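(* Let $R=\Bbbk[x_0,x_1,\dots,x_n]$, let $2\le r\le \min\{s,n\}$, and let $\mathbb{X}^{(r,s)}$ be a star-configuration in $\mathbb{P}^n$ of type $(r,s)$ defined by general forms $F_1,\dots,F_s\in R$ of degrees $d_1,\dots,d_s$. Put $d=d_1+\cdots+d_s$. Then the minimal graded free resolution of the ideal $I_{\mathbb{X}^{(r,s)}}$ is of the form $$0\to \mathbb{F}_r^{(r,s)}\to \mathbb{F}_{r-1}^{(r,s)}\to\cdots\to \mathbb{F}_1^{(r,s)}\to I_{\mathbb{X}^{(r,s)}}\to 0,$$ where, for $1\le \ell\le r$, $$\mathbb{F}_\ell^{(r,s)}=\bigoplus_{1\le i_1<\cdots<i_{r-\ell}\le s} R^{\alpha_\ell^{(r,s)}}\bigl(-(d-(d_{i_1}+\cdots+d_{i_{r-\ell}}))\bigr),\qquad \alpha_\ell^{(r,s)}=\binom{s-r+\ell-1}{\ell-1}$$ (so that $\mathbb{F}_r^{(r,s)}=R^{\alpha_r^{(r,s)}}(-d)$ and $\alpha_1^{(r,s)}=1$), and $$\operatorname{rank}\mathbb{F}_\ell^{(r,s)}=\binom{s-r+\ell-1}{\ell-1}\cdot\binom{s}{r-\ell}.$$ In particular, the last free module $\mathbb{F}_r^{(r,s)}$ has only one shift $d$, i.e. the star-configuration $\mathbb{X}^{(r,s)}$ is level. Furthermore, any star-configuration $\mathbb{X}^{(r,s)}$ in $\mathbb{P}^n$ is arithmetically Cohen-Macaulay.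
   Context: $\Bbbk$ is an infinite field of arbitrary characteristic and $R$ has the standard grading. Forms are homogeneous polynomials of positive degree; an assertion about ''general forms $F_1,\dots,F_s$ of degrees $d_1,\dots,d_s$'' means that it holds for all $(F_1,\dots,F_s)$ in some nonempty Zariski-open subset of $R_{d_1}\times\cdots\times R_{d_s}$. For $1\le r\le\min\{s,n\}$, the star-configuration in $\mathbb{P}^n$ of type $(r,s)$ defined by general forms $F_1,\dots,F_s$ is the subscheme $\mathbb{X}=\mathbb{X}^{(r,s)}$ of $\mathbb{P}^n$ defined by the ideal $I_{\mathbb{X}}=\bigcap_{1\le i_1<\cdots<i_r\le s}(F_{i_1},\dots,F_{i_r})$. A subscheme $\mathbb{X}$ is arithmetically Cohen-Macaulay if $R/I_{\mathbb{X}}$ is a Cohen-Macaulay ring. It is level if, in addition, the last free module in the minimal graded free resolution is generated in a single degree. *)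

(* Defs.v *)
(* MathComp with multinomials: {mpoly k[n.+1]} is k[x_0, ..., x_n] and
   dhomog n.+1 k e is its space of homogeneous polynomials of degree e.
   Ideals are Prop-valued predicates, since they need not be decidable. *)
From HB Require Import structures.
From mathcomp Require Import all_boot all_order all_algebra.
From mathcomp Require Import mpoly.

Set Implicit Arguments.
Unset Strict Implicit.
Unset Printing Implicit Defensive.

Import GRing.Theory.
Local Open Scope ring_scope.

Section CommutativeAlgebra.
Variable A : comNzRingType.
Implicit Types (I J P : A -> Prop) (xs : seq A).

Definition is_ideal I :=
  [/\ I 0, forall x y, I x -> I y -> I (x + y)
    & forall a x, I x -> I (a * x)].

Definition gen_ideal xs (y : A) : Prop :=
  exists c : 'I_(size xs) -> A, y = \sum_i c i * xs`_i.

Definition noetherian :=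
  forall I, is_ideal I -> exists xs, forall y, I y <-> gen_ideal xs y.

Definition prime_ideal P :=
  [/\ is_ideal P, ~ P 1 & forall x y, P (x * y) -> P x \/ P y].

Definition maximal_ideal P :=
  [/\ is_ideal P, ~ P 1
    & forall J, is_ideal J -> (forall x, P x -> J x) -> ~ J 1 ->
        forall x, J x -> P x].

(* P is the top of a strict chain Q 0 < Q 1 < ... < Q m of prime ideals. *)
Definition prime_chain P (m : nat) :=
  exists Q : nat -> A -> Prop,
    [/\ forall i, (i <= m)%N -> prime_ideal (Q i),
        forall x, Q m x <-> P x
      & forall i, (i < m)%N ->
          (forall x, Q i x -> Q i.+1 x) /\ (exists2 x, Q i.+1 x & ~ Q i x)].

Definition has_height P (m : nat) :=
  prime_chain P m /\ forall m', prime_chain P m' -> (m' <= m)%N.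

Definition regular_seq xs :=
  ~ gen_ideal xs 1 /\
  forall i, (i < size xs)%N -> forall y,
    gen_ideal (take i xs) (xs`_i * y) -> gen_ideal (take i xs) y.

Definition regular_seq_in P xs := regular_seq xs /\ {in xs, forall x, P x}.

Definition has_depth P (m : nat) :=
  (exists2 xs, regular_seq_in P xs & size xs = m) /\
  forall xs, regular_seq_in P xs -> (size xs <= m)%N.

(* Eisenbud's form of the definition, depth P = codim P for all maximal P;
   it needs no localization. *)
Definition cohen_macaulay :=
  noetherian /\
  forall P, maximal_ideal P -> exists m, has_depth P m /\ has_height P m.

End CommutativeAlgebra.

(* "R / I is a Cohen-Macaulay ring": A is the quotient R / I, given with its
   projection p.  All such A are isomorphic, so the choice of A is immaterial. *)
Definition cohen_macaulay_quotient (R : comNzRingType) (I : R -> Prop) :=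
  exists (A : comNzRingType) (p : {rmorphism R -> A}),
    [/\ forall a, exists f, p f = a,
        forall f, p f = 0 <-> I f
      & cohen_macaulay A].

Section GradedResolutions.
Variables (k : fieldType) (n : nat).
Local Notation R := {mpoly k[n.+1]}.

(* A sequence a = [:: a_0; ...; a_(b-1)] of shifts stands for the graded free
   module R(-a_0) + ... + R(-a_(b-1)), whose elements are row vectors; maps act
   by right multiplication.  Nonnegative a_i suffice for resolving an ideal. *)

(* f lies in the degree e component of R(-a). *)
Definition shifted_homog (a e : nat) (f : R) : bool :=
  if (a <= e)%N then f \is (e - a).-homog else f == 0.

Definition graded_map (a b : seq nat) (M : 'M[R]_(size a, size b)) :=
  forall (i : 'I_(size a)) (j : 'I_(size b)),
    shifted_homog (nth 0%N b j) (nth 0%N a i) (M i j).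

(* The image is contained in (x_0, ..., x_n) times the target. *)
Definition minimal_map (a b : seq nat) (M : 'M[R]_(size a, size b)) :=
  forall i j, (M i j)@_0%MM = 0.

(* F 1, ..., F c are the modules of a minimal graded free resolution
      0 -> F c -> ... -> F 1 -> I -> 0,
   with eps : F 1 -> I and D l : F l.+1 -> F l.  The values F 0 and F l,
   c < l, are not used.  Minimality of F 1 -> I is the case l = 1 of the
   condition on D, as ker eps is the image of D 1 (or 0 if c = 1). *)
Definition min_graded_free_resolution
    (I : R -> Prop) (c : nat) (F : nat -> seq nat) :=
  exists (eps : 'cV[R]_(size (F 1%N)))
         (D : forall l, 'M[R]_(size (F l.+1), size (F l))),
  let boundary l (v : 'rV[R]_(size (F l))) :=
    if (l < c)%N then exists w, v = w *m D l else v = 0 in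
  [/\ (0 < c)%N,
      (forall i : 'I_(size (F 1%N)), shifted_homog 0 (nth 0%N (F 1%N) i) (eps i 0)) /\
      (forall f, I f <-> exists v : 'rV_(size (F 1%N)), (v *m eps) 0 0 = f),
      forall l, (0 < l < c)%N -> graded_map (D l) /\ minimal_map (D l),
      forall v, v *m eps = 0 <-> boundary 1%N v
    & forall l, (0 < l < c)%N ->
        forall v, v *m D l = 0 <-> boundary l.+1 v].

Definition arithmetically_CM (I : R -> Prop) := cohen_macaulay_quotient I.

(* Minimal graded free resolutions are unique up to isomorphism, so "the"
   minimal resolution is rendered by an existential. *)
Definition level (I : R -> Prop) :=
  arithmetically_CM I /\
  exists (c : nat) (F : nat -> seq nat) (e : nat),
    [/\ min_graded_free_resolution I c F, F c <> [::] & all (pred1 e) (F c)].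

End GradedResolutions.

Section GeneralForms.
Variables (k : fieldType) (n s : nat) (d : 'I_s -> nat).

(* R_{d_1} x ... x R_{d_s} *)
Definition forms := forall i : 'I_s, dhomog n.+1 k (d i).

(* Pairs (i, m) with m a monomial of degree at most d i.  The coefficients of
   the monomials of degree < d i vanish identically on forms, so they do not
   affect the topology. *)
Definition coef_index := {i : 'I_s & 'X_{1..n.+1 < (d i).+1}}.

Definition form_coefs (F : forms) (j : 'I_#|{: coef_index}|) : k :=
  (F (tag (enum_val j)) : {mpoly k[n.+1]})@_(tagged (enum_val j)).

(* U is the complement of the common zero locus of a set S of polynomials. *)
Definition zariski_open (U : forms -> Prop) :=
  exists S : {mpoly k[#|{: coef_index}|]} -> Prop,
    forall F, U F <-> exists2 p, S p & p.@[form_coefs F] != 0.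

Definition for_general_forms (P : forms -> Prop) :=
  exists U, [/\ zariski_open U, exists F, U F & forall F, U F -> P F].

Definition star_ideal (r : nat) (F : forms) (f : {mpoly k[n.+1]}) : Prop :=
  forall B : {set 'I_s}, #|B| = r ->
    gen_ideal [seq (F i : {mpoly k[n.+1]}) | i <- enum B] f.

End GeneralForms.

Definition star_alpha (s r l : nat) : nat := 'C(s - r + l - 1, l - 1).

Definition star_module (s : nat) (d : 'I_s -> nat) (r l : nat) : seq nat :=
  flatten [seq nseq (star_alpha s r l)
                    (\sum_(i < s) d i - \sum_(i in B) d i)%N
          | B : {set 'I_s} <- enum [set B : {set 'I_s} | #|B| == r - l]%N].

(* Main.v *)
(* Genericity.  For forms f_0, ..., f_n of degrees e_0, ..., e_n let Phi be the k-linear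
   endomorphism of R that writes each monomial x^b in radix e and replaces the digits
   x_i^(e_i) by f_i, so that Phi (x_i^(e_i) g) = f_i Phi g.  In bounded degree Phi is a
   matrix whose entries are polynomials in the coefficients of the f_i and which is the
   identity for f_i = x_i^(e_i); hence Phi is bijective for general forms, and questions
   about the f_i reduce to questions about powers of the variables.  Applying this to
   all short lists F_b of distinct members of F_1, ..., F_s, completed by variables,
   shows that such lists are regular sequences, that p_r(x_r), ..., p_n(x_n) is weakly
   regular on R/(F_b) for monic p_i and |b| = r, and that R/(F_b) grows like a
   polynomial ring in n+1-r variables.

   Ideal and resolution.  Let J(s,q) be the ideal of the products of q distinct forms
   among the first s.  Then J(s,q) = F_s J(s-1,q-1) + J(s-1,q), and F_s is regular
   modulo J(s-1,q).  By induction the star ideal of type (r,s) is J(s,s-r+1), and it is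
   resolved by the mapping cone of
   (phi, -F_s) : C(s-1,q)(-d_s) -> C(s-1,q-1)(-d_s) + C(s-1,q), where phi lifts the
   inclusion of J(s-1,q) in J(s-1,q-1).  The cone is minimal because the lifts can be
   chosen recursively as diagonal maps, starting from the augmentations.

   Cohen-Macaulayness.  Modulo a maximal ideal every x_i is a root of some monic p_i
   (Nullstellensatz), and p_r(x_r), ..., p_n(x_n) is a regular sequence on R/J, as
   R/J is filtered by complete intersections R/(F_b).  Regular sequences give
   chains of primes, and a chain of length m gives m algebraically independent elements
   modulo some (F_b), so m <= n+1-r by the growth bound. *)
Require Import Defs.
From HB Require Import structures.
From Stdlib Require Import Classical ClassicalEpsilon.
From mathcomp Require Import all_boot all_order all_algebra.
From mathcomp Require Import ssrcomplements mpoly ring_quotient ring zify.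

Set Implicit Arguments.
Unset Strict Implicit.
Unset Printing Implicit Defensive.

Import GRing.Theory.
Local Open Scope ring_scope.


(** * Ideals, weakly regular sequences and star ideals *)

Section Ideals.
Variable A : comNzRingType.
Implicit Types (I J K P : A -> Prop) (x y : A) (xs ys : seq A).

Definition sub_ideal I J := forall x, I x -> J x.
Definition zero_ideal x := x = 0.
Definition sum_ideal I J x := exists y z, [/\ I y, J z & x = y + z].
Definition add_gen I f x := exists y a, I y /\ x = y + a * f.
Fixpoint add_gens I xs := if xs is x :: xs' then add_gens (add_gen I x) xs' else I.
Definition nzd_mod I f := forall y, I (f * y) -> I y.

(** Regularity without the condition that the final quotient is nonzero, so that it survives passing
    to the unit ideal and to extensions. *)
Fixpoint wreg I xs :=
  if xs is x :: xs' then nzd_mod I x /\ wreg (add_gen I x) xs' else True.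

Lemma ideal0 I : is_ideal I -> I 0. Proof. by case. Qed.
Lemma idealD I x y : is_ideal I -> I x -> I y -> I (x + y).
Proof. by case=> _ + _; apply. Qed.
Lemma idealMl I a x : is_ideal I -> I x -> I (a * x).
Proof. by case=> _ _; apply. Qed.
Lemma idealMr I a x : is_ideal I -> I x -> I (x * a).
Proof. by rewrite mulrC; apply: idealMl. Qed.
Lemma idealN I x : is_ideal I -> I x -> I (- x).
Proof. by rewrite -mulN1r; apply: idealMl. Qed.
Lemma idealB I x y : is_ideal I -> I x -> I y -> I (x - y).
Proof. by move=> hI hx hy; apply: idealD => //; apply: idealN. Qed.
Lemma idealDr I x y : is_ideal I -> I y -> I (x + y) -> I x.
Proof. by move=> hI hy hxy; rewrite -(addrK y x); apply: idealB. Qed.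
Lemma ideal_sum I (T : Type) (r : seq T) (E : pred T) (G : T -> A) :
  is_ideal I -> (forall i, E i -> I (G i)) -> I (\sum_(i <- r | E i) G i).
Proof.
by move=> hI hG; apply: big_ind => //; [exact: ideal0 | move=> *; apply: idealD].
Qed.

Lemma zero_is_ideal : is_ideal zero_ideal.
Proof.
rewrite /zero_ideal; split=> [//|x y -> ->|a x ->]; first by rewrite addr0.
by rewrite mulr0.
Qed.

Lemma add_gen_ideal I f : is_ideal I -> is_ideal (add_gen I f).
Proof.
move=> hI; split.
- by exists 0, 0; rewrite mul0r addr0; split=> //; apply: ideal0.
- move=> _ _ [y [a [hy ->]]] [z [b [hz ->]]]; exists (y + z), (a + b).
  by split; [apply: idealD | ring].
- move=> c _ [y [a [hy ->]]]; exists (c * y), (c * a).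
  by split; [apply: idealMl | ring].
Qed.

Lemma add_gen_sub I f : sub_ideal I (add_gen I f).
Proof. by move=> x hx; exists x, 0; rewrite mul0r addr0. Qed.

Lemma add_gen_gen I f : is_ideal I -> add_gen I f f.
Proof. by move=> hI; exists 0, 1; rewrite mul1r add0r; split=> //; apply: ideal0. Qed.

Lemma add_gen_min I f J : is_ideal J -> sub_ideal I J -> J f -> sub_ideal (add_gen I f) J.
Proof.
move=> hJ IJ Jf _ [y [a [hy ->]]]; apply: idealD => //; first exact: IJ.
exact: idealMl.
Qed.

Lemma add_gens_ideal I xs : is_ideal I -> is_ideal (add_gens I xs).
Proof. by elim: xs I => //= x xs IH I hI; apply: IH; apply: add_gen_ideal. Qed.

Lemma add_gens_sub I xs : sub_ideal I (add_gens I xs).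
Proof. by elim: xs I => [|x xs IH] I y hy //=; apply: IH; apply: add_gen_sub. Qed.

Lemma add_gens_gen I xs x : is_ideal I -> x \in xs -> add_gens I xs x.
Proof.
elim: xs I => //= y xs IH I hI; rewrite inE => /orP[/eqP->|hx].
  by apply: add_gens_sub; apply: add_gen_gen.
by apply: IH => //; apply: add_gen_ideal.
Qed.

Lemma add_gens_min I xs J : is_ideal J -> sub_ideal I J ->
  (forall x, x \in xs -> J x) -> sub_ideal (add_gens I xs) J.
Proof.
move=> hJ; elim: xs I => //= x xs IH I IJ hx; apply: IH => [|y hy].
  by apply: add_gen_min => //; apply: hx; rewrite mem_head.
by apply: hx; rewrite inE hy orbT.
Qed.

Lemma add_gens_mono I J xs ys : is_ideal J -> sub_ideal I J -> {subset xs <= ys} ->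
  sub_ideal (add_gens I xs) (add_gens J ys).
Proof.
move=> hJ IJ xy; apply: add_gens_min; first exact: add_gens_ideal.
  by move=> x /IJ; apply: add_gens_sub.
by move=> x /xy; apply: add_gens_gen.
Qed.

Lemma add_gens_cat I xs ys : add_gens I (xs ++ ys) = add_gens (add_gens I xs) ys.
Proof. by elim: xs I => //= x xs IH I; apply: IH. Qed.

Lemma gen_ideal_ideal xs : is_ideal (gen_ideal xs).
Proof.
split.
- by exists (fun=> 0); rewrite big1 // => i _; rewrite mul0r.
- move=> _ _ [c ->] [e ->]; exists (fun i => c i + e i).
  by rewrite -big_split; apply: eq_bigr => i _; rewrite mulrDl.
- move=> a _ [c ->]; exists (fun i => a * c i).
  by rewrite mulr_sumr; apply: eq_bigr => i _; rewrite mulrA.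
Qed.

Lemma gen_ideal_gen xs x : x \in xs -> gen_ideal xs x.
Proof.
move=> hx; have hi : (index x xs < size xs)%N by rewrite index_mem.
exists (fun i => (i == Ordinal hi)%:R).
rewrite (bigD1 (Ordinal hi)) //= eqxx mul1r nth_index // big1 ?addr0 // => i.
by move/negbTE->; rewrite mul0r.
Qed.

Lemma gen_ideal_min xs J : is_ideal J -> (forall x, x \in xs -> J x) ->
  sub_ideal (gen_ideal xs) J.
Proof.
move=> hJ hx _ [c ->]; apply: ideal_sum => // i _; apply: idealMl => //.
by apply: hx; rewrite mem_nth.
Qed.

Lemma gen_idealE xs x : gen_ideal xs x <-> add_gens zero_ideal xs x.
Proof.
have h0 := zero_is_ideal; split.
  apply: gen_ideal_min; first exact: add_gens_ideal.
  by move=> y hy; apply: add_gens_gen.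
apply: add_gens_min; first exact: gen_ideal_ideal.
  by move=> y ->; apply: ideal0; apply: gen_ideal_ideal.
by move=> y hy; apply: gen_ideal_gen.
Qed.

Lemma wreg_nthP I xs : wreg I xs <->
  forall i, (i < size xs)%N -> nzd_mod (add_gens I (take i xs)) xs`_i.
Proof.
elim: xs I => [|x xs IH] I //=; split.
  by case=> hx /IH h [|i] //= hi; apply: h.
move=> h; split; first exact: (h 0%N).
by apply/IH => i hi; apply: (h i.+1).
Qed.

Lemma wreg_ext I J xs : (forall x, I x <-> J x) -> wreg I xs -> wreg J xs.
Proof.
elim: xs I J => //= x xs IH I J IJ [h1 h2]; split.
  by move=> y /IJ /h1 /IJ.
apply: IH h2 => y; split=> -[z [a [/IJ hz ->]]]; by exists z, a.
Qed.

Lemma wreg_total I xs : (forall x, I x) -> wreg I xs.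
Proof.
elim: xs I => //= x xs IH I h; split; first by move=> y _.
by apply: IH => y; apply: add_gen_sub.
Qed.

(* A sequence that is weakly regular on the outer terms of
   0 -> A/I --f--> A/J -> A/(J + (f)) -> 0 is weakly regular on the middle one. *)
Lemma wreg_extension I J K f xs : is_ideal I -> is_ideal J ->
  (forall a, J (f * a) <-> I a) -> (forall x, K x <-> add_gen J f x) ->
  wreg I xs -> wreg K xs -> wreg J xs.
Proof.
move=> hI hJ JI KJ wI /(wreg_ext KJ) {KJ K}.
elim: xs I J hI hJ JI wI => //= x xs IH I J hI hJ JI [xI wI] [xK wK].
have hK := add_gen_ideal f hJ.
have xJ : nzd_mod J x.
  (* A diagram chase: y is b + a f because x is regular on the right-hand term, and then a lies in I
     because x is regular on the left-hand one. *)
  move=> y hy; have [b [a [hb e]]] : add_gen J f y by apply: xK; apply: add_gen_sub.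
  rewrite e; apply: idealD => //; rewrite mulrC; apply/JI; apply: xI; apply/JI.
  rewrite (_ : f * (x * a) = x * y - x * b); last by rewrite e; ring.
  by apply: idealB => //; apply: idealMl.
(* The sequence stays exact after dividing by x, because x is regular on the right-hand term. *)
split=> //; apply: (IH (add_gen I x)) => //; try exact: add_gen_ideal.
  move=> a; split.
    case=> b [c [hb e]].
    have [b' [a' [hb' e']]] : add_gen J f c.
      by apply: xK; exists (- b), a; split; [apply: idealN | rewrite (mulrC a) e; ring].
    have /JI hI' : J (f * (a - x * a')).
      rewrite (_ : f * (a - x * a') = b + x * b'); last by rewrite mulrBr e e'; ring.
      by apply: idealD => //; apply: idealMl.
    by exists (a - x * a'), a'; split=> //; ring.
  case=> b [c [/JI hb ->]]; exists (f * b), (f * c); split=> //; ring.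
apply: wreg_ext wK => y; split=> -[_ [a [[z [b [hz ->]]] ->]]].
  exists (z + a * x), b; split; last by ring.
  by exists z, a.
exists (z + a * f), b; split; last by ring.
by exists z, a.
Qed.

End Ideals.

(** * Intersections of complete intersections and ideals of products *)

Section StarIdeals.
Variables (A : comNzRingType) (T : eqType) (F : T -> A).
Implicit Types (I J : A -> Prop) (ts bs : seq T).

(* The intersection of the ideals I + (F b | b in bs) over the r-element
   sublists bs of ts. *)
Fixpoint star I ts (r : nat) : A -> Prop :=
  match r, ts with
  | 0, _ => I
  | r'.+1, [::] => fun=> True
  | r'.+1, t :: ts' => fun x => star I ts' r x /\ star (add_gen I (F t)) ts' r' x
  end.

(* The ideal generated by the products of q distinct members of F over ts. *)
Fixpoint prods ts (q : nat) : A -> Prop :=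
  match q, ts with
  | 0, _ => fun=> True
  | q'.+1, [::] => @zero_ideal A
  | q'.+1, t :: ts' => fun x => exists y z,
      [/\ prods ts' q' y, prods ts' q z & x = F t * y + z]
  end.

(** The form in which genericity enters the ideal computations. It does not depend on the order of
    the members, hence passes to sublists and, with r lowered by one, to I enlarged by a member. *)
Definition regular_upto I ts (r : nat) := forall bs t, uniq (rcons bs t) ->
  {subset rcons bs t <= ts} -> (size bs <= r)%N ->
  nzd_mod (add_gens I (map F bs)) (F t).

Lemma star_ideal_is_ideal I ts r : is_ideal I -> is_ideal (star I ts r).
Proof.
elim: ts I r => [|t ts IH] I [|r] //= hI.
have [h1 h2 h3] := IH I r.+1 hI.
have [k1 k2 k3] := IH _ r (add_gen_ideal (F t) hI).
split=> [//|x y [? ?] [? ?]|a x [? ?]]; split; by [apply: h2|apply: k2|apply: h3|apply: k3].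
Qed.

Lemma prods_ideal ts q : is_ideal (prods ts q).
Proof.
elim: ts q => [|t ts IH] [|q] //=; first exact: zero_is_ideal.
have hq := IH q; have hq1 := IH q.+1; split.
- by exists 0, 0; split; [exact: ideal0 | exact: ideal0 | rewrite mulr0 addr0].
- move=> _ _ [y [z [hy hz ->]]] [y' [z' [hy' hz' ->]]].
  by exists (y + y'), (z + z'); split; [apply: idealD | apply: idealD | ring].
- move=> a _ [y [z [hy hz ->]]].
  by exists (a * y), (a * z); split; [apply: idealMl | apply: idealMl | ring].
Qed.

Lemma prodsS ts q : sub_ideal (prods ts q.+1) (prods ts q).
Proof.
elim: ts q => [|t ts IH] [|q] //= x [y [z [hy hz ->]]].
by exists y, z; split=> //; apply: IH.
Qed.

Lemma prods0 ts q : (size ts < q)%N -> forall x, prods ts q x -> x = 0.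
Proof.
elim: ts q => [|t ts IH] [|q] //=; rewrite ltnS => h x [y [z [hy hz ->]]].
by rewrite (IH _ h _ hy) (IH _ (leqW h) _ hz) mulr0 addr0.
Qed.

(** The two conjuncts of the recursion correspond to the sublists that omit the head and those that
    contain it. *)
Lemma starP I ts r x : star I ts r x <->
  forall bs, subseq bs ts -> size bs = r -> add_gens I (map F bs) x.
Proof.
elim: ts I r => [|t ts IH] I [|r] //=.
- by split=> [hx bs _ /size0nil-> //|/(_ [::])]; apply.
- by split=> // _ bs /eqP->.
- split=> [hx bs _ /size0nil-> //|/(_ [::])]; exact.
split.
  case=> /IH h1 /IH h2 [|b bs] //=; case: eqP => [->|_] hs hr.
    by apply: h2 => //; case: hr.
  exact: h1 (b :: bs) _ _.
move=> h; split; apply/IH => bs hs hr.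
  by apply: h => //; exact: (subseq_trans hs (subseq_cons ts t)).
by apply: (h (t :: bs)) => /=; rewrite ?eqxx ?hr.
Qed.

Lemma star_sub I ts r : sub_ideal I (star I ts r).
Proof. by move=> x hx; apply/starP => bs _ _; apply: add_gens_sub. Qed.

Lemma star_total I ts r : (size ts < r)%N -> forall x, star I ts r x.
Proof.
move=> h x; apply/starP => bs /size_subseq hb e.
by move: h; rewrite -e ltnNge hb.
Qed.

Lemma regular_uptoW I t ts r : regular_upto I (t :: ts) r -> regular_upto I ts r.
Proof.
move=> h bs b hu hs hr; apply: h => // x /hs hx.
by rewrite inE hx orbT.
Qed.

Lemma regular_upto_cons I t ts r : t \notin ts ->
  regular_upto I (t :: ts) r.+1 -> regular_upto (add_gen I (F t)) ts r.
Proof.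
move=> ht h bs b hu hs hr; apply: (h (t :: bs)) => //=.
  by rewrite hu andbT; apply: contra ht; apply: hs.
move=> x; rewrite !inE => /orP[->//|/hs->]; exact: orbT.
Qed.

(** [F t] is regular modulo each of the intersected ideals, and regularity passes to
    intersections. *)
Lemma nzd_star I t ts r : uniq (t :: ts) -> regular_upto I (t :: ts) r ->
  nzd_mod (star I ts r) (F t).
Proof.
move=> /andP[ht hu] h y /starP hy; apply/starP => bs hs hr.
have sbs : {subset bs <= ts} by apply: mem_subseq.
apply: h (hy bs hs hr); last by rewrite hr.
  rewrite rcons_uniq (subseq_uniq hs hu) andbT.
  by apply: contra ht; apply: sbs.
by move=> x; rewrite mem_rcons !inE => /orP[->//|/sbs->]; apply: orbT.
Qed.

(** Here q is size ts - r + 1. An x in the intersection is i + a F t + z by the sublists containing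
    t; regularity of [F t] modulo the intersection over the sublists without t puts a into that
    intersection, and induction describes a. *)
Lemma star_prods I ts r q : is_ideal I -> uniq ts -> regular_upto I ts r ->
  (size ts).+1 = (q + r)%N ->
  forall x, star I ts r x <-> sum_ideal I (prods ts q) x.
Proof.
elim: ts I r q => [|t ts IH] I r q hI.
  case: r q => [|r] [|[|q]] //= _ _ e x; try lia.
    split=> [hx|[y [z [hy -> ->]]]]; last by rewrite addr0.
    by exists x, 0; split=> //; rewrite addr0.
  by split=> // _; exists 0, x; split=> //; [exact: ideal0 | rewrite add0r].
move=> /= /andP[ht hu] reg e x.
(* If q = 0, then r exceeds the length and both sides are the unit ideal; if r = 0, then q exceeds
   the length and all products vanish. *)
case: q e => [|q] e.
  split=> [_|_]; last by apply: (@star_total I (t :: ts) r) => /=; lia.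
  by exists 0, x; split=> //; [exact: ideal0 | rewrite add0r].
case: r reg e => [|r] reg e /=.
  split=> [hx|[y [z [hy [z1 [z2 [h1 h2 ->]]] ->]]]].
    exists x, 0; split=> //; last by rewrite addr0.
    exists 0, 0; split; rewrite ?mulr0 ?addr0 //; apply: ideal0; exact: prods_ideal.
  by rewrite (prods0 _ h1) ?(prods0 _ h2) ?mulr0 ?addr0 //; lia.
have hI' := add_gen_ideal (F t) hI.
have reg1 := regular_uptoW reg.
have e1 : (size ts).+1 = (q + r.+1)%N by lia.
have e2 : (size ts).+1 = (q.+1 + r)%N by lia.
have IH1 := IH I _ _ hI hu reg1 e1.
have IH2 := IH _ _ _ hI' hu (regular_upto_cons ht reg) e2.
split.
  case=> h1 /IH2 [_ [z [[i [a [hi ->]]] hz ex]]].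
  have ha : star I ts r.+1 a.
    have := @nzd_star I t ts r.+1; rewrite /= ht hu; apply=> //.
    have := star_ideal_is_ideal ts r.+1 hI => hS.
    rewrite (_ : F t * a = x - i - z); last by rewrite ex; ring.
    apply: idealB => //; first by apply: idealB => //; apply: star_sub.
    by apply/IH1; exists 0, z; split; [exact: ideal0 | exact: prodsS | rewrite add0r].
  have /IH1 [i' [j [hi' hj ea]]] := ha.
  exists (i + i' * F t), (F t * j + z); split.
  - by apply: idealD => //; apply: idealMr.
  - by exists j, z.
  - by rewrite ex ea; ring.
case=> i [_ [hi [y [z [hy hz ->]]] ->]]; split.
  apply/IH1; exists i, (F t * y + z); split=> //.
  have hP := prods_ideal ts q.
  by apply: idealD => //; [apply: idealMl | apply: prodsS].
apply/IH2; exists (i + y * F t), z; split=> //; last by ring.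
by exists i, y.
Qed.

(** Multiplication by [F t] gives 0 -> A/star(I, ts, r+1) -> A/star(I, t :: ts, r+1) -> A/star(I +
    (F t), ts, r) -> 0. Induction on the list thus filters the quotient by complete intersections of
    r members. *)
Lemma wreg_star I ts r xs : is_ideal I -> uniq ts -> regular_upto I ts r ->
  (forall bs, uniq bs -> {subset bs <= ts} -> size bs = r ->
    wreg (add_gens I (map F bs)) xs) ->
  wreg (star I ts r) xs.
Proof.
elim: ts I r => [|t ts IH] I [|r] hI; try by move=> _ _ /(_ [::]); apply.
  by move=> _ _ _; apply: wreg_total.
move=> /= /andP[ht hu] reg hw.
case: (leqP r (size ts)) => hr; last first.
  by apply: wreg_total => x; split; apply: star_total => //; apply: leqW.
have hI' := add_gen_ideal (F t) hI.
have reg1 := regular_uptoW reg.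
have reg2 := regular_upto_cons ht reg.
have hS1 := star_ideal_is_ideal ts r.+1 hI.
have hS2 := star_ideal_is_ideal ts r hI'.
have e1 : (size ts).+1 = ((size ts - r) + r.+1)%N by lia.
have e2 : (size ts).+1 = ((size ts - r).+1 + r)%N by lia.
have hS : is_ideal (star I (t :: ts) r.+1) by apply: star_ideal_is_ideal.
have hz : nzd_mod (star I ts r.+1) (F t).
  by apply: nzd_star; rewrite /= ?ht ?hu.
have hF : star (add_gen I (F t)) ts r (F t).
  by apply: star_sub; apply: add_gen_gen.
apply: (@wreg_extension _ (star I ts r.+1) _ (star (add_gen I (F t)) ts r) (F t)) => //.
- move=> a; split=> [[+ _]|ha]; first exact: hz.
  by split; [apply: idealMl | apply: idealMr].
- move=> x; split; last first.
    by apply: add_gen_min => // y [].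
  move/(star_prods hI' hu reg2 e2) => [_ [z [[i [a [hi ->]]] hz' ->]]].
  exists (i + z), a; split; last by ring.
  split.
    apply/(star_prods hI hu reg1 e1); exists i, z; split=> //; exact: prodsS.
  apply/(star_prods hI' hu reg2 e2); exists i, z; split=> //; exact: add_gen_sub.
- apply: IH => // bs ub sb sz; apply: hw => // x /sb hx.
  by rewrite inE hx orbT.
- apply: IH => // bs ub sb sz; apply: (hw (t :: bs)); rewrite /= ?sz //.
    by rewrite ub andbT; apply: contra ht; apply: sb.
  by move=> x; rewrite !inE => /orP[->//|/sb->]; apply: orbT.
Qed.

(** A prime that avoids q members avoids their product. So at most q - 1 = size ts - r members lie
    outside P, and at least r lie in it. *)
Lemma prime_prods P ts r q : prime_ideal P -> (size ts).+1 = (q + r)%N ->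
  sub_ideal (prods ts q) P ->
  exists2 bs, subseq bs ts /\ size bs = r & forall b, b \in bs -> P (F b).
Proof.
move=> [hP P1 Pm]; elim: ts r q => [|t ts IH] r [|q] /= e hs;
  try by case: P1; apply: hs.
  by exists [::] => //; split=> //=; lia.
case: r e => [|r] e; first by exists [::].
case: (classic (P (F t))) => ht.
  have [||bs [hb1 hb2] hb3] := IH r q.+1; first by lia.
    move=> x hx; apply: hs; exists 0, x; split=> //; last by rewrite mulr0 add0r.
    by apply: ideal0; apply: prods_ideal.
  exists (t :: bs); first by rewrite /= eqxx hb2.
  by move=> b; rewrite inE => /orP[/eqP->|/hb3].
have [||bs [hb1 hb2] hb3] := IH r.+1 q; first by lia.
  move=> x hx; have /Pm[//|//] : P (F t * x).
  apply: hs; exists x, 0; split=> //; last by rewrite addr0.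
  by apply: ideal0; apply: prods_ideal.
by exists bs => //; split=> //; exact: (subseq_trans hb1 (subseq_cons ts t)).
Qed.

End StarIdeals.

Lemma star_idealE (k : fieldType) n s (d : 'I_s -> nat) (F : forms k n d) r f :
  star_ideal r F f <->
  star (fun i => F i : {mpoly k[n.+1]}) (@zero_ideal _) (enum 'I_s) r f.
Proof.
rewrite starP; split.
  move=> h bs hs hr; have ub : uniq bs by apply: subseq_uniq hs (enum_uniq _).
  have := h [set x in bs]; rewrite cardsE (card_uniqP ub) => /(_ hr) /gen_idealE.
  apply: add_gens_mono => //; first exact: zero_is_ideal.
  move=> x /mapP[i + ->]; rewrite mem_enum inE => hi; exact: map_f.
move=> h B hB; apply/gen_idealE; apply: (h (enum B)); last by rewrite -cardE.
by rewrite (enumT 'I_s) /enum_mem filter_subseq.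
Qed.

(** * Noetherian rings and chains of primes *)

Section Noetherian.

(** B is generated as a ring by [zs] and the image of [phi], phrased as an induction principle. *)
Definition generates (D B : comNzRingType) (phi : D -> B) (zs : seq B) :=
  forall Q : B -> Prop, (forall d, Q (phi d)) -> (forall z, z \in zs -> Q z) ->
    (forall x y, Q x -> Q y -> Q (x + y)) ->
    (forall x y, Q x -> Q y -> Q (x * y)) -> forall b, Q b.

Lemma noetherian_field (k : fieldType) : noetherian k.
Proof.
move=> I hI; case: (classic (exists2 x, I x & x != 0)) => [[x hx x0]|h].
  exists [:: 1] => y; split=> _.
    by exists (fun=> y); rewrite big_ord1 mulr1.
  by rewrite -[y](mulfVK x0); apply: idealMl.
exists [::] => y; split=> [hy|[c ->]]; last by rewrite big_ord0; apply: ideal0.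
exists (fun=> 0); rewrite big_ord0; apply/eqP/negPn/negP => y0.
by case: h; exists y.
Qed.

Lemma noetherian_surj (D B : comNzRingType) (phi : {rmorphism D -> B}) :
  (forall b, exists d, phi d = b) -> noetherian D -> noetherian B.
Proof.
move=> surj nD I hI.
have [|xs hxs] := nD (fun x => I (phi x)).
  split=> [|x y hx hy|a x hx]; rewrite ?rmorph0 ?rmorphD ?rmorphM.
  - exact: ideal0.
  - exact: idealD.
  - exact: idealMl.
exists (map phi xs) => y; split; last first.
  by apply: gen_ideal_min => // _ /mapP[x hx ->]; apply/hxs; apply: gen_ideal_gen.
have [x <-] := surj y; move/hxs.
have hJ := gen_ideal_ideal (map phi xs).
apply: (@gen_ideal_min _ _ (fun x => gen_ideal (map phi xs) (phi x))).
  split=> [|u v hu hv|a u hu]; rewrite ?rmorph0 ?rmorphD ?rmorphM.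
  - exact: ideal0.
  - exact: idealD.
  - exact: idealMl.
by move=> u hu; apply: gen_ideal_gen; apply: map_f.
Qed.

Lemma bounded_list (T : eqType) (L : nat -> T -> Prop) (xs : seq T) :
  (forall n x, L n x -> L n.+1 x) -> (forall x, x \in xs -> exists n, L n x) ->
  exists n, forall x, x \in xs -> L n x.
Proof.
move=> mono; have monoD n m x : L n x -> L (m + n)%N x.
  by move=> h; elim: m => //= m; apply: mono.
elim: xs => [|x xs IH] h; first by exists 0%N.
have [|n hn] := IH; first by move=> y hy; apply: h; rewrite inE hy orbT.
have [m hm] := h x (mem_head _ _).
exists (m + n)%N => y; rewrite inE => /orP[/eqP->|/hn]; last exact: monoD.
by rewrite addnC; apply: monoD.
Qed.

(* Hilbert's basis theorem, with [lcoefs n] the ideal of the coefficients of 'X^n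
   in the members of I of degree at most n. *)
Lemma noetherian_poly (D : comNzRingType) : noetherian D -> noetherian {poly D}.
Proof.
move=> nD I hI.
pose lcoefs n a := exists p : {poly D}, [/\ I p, (size p <= n.+1)%N & p`_n = a].
have lS n a : lcoefs n a -> lcoefs n.+1 a.
  move=> [p [hp sp <-]]; exists (p * 'X); split; first exact: idealMr.
    by apply: leq_trans (size_polyMleq _ _) _; rewrite size_polyX addn2.
  by rewrite coefMX.
have lI n : is_ideal (lcoefs n).
  split.
  - by exists 0; rewrite size_poly0 coef0; split=> //; apply: ideal0.
  - move=> _ _ [p [hp sp <-]] [q [hq sq <-]]; exists (p + q); rewrite coefD.
    split=> //; first exact: idealD.
    by apply: leq_trans (size_polyD _ _) _; rewrite geq_max sp.
  - move=> a _ [p [hp sp <-]]; exists (a *: p); rewrite coefZ.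
    split=> //; first by rewrite -mul_polyC; apply: idealMl.
    exact: leq_trans (size_scale_leq _ _) sp.
have lD n m a : lcoefs n a -> lcoefs (m + n)%N a.
  by move=> h; elim: m => //= m; apply: lS.
(* The coefficient ideals increase with n; their union is finitely generated, so they are stationary
   from some N on. *)
have [|xs hxs] := nD (fun a => exists n, lcoefs n a).
  split.
  - by exists 0%N; apply: ideal0.
  - move=> x y [n hx] [m hy]; exists (n + m)%N; apply: idealD => //.
      by rewrite addnC; apply: lD.
    exact: lD.
  - by move=> a x [n hx]; exists n; apply: idealMl.
have [||N hN] := @bounded_list _ lcoefs xs; first exact: lS.
  by move=> x hx; apply/hxs; apply: gen_ideal_gen.
have stab n a : lcoefs n a -> lcoefs N a.
  by move=> h; apply: (@gen_ideal_min _ xs) => //; apply/hxs; exists n.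
pose lcoef_of (gs : seq {poly D}) n a :=
  exists p, [/\ gen_ideal gs p, (size p <= n.+1)%N & p`_n = a].
pose covers (gs : seq {poly D}) n := forall a, lcoefs n a -> lcoef_of gs n a.
have one n : exists2 gs : seq {poly D}, (forall g, g \in gs -> I g) & covers gs n.
  have [ys hys] := nD _ (lI n).
  suff [gs h1 h2] : exists2 gs : seq {poly D}, (forall g, g \in gs -> I g) &
      forall y, y \in ys -> lcoef_of gs n y.
    exists gs => // a /hys; apply: (@gen_ideal_min _ ys (lcoef_of gs n)) => //.
    have hG := gen_ideal_ideal gs; split.
    - by exists 0; rewrite size_poly0 coef0; split=> //; apply: ideal0.
    - move=> _ _ [p [hp sp <-]] [q [hq sq <-]]; exists (p + q); rewrite coefD.
      split=> //; first exact: idealD.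
      by apply: leq_trans (size_polyD _ _) _; rewrite geq_max sp.
    - move=> b _ [p [hp sp <-]]; exists (b *: p); rewrite coefZ.
      split=> //; first by rewrite -mul_polyC; apply: idealMl.
      exact: leq_trans (size_scale_leq _ _) sp.
  have : forall y, y \in ys -> lcoefs n y.
    by move=> y hy; apply/hys; apply: gen_ideal_gen.
  elim: ys {hys} => [|y ys IH] h; first by exists [::].
  have [|gs h1 h2] := IH; first by move=> z hz; apply: h; rewrite inE hz orbT.
  have [p [hp sp <-]] := h y (mem_head _ _).
  exists (p :: gs); first by move=> g; rewrite inE => /orP[/eqP->|/h1].
  move=> z; rewrite inE => /orP[/eqP->|/h2 [q [hq sq <-]]].
    by exists p; split=> //; apply: gen_ideal_gen; apply: mem_head.
  exists q; split=> //; move: hq; apply: gen_ideal_min; first exact: gen_ideal_ideal.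
  by move=> g hg; apply: gen_ideal_gen; rewrite inE hg orbT.
have coversS gs gs' n : covers gs n -> {subset gs <= gs'} -> covers gs' n.
  move=> h sg a /h [p [hp sp e]]; exists p; split=> //; move: hp.
  apply: gen_ideal_min; first exact: gen_ideal_ideal.
  by move=> g /sg; apply: gen_ideal_gen.
have [gs h1 h2] : exists2 gs : seq {poly D}, (forall g, g \in gs -> I g) &
    forall n, (n <= N)%N -> covers gs n.
  elim: N {hN stab} => [|N [gs h1 h2]].
    by have [gs h1 h2] := one 0%N; exists gs => // [[|]].
  have [gs' h1' h2'] := one N.+1; exists (gs ++ gs').
    by move=> g; rewrite mem_cat => /orP[/h1|/h1'].
  move=> n; rewrite leq_eqVlt => /orP[/eqP->|/h2 h].
    by apply: coversS h2' _ => g; rewrite mem_cat orbC => ->.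
  by apply: coversS h _ => g; rewrite mem_cat => ->.
(* Above N, a polynomial found in degree N is multiplied by a power of ['X]. *)
have h3 n : covers gs n.
  case: (leqP n N) => [/h2//|hn a /stab /(h2 _ (leqnn N)) [p [hp sp <-]]].
  exists (p * 'X^(n - N)); split.
  - by apply: idealMr => //; apply: gen_ideal_ideal.
  - apply: leq_trans (size_polyMleq _ _) _; rewrite size_polyXn; lia.
  - by rewrite coefMXn ltnNge leq_subr /=; congr _`_ _; lia.
exists gs => p; split; last exact: gen_ideal_min.
have hG := gen_ideal_ideal gs.
(* Subtracting a combination of [gs] with the same top coefficient lowers the size. *)
move: {2}(size p) (leqnn (size p)) => m; elim: m p => [|m IH] p sp hp.
  by move: sp; rewrite leqn0 size_poly_eq0 => /eqP->; apply: ideal0.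
have [|q [hq sq eq]] := h3 m p`_m; first by exists p.
rewrite -[p](subrK q); apply: idealD => //; apply: IH.
  apply/leq_sizeP => j; rewrite leq_eqVlt => /orP[/eqP<-|hj].
    by rewrite coefB eq subrr.
  by rewrite coefB !nth_default ?subrr //; [apply: leq_trans sq _ | apply: leq_trans sp _].
by apply: idealB => //; move: hq; apply: gen_ideal_min.
Qed.

(** Adjoining one generator replaces D by a polynomial ring over D, so B becomes a quotient of an
    iterated polynomial ring. *)
Lemma noetherian_generated (B : comNzRingType) (zs : seq B) :
  forall (D : comNzRingType) (phi : {rmorphism D -> B}),
  generates phi zs -> noetherian D -> noetherian B.
Proof.
elim: zs => [|z zs IH] D phi gen nD.
  apply: (noetherian_surj (phi := phi)) nD => b.
  apply: (gen (fun b => exists d, phi d = b)) => //; first by move=> d; exists d.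
    by move=> _ _ [x <-] [y <-]; exists (x + y); rewrite rmorphD.
  by move=> _ _ [x <-] [y <-]; exists (x * y); rewrite rmorphM.
have cz : commr_rmorph phi z by move=> x; apply: mulrC.
apply: (IH _ (horner_morph cz)); last exact: noetherian_poly.
move=> Q h1 h2 h3 h4; apply: gen => //.
  by move=> d; rewrite -(horner_morphC cz); apply: h1.
move=> w; rewrite inE => /orP[/eqP->|/h2//].
by rewrite -(horner_morphX cz); apply: h1.
Qed.

(** If there were no such M, choice would give a strictly increasing sequence of ideals, whereas the
    finitely many generators of its union already lie in one member. *)
Lemma noetherian_maximal (A : comNzRingType) (I S : A -> Prop) : noetherian A ->
  is_ideal I -> (forall x, I x -> ~ S x) ->
  exists M, [/\ is_ideal M, sub_ideal I M, forall x, M x -> ~ S x &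
    forall J, is_ideal J -> sub_ideal M J -> (forall x, J x -> ~ S x) -> sub_ideal J M].
Proof.
move=> nA hI hS; apply: NNPP => hno.
pose fam J := [/\ is_ideal J, sub_ideal I J & forall x, J x -> ~ S x].
have step J : fam J -> exists J', [/\ fam J', sub_ideal J J' & ~ sub_ideal J' J].
  move=> [j1 j2 j3]; apply: NNPP => hJ; apply: hno; exists J; split=> //.
  move=> K k1 k2 k3; apply: NNPP => hK; apply: hJ; exists K; split=> //; split=> //.
  by move=> x /j2 /k2.
pose T := {J | fam J}.
have next (J : T) : {J' : T | sub_ideal (sval J) (sval J') /\ ~ sub_ideal (sval J') (sval J)}.
  apply: constructive_indefinite_description; case: J => J hJ /=.
  by have [J' [h1 h2 h3]] := step J hJ; exists (exist _ J' h1).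
have t0 : T by exists I; split.
pose u n := iter n (fun J => sval (next J)) t0.
have uS n : sub_ideal (sval (u n)) (sval (u n.+1)) by case: (svalP (next (u n))).
have uI n : is_ideal (sval (u n)) by case: (svalP (u n)).
have uD n m : sub_ideal (sval (u n)) (sval (u (m + n)%N)).
  by elim: m => // m IH x /IH; apply: uS.
have [|xs hxs] := nA (fun x => exists n, sval (u n) x).
  split.
  - by exists 0%N; apply: ideal0.
  - move=> x y [n hx] [m hy]; exists (n + m)%N; apply: idealD => //.
      by rewrite addnC; apply: uD.
    exact: uD.
  - by move=> a x [n hx]; exists n; apply: idealMl.
have [||N hN] := @bounded_list _ (fun n => sval (u n)) xs; first by move=> n; apply: uS.
  by move=> x hx; apply/hxs; apply: gen_ideal_gen.
case: (svalP (next (u N))) => _; apply=> x hx.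
by apply: (@gen_ideal_min _ xs) => //; apply/hxs; exists N.+1.
Qed.

(** An ideal maximal among those disjoint from S is prime: for x and y outside M both enlarged
    ideals meet S, and the product of the two elements found lies in S, and also in M if x y
    does. *)
Lemma prime_avoiding (A : comNzRingType) (I S : A -> Prop) : noetherian A ->
  is_ideal I -> S 1 -> (forall x y, S x -> S y -> S (x * y)) ->
  (forall x, I x -> ~ S x) ->
  exists M, [/\ prime_ideal M, sub_ideal I M & forall x, M x -> ~ S x].
Proof.
move=> nA hI S1 SM hS.
have [M [hM IM MS Mmax]] := noetherian_maximal nA hI hS.
exists M; split=> //; split=> //; first by move=> /MS.
have out x : ~ M x -> exists m a, [/\ M m & S (m + a * x)].
  move=> hx; apply: NNPP => hno; apply: hx.
  apply: (Mmax (add_gen M x)); [exact: add_gen_ideal|exact: add_gen_sub| |].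
    by move=> _ [m [a [hm ->]]] hs; apply: hno; exists m, a.
  exact: add_gen_gen.
move=> x y hxy; apply: NNPP => /not_or_and [/out [m [a [hm h1]]] /out [m' [a' [hm' h2]]]].
apply: MS (SM _ _ h1 h2).
rewrite (_ : _ * _ = m * (m' + a' * y) + ((a * x) * m' + (a * a') * (x * y))); last by ring.
by apply: idealD; rewrite //; [apply: idealMr | apply: idealD; rewrite //; apply: idealMl].
Qed.

(* Below a prime containing x_1, ..., x_i there is a prime containing
   x_1, ..., x_(i-1) and avoiding the multiplicative set of all x_i^a t, t outside
   the given prime: regularity keeps that set away from (x_1, ..., x_(i-1)). *)
Lemma regular_prime_chain (A : comNzRingType) (P : A -> Prop) (xs : seq A) :
  noetherian A -> prime_ideal P -> regular_seq_in P xs -> prime_chain P (size xs).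
Proof.
move=> nA pP [[_ reg] xsP].
elim/last_ind: xs P pP reg xsP => [|xs x IH] P pP reg xsP.
  by exists (fun=> P); split.
have hP : is_ideal P by case: pP.
pose S y := exists a t, ~ P t /\ y = x ^+ a * t.
have [||||M [pM JM MS]] := @prime_avoiding A (gen_ideal xs) S nA.
- exact: gen_ideal_ideal.
- by exists 0%N, 1; rewrite mulr1; split=> //; case: pP.
- move=> _ _ [a [t [ht ->]]] [b [u [hu ->]]]; exists (a + b)%N, (t * u); split.
    by case: pP => _ _ pM /pM [].
  by rewrite exprD; ring.
- move=> y hy [a [t [ht ey]]]; move: hy; rewrite {y}ey => hy; apply: ht.
  have : gen_ideal xs t.
    elim: a hy => [|a IHa]; first by rewrite expr0 mul1r.
    rewrite exprS -mulrA => hy; apply: IHa.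
    have := reg (size xs); rewrite size_rcons ltnSn nth_rcons ltnn eqxx => /(_ isT).
    by rewrite -cats1 take_size_cat //; apply.
  by apply: gen_ideal_min => // z hz; apply: xsP; rewrite mem_rcons inE hz orbT.
have Mx : ~ M x by move=> /MS; apply; exists 1%N, 1; rewrite mulr1 expr1; split=> //; case: pP.
have MP : sub_ideal M P.
  by move=> y /MS hy; apply: NNPP => hPy; apply: hy; exists 0%N, y; rewrite mul1r.
have [||Q [h1 h2 h3]] := IH M pM.
- move=> i hi; have := reg i; rewrite size_rcons (leqW hi) => /(_ isT).
  by rewrite nth_rcons hi -cats1 takel_cat // ltnW.
- by move=> y hy; apply: JM; apply: gen_ideal_gen.
(* The chain for M is prolonged by P, which contains x while M does not. *)
exists (fun i => if (i <= size xs)%N then Q i else P); rewrite size_rcons; split.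
- by move=> i _; case: ifP => // hi; apply: h1.
- by move=> y; rewrite ltnn.
- move=> i; rewrite ltnS => hi; rewrite hi; case: ltnP => hi'; first exact: h3.
  have -> : i = size xs by apply/eqP; rewrite eqn_leq hi.
  split; first by move=> y /h2 /MP.
  by exists x; [apply: xsP; rewrite mem_rcons mem_head | move=> /h2].
Qed.

End Noetherian.

(** * Residue fields *)

Section QuotientRing.
Variables (A : comNzRingType) (I : A -> Prop) (hI : is_ideal I) (I1 : ~ I 1).

(** A classical boolean version of I, as the quotient construction requires. The proof arguments let
    the ideal structure be declared on it. *)
Definition ideal_pred of is_ideal I & ~ I 1 : pred A :=
  fun x => excluded_middle_informative (I x).

Lemma ideal_predP x : reflect (I x) (ideal_pred hI I1 x).
Proof. by rewrite /ideal_pred; case: excluded_middle_informative => h; constructor. Qed.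

Lemma ideal_pred_closed : idealr_closed (ideal_pred hI I1).
Proof.
split; first by apply/ideal_predP; apply: ideal0.
  by apply/ideal_predP.
move=> a x y /ideal_predP hx /ideal_predP hy; apply/ideal_predP.
by apply: idealD => //; apply: idealMl.
Qed.

HB.instance Definition _ := isIdealr.Build A (ideal_pred hI I1) ideal_pred_closed.

Lemma quotient_ring_exists : exists (B : comNzRingType) (p : {rmorphism A -> B}),
  (forall b, exists a, p a = b) /\ (forall a, p a = 0 <-> I a).
Proof.
pose B : comNzRingType := {ideal_quot (ideal_pred hI I1 : idealr A)}.
pose p : {rmorphism A -> B} := (\pi_B)%qT.
exists B, p; split=> [b|a]; first by exists (repr b); apply: reprK.
have := Quotient.idealrBE (ideal_pred hI I1 : idealr A) a 0; rewrite subr0 => e.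
split=> [h|/ideal_predP h]; last first.
  by apply: etrans (rmorph0 p); apply/eqP; rewrite -e.
by apply/ideal_predP; apply: etrans e _; apply/eqP/(etrans h)/esym/(rmorph0 p).
Qed.

End QuotientRing.

Lemma maximal_quotient_field (A : comNzRingType) (P : A -> Prop) : maximal_ideal P ->
  exists (L : fieldType) (p : {rmorphism A -> L}),
    (forall b, exists a, p a = b) /\ (forall a, p a = 0 <-> P a).
Proof.
move=> [hP P1 Pmax]; have [B [p [surj ker]]] := quotient_ring_exists hP P1.
have inv (x : B) : {y : B | (x != 0 -> y * x = 1) /\ (x = 0 -> y = 0)}.
  apply: constructive_indefinite_description.
  case: eqP => [->|x0]; first by exists 0.
  have [a ha] := surj x.
  have [b [c [hb e]]] : add_gen P a 1.
    apply: NNPP => h; apply: x0; rewrite -ha; apply/ker.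
    apply: (Pmax (add_gen P a)) h _ _; [exact: add_gen_ideal|exact: add_gen_sub|].
    exact: add_gen_gen.
  exists (p c); split=> // _; rewrite -ha -rmorphM -(rmorph1 p) e rmorphD.
  by have /ker-> := hb; rewrite add0r.
pose inverse x := sval (inv x).
have mulVx x : x != 0 -> inverse x * x = 1 by case: (svalP (inv x)).
have inv0 : inverse 0 = 0 by case: (svalP (inv 0)) => _; apply.
pose L : fieldType := HB.pack (GRing.ComNzRing.sort B)
  (GRing.ComNzRing_isField.Build B mulVx inv0).
by exists L, p.
Qed.

(** * Subrings of a field that become fields on inverting one element *)

Section GDomain.
Variable L : fieldType.
Implicit Types (S : L -> Prop) (x y z : L) (p q r g : {poly L}).

Definition is_subring S :=
  [/\ S 1, forall x y, S x -> S y -> S (x - y) & forall x y, S x -> S y -> S (x * y)].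

Definition poly_in S p := forall i, S p`_i.
Definition adjoin S z x := exists2 p, poly_in S p & x = p.[z].

(* S[1/a] is a field for some nonzero a. *)
Definition g_domain S := exists a, [/\ S a, a != 0 &
  forall x, S x -> x != 0 -> exists N b, S b /\ x * b = a ^+ N].

Section Subring.
Variables (S : L -> Prop) (hS : is_subring S).

Lemma subring1 : S 1. Proof. by case: hS. Qed.
Lemma subringB x y : S x -> S y -> S (x - y). Proof. by case: hS => _ + _; apply. Qed.
Lemma subringM x y : S x -> S y -> S (x * y). Proof. by case: hS => _ _; apply. Qed.
Lemma subring0 : S 0. Proof. by rewrite -(subrr 1); apply: subringB; apply: subring1. Qed.
Lemma subringN x : S x -> S (- x).
Proof. by move=> hx; rewrite -sub0r; apply: subringB hx; apply: subring0. Qed.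
Lemma subringD x y : S x -> S y -> S (x + y).
Proof. by move=> hx hy; rewrite -[y]opprK; apply: subringB => //; apply: subringN. Qed.
Lemma subringX x n : S x -> S (x ^+ n).
Proof.
by move=> hx; elim: n => [|n IH]; rewrite ?exprS; [apply: subring1 | apply: subringM].
Qed.

Lemma poly_inC x : S x -> poly_in S x%:P.
Proof. by move=> hx i; rewrite coefC; case: eqP => // _; apply: subring0. Qed.
Lemma poly_inXn n : poly_in S 'X^n.
Proof. by move=> i; rewrite coefXn; case: eqP => _; [exact: subring1 | exact: subring0]. Qed.
Lemma poly_inX : poly_in S 'X. Proof. exact: (poly_inXn 1). Qed.
Lemma poly_inB p q : poly_in S p -> poly_in S q -> poly_in S (p - q).
Proof. by move=> hp hq i; rewrite coefB; apply: subringB. Qed.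
Lemma poly_inD p q : poly_in S p -> poly_in S q -> poly_in S (p + q).
Proof. by move=> hp hq i; rewrite coefD; apply: subringD. Qed.
Lemma poly_inM p q : poly_in S p -> poly_in S q -> poly_in S (p * q).
Proof.
move=> hp hq i; rewrite coefM; apply: big_ind => [|x y|j _].
- exact: subring0.
- exact: subringD.
- exact: subringM.
Qed.
Lemma poly_inZ x p : S x -> poly_in S p -> poly_in S (x *: p).
Proof. by move=> hx hp i; rewrite coefZ; apply: subringM. Qed.
Lemma poly_inE p n : poly_in S p -> poly_in S (p ^+ n).
Proof.
move=> hp; elim: n => [|n IH]; rewrite ?exprS; first exact: (poly_inC subring1).
exact: poly_inM.
Qed.

Lemma adjoin_subring z : is_subring (adjoin S z).
Proof.
split.
- by exists 1; [apply: (poly_inC subring1) | rewrite hornerC].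
- by move=> _ _ [p hp ->] [q hq ->]; exists (p - q); [apply: poly_inB | rewrite !hornerE].
- by move=> _ _ [p hp ->] [q hq ->]; exists (p * q); [apply: poly_inM | rewrite !hornerE].
Qed.

Lemma sub_adjoin z x : S x -> adjoin S z x.
Proof. by exists x%:P; [apply: poly_inC | rewrite hornerC]. Qed.

Lemma adjoin_gen z : adjoin S z z.
Proof. by exists 'X; [apply: poly_inX | rewrite hornerX]. Qed.

(** Coefficients have to stay in S, so the leading coefficient of g is cleared by multiplication
    instead of being inverted. *)
Lemma pseudo_division p g : poly_in S p -> poly_in S g -> g != 0 ->
  exists s q r, [/\ poly_in S q, poly_in S r, (size r < size g)%N &
    lead_coef g ^+ s *: p = q * g + r].
Proof.
move=> + hg g0; have [m] := ubnP (size p); elim: m p => // m IH p sp hp.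
have sg : (0 < size g)%N by rewrite size_poly_gt0.
case: (ltnP (size p) (size g)) => hs.
  exists 0%N, 0, p; split=> //; first exact: (poly_inC subring0).
  by rewrite expr0 scale1r mul0r add0r.
have [e ee] : exists e, e = (size p - size g)%N by eexists.
pose p' := lead_coef g *: p - (lead_coef p *: 'X^e) * g.
have cXg i : ('X^e * g)`_i = if (i < e)%N then 0 else g`_(i - e).
  by rewrite mulrC coefMXn.
have sp' : (size p' < m)%N.
  have : (size p' <= (size p).-1)%N.
    apply/leq_sizeP => j hj; rewrite coefB coefZ -scalerAl coefZ cXg.
    have -> : (j < e)%N = false by lia.
    move: hj; rewrite leq_eqVlt => /orP[/eqP<-|hj].
      rewrite /lead_coef mulrC (_ : ((size p).-1 - e)%N = (size g).-1); last by lia.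
      by rewrite subrr.
    have h1 : (size g <= j - e)%N by lia.
    have h2 : (size p <= j)%N by lia.
    by rewrite (nth_default _ h1) (nth_default _ h2) !mulr0 subrr.
  lia.
have hp' : poly_in S p'.
  apply: poly_inB; first by apply: poly_inZ; first exact: hg.
  apply: poly_inM => //; apply: poly_inZ; [exact: hp|exact: poly_inXn].
have [s [q [r [hq hr sr e']]]] := IH p' sp' hp'.
exists s.+1, (q + (lead_coef g ^+ s * lead_coef p) *: 'X^e), r; split=> //.
  apply: poly_inD => //; apply: poly_inZ (poly_inXn _).
  by apply: subringM; [apply: subringX; apply: hg | apply: hp].
rewrite mulrDl addrAC -e' /p' scalerBr exprSr -!scalerA -!scalerAl.
by rewrite subrK.
Qed.

(** S[z] is a polynomial ring here. With a = p(z), the element 1 + X p would divide a power of p; as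
    X p is -1 modulo 1 + X p, it would then divide a power of -1, although its degree is
    positive. *)
Lemma adjoin_transcendental z :
  (forall p, poly_in S p -> p.[z] = 0 -> p = 0) -> ~ g_domain (adjoin S z).
Proof.
move=> tr [a [[p hp ->] p0 hG]].
have {}p0 : p != 0 by apply: contraNneq p0 => ->; rewrite horner0.
pose x := 1 + 'X * p.
have hx : poly_in S x.
  by apply: poly_inD; [apply: (poly_inC subring1) | apply: poly_inM => //; apply: poly_inX].
have sx : (1 < size x)%N.
  rewrite /x addrC size_polyDl mulrC size_mulX // ?size_poly1 ltnS size_poly_gt0 //.
have x0 : x != 0 by rewrite -size_poly_gt0 (ltn_trans _ sx).
have [||N [_ [[b hb ->] e]]] := hG x.[z]; first by exists x.
  by apply: contraNneq x0 => /tr->.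
have {}e : x * b = p ^+ N.
  apply/eqP; rewrite -subr_eq0; apply/eqP; apply: tr.
    by apply: poly_inB; [apply: poly_inM | apply: poly_inE].
  by rewrite hornerD hornerN hornerM e horner_exp subrr.
have [c ec] : exists c, x * c = (- 1) ^+ N.
  have := subrXX ('X * p) (- 1) N; set s := (\sum_(i < N) _).
  rewrite opprK exprMn -e => es.
  exists ('X^N * b - s); rewrite mulrBr mulrCA (_ : x * s = ('X * p + 1) * s).
    by rewrite -es opprB addrC subrK.
  by rewrite /x addrC.
have s1 : size (x * c) = 1%N by rewrite ec -signr_odd; case: odd; rewrite ?size_polyN size_poly1.
have c0 : c != 0 by apply/eqP => c0; move: s1; rewrite c0 mulr0 size_poly0.
move: (c0) (size_mul x0 c0) sx; rewrite s1 -size_poly_gt0.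
by move: (size x) (size c) => u v; lia.
Qed.

(** By the transcendental case z is a root of some nonzero p over S, taken of least degree. If c is
    a nonzero multiple of a lying in S, inverting [lead_coef p * c] suffices: the inverse of x in
    the localized S[z] is reduced modulo p, and constant coefficients are compared. *)
Lemma g_domain_adjoin z : g_domain (adjoin S z) -> g_domain S.
Proof.
move=> gz; case: (classic (exists p, [/\ poly_in S p, p != 0 & p.[z] = 0])); last first.
  move=> h; case: (adjoin_transcendental (z := z)) => // p hp pz.
  by apply/eqP/negPn/negP => p0; apply: h; exists p.
case=> p0 hp0.
have [p [hp pn0 pz] pmin] : exists2 p, [/\ poly_in S p, p != 0 & p.[z] = 0] &
    forall q, poly_in S q -> (size q < size p)%N -> q.[z] = 0 -> q = 0.
  have [m] := ubnP (size p0); elim: m p0 hp0 => // m IH p hp sp.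
  case: (classic (exists q, [/\ poly_in S q, (size q < size p)%N, q.[z] = 0 & q != 0])).
    by move=> [q [q1 q2 q3 q4]]; apply: (IH q); rewrite //; lia.
  move=> h; exists p => // q q1 q2 q3; apply/eqP/negPn/negP => q4.
  by apply: h; exists q.
case: gz => a [[pa hpa ea] a0 hG].
(* Euclid's algorithm for p and a polynomial representing a: every remainder still takes at z a
   value that is a multiple of a, until a nonzero constant remains. *)
have [c [h [hc c0 hh ec]]] : exists c h, [/\ S c, c != 0, adjoin S z h & c = a * h].
  pose good g := exists h, [/\ poly_in S g, g != 0, (size g < size p)%N,
                              adjoin S z h & g.[z] = a * h].
  have [g0 hg0] : exists g, good g.
    have [s [q [r [hq hr sr e]]]] := pseudo_division hpa hp pn0.
    have er : r.[z] = a * lead_coef p ^+ s.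
      have := congr1 (fun p => p.[z]) e; rewrite !hornerE pz mulr0 add0r -ea => <-.
      by rewrite mulrC.
    exists r, (lead_coef p ^+ s); split=> //.
      apply/eqP => r0; move/esym/eqP: er; rewrite r0 horner0 mulf_eq0 (negPf a0) /=.
      by rewrite expf_eq0 lead_coef_eq0 (negPf pn0) andbF.
    by apply: sub_adjoin; apply: subringX; apply: hp.
  have [m] := ubnP (size g0); elim: m g0 hg0 => // m IH g [h [hg gn0 sg hh eg]] sm.
  case: (leqP (size g) 1) => s1.
    move: eg gn0; rewrite (size1_polyC s1) hornerC polyC_eq0 => eg gn0.
    by exists g`_0, h; split.
  have [s [q [r [hq hr sr e]]]] := pseudo_division hp hg gn0.
  have er : r.[z] = a * (- q.[z] * h).
    have := congr1 (fun p => p.[z]) e.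
    rewrite hornerZ hornerD hornerM pz mulr0 eg => /esym e0.
    by rewrite -(addKr (q.[z] * (a * h)) r.[z]) e0 addr0; ring.
  case: (eqVneq r 0) => [r0|rn0]; last first.
    apply: (IH r); last by lia.
    exists (- q.[z] * h); split=> //; first by lia.
    have hA := adjoin_subring z; case: (hA) => _ _; apply=> //.
    by exists (- q); [rewrite -sub0r; apply: poly_inB => //; apply: (poly_inC subring0) | rewrite !hornerE].
  (* With zero remainder p would factor up to a constant, and one factor would be a smaller
     polynomial vanishing at z. *)
  move: e; rewrite r0 addr0 => e.
  have l0 : lead_coef g ^+ s != 0 by rewrite expf_eq0 lead_coef_eq0 (negPf gn0) andbF.
  have qn0 : q != 0.
    apply/eqP => q0; move/eqP: e; rewrite q0 mul0r scaler_eq0 (negPf l0) /=.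
    by rewrite (negPf pn0).
  have : q = 0; last by move/eqP; rewrite (negPf qn0).
  apply: (pmin) => //.
    have := congr1 (fun p => size (p : {poly L})) e; rewrite size_scale // size_mul //.
    by move: s1; move: (size p) (size q) (size g) => u v w; lia.
  have /eqP := congr1 (fun p => p.[z]) e; rewrite !hornerE pz mulr0 eq_sym mulf_eq0.
  case/orP=> /eqP // gz; case/eqP: gn0; exact: pmin.
have sp1 : (1 < size p)%N.
  rewrite ltnNge; apply/negP => s1; move: pz pn0; rewrite (size1_polyC s1) hornerC.
  by move->; rewrite eqxx.
exists (lead_coef p * c); split; first by apply: subringM => //; apply: hp.
  by rewrite mulf_neq0 // lead_coef_eq0.
move=> x hx x0; have [N [b [hb e]]] := hG x (sub_adjoin z hx) x0.
have [g hg eg] : adjoin S z (b * h ^+ N).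
  have hA := adjoin_subring z; case: (hA) => h1 _ hM; apply: (hM) => //.
  by elim: (N) => [|i IHi]; rewrite ?exprS //; apply: hM.
have [s [q [r [hq hr sr e']]]] := pseudo_division hg hp pn0.
have er : r.[z] = lead_coef p ^+ s * (b * h ^+ N).
  have := congr1 (fun p => p.[z]) e'.
  by rewrite hornerZ hornerD hornerM pz mulr0 add0r -eg => <-.
(* The left-hand side vanishes at z and is smaller than p; its constant coefficient yields the
   inverse of x. *)
have key : x *: r - (lead_coef p ^+ s * c ^+ N)%:P = 0.
  apply: pmin.
  - apply: poly_inB; first exact: poly_inZ.
    by apply: poly_inC; apply: subringM; apply: subringX => //; apply: hp.
  - apply: leq_ltn_trans (size_polyD _ _) _; rewrite size_polyN gtn_max.
    by rewrite (leq_ltn_trans (size_scale_leq _ _) sr) (leq_ltn_trans (size_polyC_leq1 _) sp1).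
  - by rewrite hornerD hornerN hornerZ hornerC er ec exprMn -e; ring.
exists (s + N)%N, (r`_0 * (lead_coef p ^+ N * c ^+ s)); split.
  by apply: subringM; [apply: hr | apply: subringM; apply: subringX => //; apply: hp].
have /eqP := congr1 (fun p : {poly L} => p`_0) key.
rewrite coefB coefZ coefC eqxx coef0 subr_eq0 => /eqP e0.
by rewrite (mulrA x) e0 exprMn !exprD; ring.
Qed.

End Subring.

(** The whole field satisfies the condition with a = 1, and the generators are removed one at a
    time. *)
Lemma g_domain_adjoins S zs : is_subring S ->
  (forall x, foldl adjoin S zs x) -> g_domain S.
Proof.
elim: zs S => [|z zs IH] S hS /= h.
  exists 1; split=> //; first exact: oner_neq0.
  by move=> x _ x0; exists 0%N, x^-1; split=> //; rewrite divff.
by apply: (g_domain_adjoin hS); apply: IH => //; apply: adjoin_subring.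
Qed.

Lemma adjoins_subring S zs : is_subring S ->
  [/\ is_subring (foldl adjoin S zs), sub_ideal S (foldl adjoin S zs) &
      forall z, z \in zs -> foldl adjoin S zs z].
Proof.
elim: zs S => [|z zs IH] S hS /=; first by split=> // x.
have [h1 h2 h3] := IH _ (adjoin_subring hS z); split=> //.
  by move=> x hx; apply: h2; apply: sub_adjoin.
by move=> y; rewrite inE => /orP[/eqP->|/h3//]; apply: h2; apply: adjoin_gen.
Qed.

End GDomain.

(* Otherwise k[t] would be a polynomial ring in which inverting a single element
   gives a field. *)
Lemma nullstellensatz (k : fieldType) (A : comNzRingType) (phi : {rmorphism k -> A})
    (zs : seq A) (P : A -> Prop) : generates phi zs -> maximal_ideal P ->
  forall t, exists2 p : {poly k}, p \is monic & P (map_poly phi p).[t].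
Proof.
move=> gen mP t; have [L [pi [surj ker]]] := maximal_quotient_field mP.
pose f : {rmorphism k -> L} := pi \o phi.
pose S0 x := exists c, x = f c.
have hS0 : is_subring S0.
  split; first by exists 1; rewrite rmorph1.
    by move=> _ _ [c ->] [e ->]; exists (c - e); rewrite rmorphB.
  by move=> _ _ [c ->] [e ->]; exists (c * e); rewrite rmorphM.
have hS := adjoin_subring hS0 (pi t).
have [hT ST zT] := adjoins_subring (map pi zs) hS.
(* The residue field is finitely generated over k[t], so the localization property descends to k[t]
   and excludes that t is transcendental. *)
have gd : g_domain (adjoin S0 (pi t)).
  apply: (g_domain_adjoins (zs := map pi zs)) hS _ => x.
  have [a <-] := surj x; move: a.
  apply: (gen (fun a => foldl (adjoin (L := L)) (adjoin S0 (pi t)) (map pi zs) (pi a))).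
  - by move=> c; apply: ST; apply: sub_adjoin => //; exists c.
  - by move=> z hz; apply: zT; apply: map_f.
  - by move=> y z hy hz; rewrite rmorphD; apply: subringD.
  - by move=> y z hy hz; rewrite rmorphM; apply: subringM.
have [p [hp p0 pt]] : exists p, [/\ poly_in S0 p, p != 0 & p.[pi t] = 0].
  apply: NNPP => h; apply: (adjoin_transcendental hS0 (z := pi t)) gd => p hp pt.
  by apply/eqP/negPn/negP => p0; apply: h; exists p.
have [q eq] : exists q : {poly k}, p = map_poly f q.
  have hc i : {c | p`_i = f c} by apply: constructive_indefinite_description; apply: hp.
  exists (\poly_(i < size p) sval (hc i)); apply/polyP => i.
  rewrite coef_map coef_poly; case: ltnP => hi; first exact: svalP (hc i).
  by rewrite nth_default //; exact/esym/(rmorph0 f).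
have q0 : q != 0 by apply: contraNneq p0 => q0; rewrite eq q0 map_poly0.
exists ((lead_coef q)^-1 *: q).
  by rewrite monicE lead_coefZ mulVf // lead_coef_eq0.
apply/ker; rewrite -horner_map /= -map_poly_comp /= -/f.
by rewrite linearZ /= -[X in X.[_]]/(_ *: _) hornerZ -eq pt mulr0.
Qed.

(** * Polynomials in radix e *)

Section DegreeBounds.
Variables (n : nat) (K : comNzRingType).
Implicit Types (p q u v : {mpoly K[n]}).

Lemma msize_leP p d :
  reflect (forall m, m \in msupp p -> (mdeg m < d)%N) (msize p <= d)%N.
Proof.
rewrite msizeE; apply: (iffP (bigmax_leqP_seq _ _ _ _)) => h m hm; first exact: h.
by move=> _; apply: h.
Qed.

Lemma msizeD_leq p q d : (msize p <= d)%N -> (msize q <= d)%N -> (msize (p + q) <= d)%N.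
Proof. by move=> hp hq; apply: leq_trans (msizeD_le _ _) _; rewrite geq_max hp. Qed.

Lemma msizeM_leq p q a b : (msize p <= a.+1)%N -> (msize q <= b.+1)%N ->
  (msize (p * q) <= (a + b).+1)%N.
Proof.
move=> /msize_leP hp /msize_leP hq; apply/msize_leP => m /msuppM_le /allpairsP.
by case=> -[m1 m2] /= [/hp h1 /hq h2 ->]; rewrite mdegD; lia.
Qed.

Lemma msizeX_leq p a b : (msize p <= a.+1)%N -> (msize (p ^+ b) <= (a * b).+1)%N.
Proof.
move=> hp; elim: b => [|b IH]; first by rewrite expr0 muln0 msize1.
by rewrite exprS mulnS; apply: msizeM_leq.
Qed.

Lemma msize_sum_leq (T : Type) (r : seq T) (P : pred T) (F : T -> {mpoly K[n]}) d :
  (forall i, P i -> (msize (F i) <= d)%N) -> (msize (\sum_(i <- r | P i) F i) <= d)%N.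
Proof.
move=> h; elim/big_ind: _ => //; first by rewrite msize0.
by move=> p q; apply: msizeD_leq.
Qed.

(** Degree at most d and equal components of degree d. *)
Definition same_top d u v :=
  [/\ (msize u <= d.+1)%N, (msize v <= d.+1)%N & (msize (u - v) <= d)%N].

Lemma same_top1 : same_top 0 1 1.
Proof. by rewrite /same_top msize1 subrr msize0. Qed.

Lemma same_topM a b u v u' v' :
  same_top a u v -> same_top b u' v' -> same_top (a + b) (u * u') (v * v').
Proof.
move=> [h1 h2 h3] [h1' h2' h3']; split; try exact: msizeM_leq.
rewrite (_ : u * u' - v * v' = (u - v) * u' + v * (u' - v')); last by ring.
have M p q c e : (msize p <= c)%N -> (msize q <= e.+1)%N -> (msize (p * q) <= c + e)%N.
  move=> /msize_leP hp /msize_leP hq; apply/msize_leP => m /msuppM_le /allpairsP.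
  by case=> -[m1 m2] /= [/hp hm1 /hq hm2 ->]; rewrite mdegD; lia.
apply: msizeD_leq; first exact: M.
by rewrite mulrC addnC; apply: M.
Qed.

Lemma same_topE a b u v : same_top a u v -> same_top (a * b) (u ^+ b) (v ^+ b).
Proof.
move=> h; elim: b => [|b IH]; first by rewrite muln0 !expr0; apply: same_top1.
by rewrite mulnS !exprS; apply: same_topM.
Qed.

End DegreeBounds.

Section Radix.
Variables (n : nat) (e : 'I_n -> nat).
Implicit Types (m : 'X_{1..n}).

Section Def.
Variables (K : comNzRingType) (f : 'I_n -> {mpoly K[n]}).

(* Monomials are written in radix e and the digits 'X_i ^+ e i are replaced by f i;
   when f is a homogeneous system of parameters with deg (f i) = e i this is
   K[x] = (+)_(a < e) x^a K[f]. *)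
Definition radix_mon (m : 'X_{1..n}) : {mpoly K[n]} :=
  \prod_i ('X_i ^+ (m i %% e i) * f i ^+ (m i %/ e i)).

Definition radix (g : {mpoly K[n]}) := \sum_(m <- msupp g) g@_m *: radix_mon m.

Lemma radixwE d g : (msize g <= d)%N ->
  radix g = \sum_(m : 'X_{1..n < d}) g@_m *: radix_mon m.
Proof.
move=> le_gd; rewrite /radix (big_mksub ('X_{1..n < d})) ?msupp_uniq //=; first last.
  by move=> x /msize_mdeg_lt /leq_trans; apply.
by rewrite big_rmcond //= => j /memN_msupp_eq0 ->; rewrite scale0r.
Qed.

Lemma radix_is_linear : linear radix.
Proof.
move=> a p q; pose d := maxn (msize p) (msize q).
have hp : (msize p <= d)%N by apply: leq_maxl.
have hq : (msize q <= d)%N by apply: leq_maxr.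
have ha : (msize (a *: p) <= d)%N.
  by apply/msize_leP => m /msuppZ_le; apply/msize_leP.
rewrite !(@radixwE d) ?msizeD_leq // scaler_sumr -big_split /=.
by apply: eq_bigr => m _; rewrite mcoeffD mcoeffZ scalerDl scalerA.
Qed.

HB.instance Definition _ :=
  GRing.isLinear.Build K {mpoly K[n]} {mpoly K[n]} _ radix radix_is_linear.

Lemma radixX m : radix 'X_[m] = radix_mon m.
Proof. by rewrite /radix msuppX big_seq1 mcoeffX eqxx scale1r. Qed.

End Def.

Section Field.
Variables (k : fieldType) (f : 'I_n -> {mpoly k[n]}).
Hypothesis e_gt0 : forall i, (0 < e i)%N.
Local Notation radix := (radix f).
Local Notation radix_mon := (radix_mon f).

Lemma radix_mon_reduced m : (forall i, m i < e i)%N -> radix_mon m = 'X_[m].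
Proof.
move=> h; rewrite /radix_mon mpolyXE_id; apply: eq_bigr => i _.
by rewrite modn_small // divn_small // expr0 mulr1.
Qed.

(** Adding [e i] to the i-th exponent keeps its remainder and raises its quotient by one. *)
Lemma radix_mon_shift i m : radix_mon (U_(i) *+ e i + m)%MM = f i * radix_mon m.
Proof.
rewrite /radix_mon (bigD1 i) //= [in RHS](bigD1 i) //= mulrA; congr (_ * _).
  rewrite mnmDE mulmnE mnm1E eqxx mul1n modnDl divnDl // divnn e_gt0 exprD expr1.
  by ring.
apply: eq_bigr => j ji; rewrite mnmDE mulmnE mnm1E.
by rewrite eq_sym (negPf ji) mul0n add0n.
Qed.

Lemma radix_shift i g : radix ('X_i ^+ e i * g) = f i * radix g.
Proof.
rewrite [in LHS](mpolyE g) mulr_sumr linear_sum [in RHS](mpolyE g) linear_sum mulr_sumr.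
apply: eq_bigr => m _; rewrite -scalerAr !linearZ /= -scalerAr; congr (_ *: _).
by rewrite mpolyXn -mpolyXD !radixX radix_mon_shift.
Qed.

Lemma radix_mon_size m : (forall i, msize (f i) <= (e i).+1)%N ->
  (msize (radix_mon m) <= (mdeg m).+1)%N.
Proof.
move=> hf; rewrite /radix_mon mdegE.
elim/big_ind2: _ => [|p a q b hp hq|i _]; first by rewrite msize1.
  exact: msizeM_leq.
have hX : (msize ('X_i : {mpoly k[n]}) <= 1.+1)%N by rewrite msizeX mdeg1.
rewrite [X in (_ <= X.+1)%N](_ : _ = 1 * (m i %% e i) + e i * (m i %/ e i))%N.
  by apply: msizeM_leq; apply: msizeX_leq.
by rewrite mul1n addnC mulnC -divn_eq.
Qed.

Lemma radix_size g : (forall i, msize (f i) <= (e i).+1)%N ->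
  (msize (radix g) <= msize g)%N.
Proof.
move=> hf; rewrite (@radixwE _ _ (msize g)) //; apply: msize_sum_leq => m _.
apply: leq_trans (msizeZ_le _ _) _; apply: leq_trans (radix_mon_size _ hf) _.
exact: bmdeg.
Qed.

(* Injectivity is a dimension count in each bounded degree. *)
Lemma radix_inj : (forall i, msize (f i) <= (e i).+1)%N ->
  (forall m, exists2 h, (msize h <= (mdeg m).+1)%N & radix h = 'X_[m]) ->
  injective radix.
Proof.
move=> hf surj; suff ker g : radix g = 0 -> g = 0.
  by move=> g g' eg; apply/eqP; rewrite -subr_eq0; apply/eqP/ker; rewrite linearB /= eg subrr.
pose d := msize g; pose T : finType := 'X_{1..n < d}.
pose mon (i : 'I_#|T|) : 'X_{1..n} := (enum_val i : 'X_{1..n < d}).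
(* On polynomials of degree below d the map is a square matrix acting on coefficient rows, and
   surjectivity provides a one-sided inverse W. *)
pose A : 'M[k]_#|T| := \matrix_(i, j) (radix_mon (mon i))@_(mon j).
pose row_of (h : {mpoly k[n]}) : 'rV[k]_#|T| := \row_i h@_(mon i).
have row_radix h : (msize h <= d)%N -> row_of h *m A = row_of (radix h).
  move=> hd; apply/rowP => j; rewrite !mxE (radixwE f hd) raddf_sum /=.
  rewrite (reindex (enum_val : 'I_#|T| -> T)) /=; last by apply: onW_bij; apply: enum_val_bij.
  by apply: eq_bigr => i _; rewrite !mxE mcoeffZ.
have row_inj h : (msize h <= d)%N -> row_of h = 0 -> h = 0.
  move=> hd h0; apply/mpolyP => m; rewrite mcoeff0; case: (ltnP (mdeg m) d) => hm.
    have /rowP/(_ (enum_rank (BMultinom hm : T))) := h0.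
    by rewrite !mxE /mon enum_rankK.
  by apply/eqP; rewrite mcoeff_eq0; apply: msize_mdeg_ge; apply: leq_trans hm.
have [W hW] : exists W : 'M_#|T|, W *m A = 1%:M.
  have hs (i : 'I_#|T|) : {h | (msize h <= d)%N /\ radix h = 'X_[mon i]}.
    apply: constructive_indefinite_description.
    have [h h1 h2] := surj (mon i).
    by exists h; split=> //; apply: leq_trans h1 _; apply: bmdeg.
  exists (\matrix_i row_of (sval (hs i))); apply/row_matrixP => i.
  rewrite row_mul rowK row_radix; last by case: (svalP (hs i)).
  have [_ ->] := svalP (hs i); apply/rowP => j; rewrite !mxE mcoeffX.
  by rewrite -bmeqP (inj_eq enum_val_inj).
move=> g0; apply: row_inj => //.
have := row_radix g (leqnn _); rewrite g0 (_ : row_of 0 = 0); last first.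
  by apply/rowP => j; rewrite !mxE mcoeff0.
move/(congr1 (mulmx^~ W)); rewrite mul0mx -mulmxA.
by rewrite (mulmx1C hW) mulmx1.
Qed.

Lemma submonomial (m : 'X_{1..n}) d : (d <= mdeg m)%N ->
  exists2 m', (m' <= m)%MM & mdeg m' = d.
Proof.
elim: d => [|d IH] hd; first by exists 0%MM; rewrite ?mdeg0 //; apply/mnm_lepP => i; rewrite mnm0E.
have [m' hm' em'] := IH (ltnW hd).
have [i hi] : exists i, (m' i < m i)%N.
  apply: NNPP => h; suff : (mdeg m <= mdeg m')%N by rewrite em' leqNgt hd.
  rewrite !mdegE; apply: leq_sum => i _; rewrite leqNgt; apply/negP => hi.
  by apply: h; exists i.
exists (m' + U_(i))%MM; last by rewrite mdegD mdeg1 em' addn1.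
apply/mnm_lepP => j; rewrite mnmDE mnm1E; case: eqVneq => [<-|_]; first by rewrite addn1.
by rewrite addn0; apply/mnm_lepP.
Qed.

(* Every monomial of degree N0 is in the ideal of the f i modulo lower degree, so
   surjectivity propagates from degree N0 to all higher degrees. *)
Lemma radix_surj : (forall i, msize (f i) <= (e i).+1)%N ->
  (forall m, (mdeg m <= (\sum_i (e i).-1).+1)%N ->
    exists2 h, (msize h <= (mdeg m).+1)%N & radix h = 'X_[m]) ->
  forall g, exists2 h, (msize h <= msize g)%N & radix h = g.
Proof.
set N0 := (\sum_i (e i).-1).+1%N => hf small.
pose im d g := exists2 h, (msize h <= d)%N & radix h = g.
have imW d d' g : (d <= d')%N -> im d g -> im d' g.
  by move=> dd [h hh eh]; exists h => //; apply: leq_trans dd.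
have imD d g g' : im d g -> im d g' -> im d (g + g').
  move=> [h hh <-] [h' hh' <-]; exists (h + h'); last by rewrite linearD.
  exact: msizeD_leq.
have imZ d a g : im d g -> im d (a *: g).
  move=> [h hh <-]; exists (a *: h); last by rewrite linearZ.
  exact: leq_trans (msizeZ_le _ _) _.
have im0 d : im d 0 by exists 0; rewrite ?msize0 // linear0.
have im_sum d (T : Type) (r : seq T) (P : pred T) (F : T -> {mpoly k[n]}) :
    (forall i, P i -> im d (F i)) -> im d (\sum_(i <- r | P i) F i).
  by move=> h; apply: big_ind => // *; apply: imD.
have im_of d : (forall m, (mdeg m < d)%N -> im d 'X_[m]) ->
    forall g, (msize g <= d)%N -> im d g.
  move=> h g hg; rewrite [g](mpolywE hg); apply: im_sum => m _.
  by apply: imZ; apply: h; apply: bmdeg.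
suff main d m : (mdeg m < d)%N -> im (mdeg m).+1 'X_[m].
  move=> g; apply: (im_of (msize g)) => // m hm.
  exact: imW hm (main _ m (leqnn _)).
elim: d m => // d IH m; rewrite ltnS leq_eqVlt => /orP[/eqP ed|]; last exact: IH.
case: (leqP (mdeg m) N0) => hN; first exact: small.
have imIH d' g : (d' <= mdeg m)%N -> (msize g <= d')%N -> im d' g.
  move=> hd'; apply: im_of => m' hm'; apply: imW (hm') _; apply: IH.
  by rewrite -ed; apply: leq_trans hd'.
(* A factor m' of degree N0 is split off and replaced by its preimage h; the monomials of h are then
   treated one by one. *)
have [m' hm' em'] := submonomial (ltnW hN).
have [h hh eh] := small m' (eq_leq em').
rewrite -(submK hm') mpolyXD -eh mdegD em'.
have dm : mdeg m = (mdeg (m - m') + N0)%N by rewrite -{1}(submK hm') mdegD em'.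
rewrite [h](mpolywE hh) linear_sum mulr_sumr; apply: im_sum => -[c /= hc] _.
rewrite linearZ -scalerAr; apply: imZ; rewrite /= radixX.
move: hc; rewrite em' ltnS => hc.
(* A reduced c has degree below N0, which exceeds the sum of the [e i] - 1, so induction applies.
   Otherwise a power of some variable splits off and becomes the factor [f i], leaving a polynomial
   of lower degree. *)
case: (boolP [forall i, c i < e i]%N) => [/forallP red|/forallPn[i]].
  have hc' : (mdeg c < N0)%N.
    rewrite ltnS mdegE; apply: leq_sum => i _.
    by have := red i; have := e_gt0 i; lia.
  rewrite radix_mon_reduced // -mpolyXD; apply: imW (IH _ _); rewrite mdegD; last first.
    by rewrite -ed dm ltn_add2l.
  by rewrite ltnS leq_add2l ltnW.
rewrite -leqNgt => hi; pose c' := (c - U_(i) *+ e i)%MM.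
have ec : c = (U_(i) *+ e i + c')%MM.
  rewrite addmC submK //; apply/mnm_lepP => j; rewrite mulmnE mnm1E.
  by case: eqVneq => [<-|_]; rewrite ?mul1n.
rewrite ec radix_mon_shift mulrCA.
have dc : mdeg c = (e i + mdeg c')%N.
  by rewrite ec mdegD mdegMn mdeg1 mul1n.
have [] := imIH (mdeg (m - m') + mdeg c').+1 ('X_[m - m'] * radix_mon c').
- by rewrite dm; have := e_gt0 i; lia.
- by apply: msizeM_leq; rewrite ?msizeX //; apply: radix_mon_size.
move=> w hw <-; exists ('X_i ^+ e i * w); last by rewrite radix_shift.
have : (msize ('X_i ^+ e i * w) <= (1 * e i + (mdeg (m - m') + mdeg c')).+1)%N.
  apply: msizeM_leq => //; apply: msizeX_leq.
  by rewrite msizeX mdeg1.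
by move/leq_trans; apply; rewrite ltnS; lia.
Qed.

(** The map is the identity up to terms of lower degree, so g - radix g is smaller than g. *)
Lemma radix_surj_top : (forall i, same_top (e i) (f i) ('X_i ^+ e i)) ->
  forall m, exists2 h, (msize h <= (mdeg m).+1)%N & radix h = 'X_[m].
Proof.
move=> top; suff main d g : (msize g <= d)%N -> exists2 h, (msize h <= d)%N & radix h = g.
  by move=> m; apply: main; rewrite msizeX.
elim: d g => [|d IH] g hg.
  by exists 0; rewrite ?msize0 ?linear0 //; apply/esym/eqP; rewrite -msize_poly_eq0 -leqn0.
have topm m : same_top (mdeg m) (radix_mon m) 'X_[m].
  rewrite /radix_mon mdegE mpolyXE_id.
  elim/big_rec3: _ => [|i p q a _ IHp]; first exact: same_top1.
  have em : m i = (1 * (m i %% e i) + e i * (m i %/ e i))%N.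
    by rewrite mul1n addnC mulnC -divn_eq.
  apply: same_topM => //; rewrite [X in same_top X]em.
  rewrite (_ : 'X_i ^+ m i = 'X_i ^+ (m i %% e i) * ('X_i ^+ e i) ^+ (m i %/ e i)); last first.
    by rewrite -exprM -exprD {1}em mul1n.
  apply: same_topM; last exact: same_topE.
  apply: same_topE.
  by rewrite /same_top msizeX mdeg1 subrr msize0.
have [|h hh eh] := IH (g - radix g).
  rewrite (radixwE f hg) {1}[g](mpolywE hg) -sumrB; apply: msize_sum_leq => m _.
  rewrite -scalerBr; apply: leq_trans (msizeZ_le _ _) _.
  have [_ _ hm] := topm m; rewrite -opprB msizeN.
  by apply: leq_trans hm _; have := bmdeg m; rewrite ltnS.
exists (h + g); last by rewrite linearD /= eh subrK.
by apply: msizeD_leq => //; apply: leqW.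
Qed.

End Field.
End Radix.

(** * Regularity transported from powers of variables *)

Section ShiftedBijection.
Variables (k : fieldType) (n : nat) (e : 'I_n -> nat) (f : 'I_n -> {mpoly k[n]}).
Variable Phi : {mpoly k[n]} -> {mpoly k[n]}.
Hypotheses (PhiD : {morph Phi : x y / x + y}) (Phi_inj : injective Phi).
Hypothesis Phi_surj : forall g, exists h, Phi h = g.
Hypothesis Phi_shift : forall i g, Phi ('X_i ^+ e i * g) = f i * Phi g.
Let powers (js : seq 'I_n) := [seq ('X_i ^+ e i : {mpoly k[n]}) | i <- js].

Lemma Phi0 : Phi 0 = 0.
Proof. by apply: (addrI (Phi 0)); rewrite -PhiD !addr0. Qed.

(** [Phi] need not be multiplicative, but the shift rule suffices for it to match the ideals
    generated by the powers and by the [f i]. *)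
Lemma Phi_gens js h :
  add_gens (@zero_ideal _) (map f js) (Phi h) <-> add_gens (@zero_ideal _) (powers js) h.
Proof.
elim/last_ind: js h => [|js j IH] h /=.
  split=> [e0|->]; last exact: Phi0.
  by apply: Phi_inj; rewrite Phi0.
rewrite /powers !map_rcons -!cats1 !add_gens_cat /=; split.
  case=> y [a [hy ey]]; have [y' ey'] := Phi_surj y; have [a' ea'] := Phi_surj a.
  exists y', a'; split; first by apply/IH; rewrite ey'.
  by apply: Phi_inj; rewrite ey PhiD [a' * _]mulrC Phi_shift ey' ea' mulrC.
case=> y [a [/IH hy ->]]; exists (Phi y), (Phi a); split=> //.
by rewrite PhiD [a * _]mulrC Phi_shift mulrC.
Qed.

Lemma monomial_idealP js h : add_gens (@zero_ideal _) (powers js) h <->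
  forall m, m \in msupp h -> exists2 j, j \in js & (e j <= m j)%N.
Proof.
split.
  apply: (@add_gens_min _ _ _ (fun h : {mpoly k[n]} => forall m, m \in msupp h ->
    exists2 j, j \in js & (e j <= m j)%N)).
  - split=> [m|x y hx hy m|a x hx m]; first by rewrite msupp0.
      by move/msuppD_le; rewrite mem_cat => /orP[/hx|/hy].
    move/msuppM_le => /allpairsP[[m1 m2] /= [_ /hx [j hj ej] ->]].
    by exists j => //; rewrite mnmDE; apply: leq_trans ej _; apply: leq_addl.
  - by move=> x -> m; rewrite msupp0.
  - move=> _ /mapP[j hj ->] m; rewrite mpolyXn => /mem_msuppXP <-.
    by exists j => //; rewrite mulmnE mnm1E eqxx mul1n.
move=> hh; rewrite (mpolyE h) big_seq.
have hI := add_gens_ideal (powers js) (zero_is_ideal {mpoly k[n]}).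
apply: ideal_sum => // m /hh [j hj ej]; rewrite -mul_mpolyC; apply: idealMl => //.
rewrite -(@submK _ (U_(j) *+ e j) m); last first.
  apply/mnm_lepP => i; rewrite mulmnE mnm1E.
  by case: eqVneq => [<-|_]; rewrite ?mul1n.
rewrite mpolyXD -mpolyXn; apply: idealMl => //; apply: add_gens_gen.
  exact: zero_is_ideal.
exact: map_f.
Qed.

(** For monomial ideals the claim is clear: multiplying by a power of another variable does not
    change divisibility by the given powers. *)
Lemma nzd_shifted js i : i \notin js ->
  nzd_mod (add_gens (@zero_ideal _) (map f js)) (f i).
Proof.
move=> ij y; have [h <-] := Phi_surj y; rewrite -Phi_shift => /Phi_gens hh.
apply/Phi_gens/monomial_idealP => m hm.
have [|j hj] := (monomial_idealP _ _).1 hh (m + U_(i) *+ e i)%MM.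
  by rewrite mulrC mpolyXn mcoeff_msupp addmC mcoeffMX -mcoeff_msupp.
rewrite mnmDE mulmnE mnm1E; case: eqVneq => [eij|_].
  by move: ij; rewrite eij hj.
by rewrite addn0; exists j.
Qed.

Lemma wreg_shifted us js : uniq (us ++ js) ->
  wreg (add_gens (@zero_ideal _) (map f us)) (map f js).
Proof.
elim: js us => //= j js IH us hu; split.
  apply: nzd_shifted; move: hu; rewrite cat_uniq => /and3P[_ /hasPn h _].
  by apply: h; rewrite mem_head.
have := IH (rcons us j); rewrite map_rcons -!cats1 add_gens_cat /=; apply.
by rewrite -catA.
Qed.

End ShiftedBijection.

(** * Good families of forms *)

Section ChainIndependence.
Variables (k : fieldType) (A : comAlgType k) (N : nat).

(** Nested pairs, so that the exponent of the first element splits off in the induction along a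
    chain. *)
Fixpoint exponents (m : nat) : finType :=
  if m is m'.+1 then ('I_N * exponents m')%type else unit.

Fixpoint power_prod (x : nat -> A) (m : nat) : exponents m -> A :=
  match m with
  | 0 => fun=> 1
  | m'.+1 => fun t => x 0%N ^+ t.1 * power_prod (fun i => x i.+1) t.2
  end.

Lemma card_exponents m : #|exponents m| = (N ^ m)%N.
Proof. by elim: m => [|m IH]; rewrite ?card_unit //= card_prod card_ord IH expnS. Qed.

(** The constant term lies in Q, because x and the whole sum do, so it vanishes; the rest is
    divisible by x, which the prime P allows to cancel. *)
Lemma power_sum_in_prime (P Q : A -> Prop) (x : A) (w : nat -> A) (m : nat) :
  prime_ideal P -> is_ideal Q -> sub_ideal P Q -> Q x -> ~ P x ->
  (forall a, (a < m)%N -> Q (w a) -> w a = 0) ->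
  P (\sum_(a < m) x ^+ a * w a) -> forall a, (a < m)%N -> w a = 0.
Proof.
move=> [hP P1 Pm] hQ PQ Qx Px; elim: m w => // m IH w hw.
rewrite big_ord_recl expr0 mul1r /= => hs.
set s := \sum_(i < m) x ^+ i * w i.+1.
have es : \sum_(i < m) x ^+ bump 0 i * w (bump 0 i) = x * s.
  by rewrite mulr_sumr; apply: eq_bigr => i _; rewrite /bump add1n exprS mulrA.
move: hs; rewrite es => hs.
have w0 : w 0%N = 0.
  by apply: hw => //; apply: idealDr (PQ _ hs) => //; apply: idealMr.
move: hs; rewrite w0 add0r => /Pm[//|hs].
by case=> [_ //|a ha]; apply: (IH (fun a => w a.+1)) => // b hb; apply: hw.
Qed.

(* Read as a polynomial in x 0, which lies in Q 1 but not in Q 0; by induction its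
   coefficients vanish as soon as they lie in Q 1. *)
Lemma chain_independent (Q : nat -> A -> Prop) (x : nat -> A) (m : nat) (c : exponents m -> k) :
  (forall i, (i <= m)%N -> prime_ideal (Q i)) ->
  (forall i, (i < m)%N -> [/\ sub_ideal (Q i) (Q i.+1), Q i.+1 (x i) & ~ Q i (x i)]) ->
  Q 0%N (\sum_t c t *: power_prod x t) -> forall t, c t = 0.
Proof.
have scaleI P a (y : A) : is_ideal P -> P (a *: y) -> a = 0 \/ P y.
  move=> hP hy; case: (eqVneq a 0) => [->|a0]; [by left | right].
  by rewrite -[y](scalerK a0) -mulr_algl; apply: idealMl.
elim: m Q x c => [|m IH] Q x c pQ ch.
  rewrite /= (big_pred1 tt) => [|[]] // hc [].
  have [hQ Q1 _] := pQ 0%N (leqnn _).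
  by have [] := scaleI _ _ _ hQ hc.
have -> : \sum_t c t *: power_prod x t = \sum_(a < N) \sum_(b : exponents m)
    c (a, b) *: (x 0%N ^+ a * power_prod (fun i => x i.+1) b).
  by rewrite pair_bigA; apply: eq_bigr => -[a b].
(* The coefficients of the powers of [x 0%N], extended by 0 from N on to a family over all
   naturals. *)
pose w (a : nat) : A := if insub a is Some a' then
  \sum_b c (a' : 'I_N, b) *: power_prod (fun i => x i.+1) b else 0.
have ew (a : 'I_N) : w a = \sum_b c (a, b) *: power_prod (fun i => x i.+1) b.
  by rewrite /w valK.
rewrite (eq_bigr (fun a : 'I_N => x 0%N ^+ a * w a)); last first.
  by move=> a _; rewrite ew mulr_sumr; apply: eq_bigr => b _; rewrite scalerAr.
have [h1 h2 h3] := ch 0%N (ltn0Sn _).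
have [hQ1 Q11 _] := pQ 1%N (ltn0Sn _).
have key (a : 'I_N) : Q 1%N (w a) -> forall b, c (a, b) = 0.
  rewrite ew; apply: (IH (fun i => Q i.+1)) => i hi; first exact: pQ.
  exact: ch.
move=> hs [a b]; apply: (key).
have -> : w a = 0; last exact: ideal0.
apply: (power_sum_in_prime _ hQ1 h1 h2 h3 _ hs) => //; first exact: pQ.
move=> i hi /(key (Ordinal hi)) hc; rewrite -[i]/(nat_of_ord (Ordinal hi)) ew.
by rewrite big1 // => b' _; rewrite hc scale0r.
Qed.

End ChainIndependence.

(** * Forms whose radix maps are surjective, and their regular sequences *)

Section GoodForms.
Variables (k : fieldType) (n s : nat) (d : 'I_s -> nat) (F : 'I_s -> {mpoly k[n.+1]}).
Hypothesis d_gt0 : forall i, (0 < d i)%N.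
Hypothesis F_homog : forall i, F i \is (d i).-homog.
Implicit Types (b : seq 'I_s) (i : 'I_n.+1).
Local Notation R := {mpoly k[n.+1]}.
Local Notation zero := (@zero_ideal R).

(* The first variables are traded for the forms listed in b. *)
Definition slot_deg b i := oapp d 1%N (onth b i).
Definition slot_form b i : R := oapp F 'X_i (onth b i).

(** Surjectivity with a degree bound is all that is retained of genericity; injectivity follows by
    the dimension count. *)
Definition good_at b := forall g : R, exists2 h, (msize h <= msize g)%N &
  radix (slot_deg b) (slot_form b) h = g.

Definition good := forall b, uniq b -> (size b <= n.+1)%N -> good_at b.

Lemma slot_deg_gt0 b i : (0 < slot_deg b i)%N.
Proof. by rewrite /slot_deg; case: onth => [j|] /=. Qed.

Lemma homog_msize_leq e (g : R) : g \is e.-homog -> (msize g <= e.+1)%N.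
Proof. by move/dhomogP => h; apply/msize_leP => m /h /= ->. Qed.

Lemma slot_form_size b i : (msize (slot_form b i) <= (slot_deg b i).+1)%N.
Proof.
rewrite /slot_form /slot_deg; case: onth => [j|] /=; first exact: homog_msize_leq.
by rewrite msizeX mdeg1.
Qed.

Lemma good_inj b : good_at b -> injective (radix (slot_deg b) (slot_form b)).
Proof.
move=> hb; apply: radix_inj; first exact: slot_form_size.
by move=> m; have [h hh eh] := hb 'X_[m]; exists h => //; rewrite msizeX in hh.
Qed.

(** Converts families indexed by variables into lists indexed by b: the leading slots hold the
    members of b in order. *)
Lemma slot_map (B : Type) b (u : 'I_s -> B) (v : 'I_n.+1 -> B) : (size b <= n.+1)%N ->
  [seq oapp u (v i) (onth b i) | i <- take (size b) (enum 'I_n.+1)] = map u b.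
Proof.
move=> sb; have st : size (take (size b) (enum 'I_n.+1)) = size b.
  by rewrite size_takel // size_enum_ord.
case: b sb st => [|t b] sb st; first by rewrite take0.
apply: (@eq_from_nth _ (u t)); first by rewrite !size_map st.
move=> j; rewrite size_map st => hj; rewrite (nth_map ord0) ?st // nth_take //.
rewrite (nth_map t) //= nth_enum_ord ?(leq_trans hj) //.
by rewrite onthE (nth_map t).
Qed.


Lemma mem_take_ord r i : i \in take r (enum 'I_n.+1) -> (i < r)%N.
Proof.
move=> hi; have hu : (index i (take r (enum 'I_n.+1)) < size (take r (enum 'I_n.+1)))%N.
  by rewrite index_mem.
have := nth_index ord0 hi; rewrite nth_take; last first.
  by apply: leq_trans hu _; rewrite size_take; case: ltnP.
move: hu; rewrite size_take size_enum_ord => hu.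
have hj : (index i (take r (enum 'I_n.+1)) < n.+1)%N by move: hu; case: (ltnP r n.+1); lia.
move/(congr1 val); rewrite /= nth_enum_ord // => <-.
by move: hu; case: (ltnP r n.+1) => // h /leq_trans; apply.
Qed.

Lemma mem_drop_ord r i : i \in drop r (enum 'I_n.+1) -> (r <= i)%N.
Proof.
move=> hi; rewrite leqNgt; apply/negP => ir.
have := enum_uniq 'I_n.+1; rewrite -(cat_take_drop r (enum 'I_n.+1)) cat_uniq.
case/and3P=> _ /hasPn /(_ i hi) /negP h _; apply: h.
have ht : (i < size (take r (enum 'I_n.+1)))%N.
  by rewrite size_take size_enum_ord; case: ifP => // _; apply: ltn_ord.
by have := mem_nth ord0 ht; rewrite nth_take // nth_ord_enum.
Qed.

Lemma good_wreg b : good -> uniq b -> (size b <= n.+1)%N -> wreg zero (map F b).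
Proof.
move=> hg ub sb; have hb := hg b ub sb.
rewrite -(slot_map F (fun i => 'X_i : R) sb).
apply: (@wreg_shifted _ _ (slot_deg b) (slot_form b) (radix (slot_deg b) (slot_form b))
  _ _ _ _ [::]) => //=.
- by move=> x y; rewrite linearD.
- exact: good_inj.
- by move=> g; have [h _ eh] := hb g; exists h.
- by move=> i g; apply: radix_shift; apply: slot_deg_gt0.
- by apply: take_uniq; apply: enum_uniq.
Qed.

Lemma good_nzd b t : good -> uniq (rcons b t) -> (size b <= n)%N ->
  nzd_mod (add_gens zero (map F b)) (F t).
Proof.
move=> hg ub sb; have sb' : (size (rcons b t) <= n.+1)%N by rewrite size_rcons.
have /wreg_nthP/(_ (size b)) := good_wreg hg ub sb'.
rewrite size_map size_rcons ltnSn => /(_ isT).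
by rewrite map_rcons nth_rcons size_map ltnn eqxx -cats1 take_size_cat ?size_map.
Qed.

Definition var_poly (p : {poly k}) i : R := (map_poly (@mpolyC n.+1 k) p).['X_i].

Lemma var_polyE p i : var_poly p i = \sum_(j < size p) p`_j *: 'X_i ^+ j.
Proof.
rewrite /var_poly (@horner_coef_wide _ (size p)) ?size_poly //.
by apply: eq_bigr => j _; rewrite coef_map /= mul_mpolyC.
Qed.

Lemma var_poly_top p i : p \is monic -> (1 < size p)%N ->
  same_top (size p).-1 (var_poly p i) ('X_i ^+ (size p).-1).
Proof.
move=> /eqP lp sp; rewrite var_polyE.
have hX j : (msize ('X_i ^+ j : R) <= j.+1)%N.
  by rewrite -{2}[j]mul1n; apply: msizeX_leq; rewrite msizeX mdeg1.
have [e ep] : exists e, size p = e.+1 by exists (size p).-1; rewrite prednK // ltnW.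
have lp1 : p`_e = 1 by rewrite -lp /lead_coef ep.
rewrite ep /=.
rewrite big_ord_recr /= lp1 scale1r.
have hs : (msize (\sum_(j < e) p`_j *: ('X_i : R) ^+ j) <= e)%N.
  apply: msize_sum_leq => j _; apply: leq_trans (msizeZ_le _ _) _.
  exact: leq_trans (hX j) (ltn_ord j).
split; rewrite ?addrK //; first by apply: msizeD_leq => //; apply: leqW.
Qed.

(* Composing two radix maps, for the forms in b and then for the polynomials in the
   other variables, reduces the claim to monomial ideals. *)
Lemma good_wreg_vars b (p : 'I_n.+1 -> {poly k}) : good_at b -> (size b <= n.+1)%N ->
  (forall i, p i \is monic) -> (forall i, 1 < size (p i))%N ->
  wreg (add_gens zero (map F b))
       [seq var_poly (p i) i | i <- drop (size b) (enum 'I_n.+1)].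
Proof.
move=> hb sb pm ps; set r := size b in sb *.
(* The inner map replaces powers by [f]. The outer one, that of b, turns the powers in the first r
   slots into forms and commutes with multiplication by the other variables, so the composite
   replaces powers by [h]. *)
pose e i := if (i < r)%N then slot_deg b i else (size (p i)).-1.
pose f i : R := if (i < r)%N then 'X_i ^+ slot_deg b i else var_poly (p i) i.
pose h i : R := if (i < r)%N then slot_form b i else var_poly (p i) i.
have e0 i : (0 < e i)%N.
  by rewrite /e; case: ifP => _; [apply: slot_deg_gt0 | have := ps i; lia].
have top i : same_top (e i) (f i) ('X_i ^+ e i).
  rewrite /e /f; case: ifP => _; last exact: var_poly_top.
  rewrite /same_top subrr msize0; split=> //.
    by rewrite -{2}[slot_deg b i]mul1n; apply: msizeX_leq; rewrite msizeX mdeg1.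
  by rewrite -{2}[slot_deg b i]mul1n; apply: msizeX_leq; rewrite msizeX mdeg1.
have hf i : (msize (f i) <= (e i).+1)%N by case: (top i).
have small m := radix_surj_top top m.
have -> : map F b = map h (take r (enum 'I_n.+1)).
  rewrite -(slot_map F (fun i => 'X_i : R) sb); apply/eq_in_map => i /mem_take_ord hi.
  by rewrite /h hi.
have -> : [seq var_poly (p i) i | i <- drop r (enum 'I_n.+1)] = map h (drop r (enum 'I_n.+1)).
  by apply/eq_in_map => i /mem_drop_ord hi; rewrite /h ltnNge hi.
apply: (@wreg_shifted _ _ e h (radix (slot_deg b) (slot_form b) \o radix e f)) => /=.
- by move=> x y; rewrite !linearD.
- by apply: inj_comp; [apply: good_inj | apply: radix_inj].
- move=> g; have [g' _ <-] := hb g.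
  have [|g2 _ <-] := radix_surj e0 hf _ g'; first by move=> m _; apply: small.
  by exists g2.
- move=> i g; rewrite radix_shift // /f /h; case: ltnP => hi.
    by rewrite radix_shift //; apply: slot_deg_gt0.
  rewrite var_polyE !mulr_suml linear_sum; apply: eq_bigr => j _.
  rewrite -!scalerAl linearZ /=; congr (_ *: _).
  have ho : onth b i = None by apply: onth_default.
  have e1 : slot_deg b i = 1%N by rewrite /slot_deg ho.
  have f1 : slot_form b i = 'X_i by rewrite /slot_form ho.
  have hX g' : radix (slot_deg b) (slot_form b) ('X_i * g') =
      'X_i * radix (slot_deg b) (slot_form b) g'.
    by have := radix_shift (slot_form b) (slot_deg_gt0 b) i g'; rewrite e1 f1 expr1.
  elim: (val j) => [|j' IH]; first by rewrite expr0 !mul1r.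
  by rewrite exprS -!mulrA -IH -hX.
- by rewrite cat_take_drop enum_uniq.
Qed.

(** Terms of the preimage of g with a large exponent in one of the first slots map into the ideal of
    the forms and are dropped. *)
Lemma good_span b (g : R) : good_at b -> (size b <= n.+1)%N ->
  exists h, [/\ (msize h <= msize g)%N,
    forall m, m \in msupp h -> forall i, (i < size b)%N -> (m i < slot_deg b i)%N &
    add_gens zero (map F b) (g - radix (slot_deg b) (slot_form b) h)].
Proof.
move=> hb sb; have [h hh eh] := hb g.
pose red (m : 'X_{1..n.+1}) := [forall i : 'I_n.+1, (i < size b)%N ==> (m i < slot_deg b i)%N].
pose h1 := \sum_(m <- msupp h | red m) h@_m *: 'X_[m].
have supp m : m \in msupp h1 -> m \in msupp h /\ red m.
  move=> hm; suff : exists m', [/\ m' \in msupp h, red m' & m = m'].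
    by move=> [m' [? ? ->]].
  apply: NNPP => hno; move: hm; rewrite mcoeff_msupp /h1 raddf_sum big_seq_cond big1 ?eqxx //.
  move=> m' /andP[h1' h2']; rewrite /= mcoeffZ mcoeffX; case: eqP => [em|_]; last by rewrite mulr0.
  by case: hno; exists m'.
exists h1; split.
- apply/msize_leP => m /supp [hm _]; apply: leq_trans hh.
  exact: msize_mdeg_lt.
- by move=> m /supp [_ /forallP red_m] i hi; have := red_m i; rewrite hi.
rewrite -eh -linearB {1}(mpolyE h) (bigID red) /= -/h1 (addrAC h1) subrr add0r linear_sum.
have hI : is_ideal (add_gens zero (map F b)) by apply: add_gens_ideal; apply: zero_is_ideal.
apply: ideal_sum => // m /forallPn[i]; rewrite negb_imply -leqNgt => /andP[hi hm].
rewrite linearZ /= -mul_mpolyC; apply: idealMl => //.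
rewrite -(@submK _ (U_(i) *+ slot_deg b i) m); last first.
  apply/mnm_lepP => j; rewrite mulmnE mnm1E.
  by case: eqVneq => [<-|_]; rewrite ?mul1n.
rewrite addmC mpolyXD -mpolyXn radix_shift; last exact: slot_deg_gt0.
apply: idealMr => //; apply: add_gens_gen; first exact: zero_is_ideal.
rewrite /slot_form -(slot_map F (fun i => 'X_i : R) sb).
apply/mapP; exists i => //.
have ht : (i < size (take (size b) (enum 'I_n.+1)))%N by rewrite size_takel ?size_enum_ord.
by have := mem_nth ord0 ht; rewrite nth_take // nth_ord_enum.
Qed.

End GoodForms.

Lemma prod_if_ltn (N r a c : nat) : (r <= N)%N ->
  (\prod_(i < N) (if i < r then a else c) = a ^ r * c ^ (N - r))%N.
Proof.
move=> rN; rewrite -(big_mkord xpredT (fun i => if (i < r)%N then a else c)).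
rewrite (@big_cat_nat _ _ _ r) //= [X in (X * _)%N](eq_big_nat _ _ (F2 := fun=> a)); last first.
  by move=> i /andP[_ ->].
rewrite [X in (_ * X)%N](eq_big_nat _ _ (F2 := fun=> c)); last first.
  by move=> i /andP[ri _]; rewrite ltnNge ri.
by rewrite !prod_nat_const_nat subn0.
Qed.

Lemma maximal_is_prime (A : comNzRingType) (P : A -> Prop) :
  maximal_ideal P -> prime_ideal P.
Proof.
move=> [hP P1 Pmax]; split=> // x y hxy; apply: NNPP => /not_or_and [hx hy].
have [b [c [hb e]]] : add_gen P x 1.
  apply: NNPP => h; apply: hx; apply: (Pmax (add_gen P x)) h _ _.
  - exact: add_gen_ideal.
  - exact: add_gen_sub.
  - exact: add_gen_gen.
apply: hy; rewrite -[y]mul1r e mulrDl -mulrA; apply: idealD => //.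
  exact: idealMr.
exact: idealMl.
Qed.

(** * The growth bound for chains of primes *)

Section Height.
Variables (k : fieldType) (n s : nat) (d : 'I_s -> nat) (F : 'I_s -> {mpoly k[n.+1]}).
Hypothesis d_gt0 : forall i, (0 < d i)%N.
Hypothesis F_homog : forall i, F i \is (d i).-homog.
Local Notation R := {mpoly k[n.+1]}.

Lemma power_prod_size N (x : nat -> R) m delta (t : exponents N m) :
  (forall i, (i < m)%N -> (msize (x i) <= delta.+1)%N) ->
  (msize (power_prod x t) <= (m * (delta * N)).+1)%N.
Proof.
elim: m x t => [|m IH] x t hx /=; first by rewrite msize1.
rewrite mulSn; apply: msizeM_leq; last by apply: IH => i hi; apply: hx.
apply: leq_trans (msizeX_leq _ (hx 0%N _)) _ => //.
by rewrite ltnS leq_mul2l (ltnW (ltn_ord t.1)) orbT.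
Qed.

(* The number of products of powers < N of m elements of a chain grows like N^m,
   while R/(F_b) has dimension O(N^(n+1-|b|)) in the degrees concerned. *)
Lemma good_height b (Q : nat -> R -> Prop) m : good_at d F b -> (size b <= n.+1)%N ->
  (forall i, (i <= m)%N -> prime_ideal (Q i)) ->
  (forall i, (i < m)%N -> (forall x, Q i x -> Q i.+1 x) /\ (exists2 x, Q i.+1 x & ~ Q i x)) ->
  (forall t, t \in b -> Q 0%N (F t)) -> (m <= n.+1 - size b)%N.
Proof.
move=> hb sb pQ ch bQ; rewrite leqNgt; apply/negP => hm.
have hx i : {x | (i < m)%N -> Q i.+1 x /\ ~ Q i x}.
  apply: constructive_indefinite_description; case: (ltnP i m) => [/ch[_ [x h1 h2]]|_].
    by exists x.
  by exists 0.
pose x i := sval (hx i); pose delta := (\sum_(i < m) msize (x i))%N.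
have xdelta i : (i < m)%N -> (msize (x i) <= delta.+1)%N.
  by move=> hi; apply: leqW; rewrite /delta (bigD1 (Ordinal hi)) //= leq_addr.
(* D exceeds the slot degrees and M bounds the degrees of the products. As M + 1 <= (m delta + 1) N,
   the set E of exponents has at most D^r (M+1)^p elements; N is chosen so that this is below
   N^(p+1) <= N^m. *)
pose r := size b; pose p := (n.+1 - r)%N; pose D := (\sum_i d i).+1%N.
pose N := (D ^ r * (m * delta).+1 ^ p).+1%N.
pose M := (m * (delta * N))%N.
pose bnd (i : 'I_n.+1) := if (i < r)%N then D else M.+1.
pose E : finType := {dffun forall i : 'I_n.+1, 'I_(bnd i)}.
have cE : (#|E| < #|exponents N m|)%N.
  rewrite card_exponents card_dep_ffun foldrE big_image /= (eq_bigr bnd); last by move=> i _; rewrite card_ord.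
  rewrite /bnd prod_if_ltn // -/p.
  apply: (@leq_trans (N ^ p.+1)); last by rewrite leq_exp2l // /N; lia.
  have hM : (M.+1 <= (m * delta).+1 * N)%N.
    by rewrite /M mulSn mulnA -add1n leq_add2r.
  apply: (@leq_ltn_trans (D ^ r * ((m * delta).+1 * N) ^ p)).
    by rewrite leq_mul2l; apply/orP; right; case: (posnP p) => [->//|p0]; rewrite leq_exp2r.
  by rewrite expnMn mulnA expnS ltn_pmul2r ?expn_gt0 // /N.
have spn (t : exponents N m) : {h | [/\ (msize h <= M.+1)%N,
    forall mm : 'X_{1..n.+1}, mm \in msupp h -> forall i, (mm i < bnd i)%N &
    add_gens (@zero_ideal R) (map F b)
      (power_prod x t - radix (slot_deg d b) (slot_form F b) h)]}.
  apply: constructive_indefinite_description.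
  have [h [h1 h2 h3]] := good_span d_gt0 (power_prod x t) hb sb.
  have hM := leq_trans h1 (power_prod_size t xdelta).
  exists h; split=> // mm hmm i; rewrite /bnd; case: (ltnP i r) => hi.
    apply: leq_trans (h2 _ hmm _ hi) _; rewrite /slot_deg /D; case: onth => [j|] //=.
    by rewrite ltnW // ltnS (bigD1 j) //= leq_addr.
  apply: leq_trans hM; apply: leq_ltn_trans (msize_mdeg_lt hmm).
  by rewrite mdegE (bigD1 i) //= leq_addr.
pose mon (c : E) : 'X_{1..n.+1} := [multinom (c i : nat) | i < n.+1].
pose V : 'M[k]_(#|exponents N m|, #|E|) :=
  \matrix_(i, j) (sval (spn (enum_val i)))@_(mon (enum_val j)).
(* There are more products than admissible monomials, hence a nontrivial linear relation between the
   reduced representatives. *)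
have /rowV0Pn[u /sub_kermxP uV u0] : kermx V != 0.
  rewrite -mxrank_eq0 mxrank_ker subn_eq0 -ltnNge.
  exact: leq_ltn_trans (rank_leq_col V) cE.
pose c (t : exponents N m) := u 0 (enum_rank t).
have hsum : \sum_t c t *: sval (spn t) = 0.
  apply/mpolyP => mm; rewrite raddf_sum mcoeff0 /=.
  case: (classic (forall i, mm i < bnd i)%N) => hmm; last first.
    rewrite big1 // => t _; rewrite mcoeffZ.
    case: (svalP (spn t)) => _ h2 _.
    case: (boolP (mm \in msupp (sval (spn t)))) => [/h2//|/memN_msupp_eq0->].
    by rewrite mulr0.
  pose g : E := [ffun i => Ordinal (hmm i)].
  have eg : mon g = mm by apply/mnmP => i; rewrite mnmE ffunE.
  have /rowP/(_ (enum_rank g)) := uV; rewrite !mxE; apply: etrans.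
  rewrite (reindex (enum_val : 'I_#|exponents N m| -> _)) /=; last first.
    by apply: onW_bij; apply: enum_val_bij.
  by apply: eq_bigr => i _; rewrite mcoeffZ !mxE /c enum_valK enum_rankK eg.
have [hQ0 _ _] := pQ 0%N (leq0n _).
have gQ : sub_ideal (add_gens (@zero_ideal R) (map F b)) (Q 0%N).
  apply: add_gens_min => //; first by move=> y ->; apply: ideal0.
  by move=> _ /mapP[t ht ->]; apply: bQ.
(* The relation holds for the products modulo the forms of b, which lie in [Q 0%N]; independence
   along the chain makes it trivial. *)
have c0 : forall t, c t = 0.
  apply: (chain_independent (Q := Q) (x := x)) => //.
    move=> i hi; case: (svalP (hx i) hi) => h1 h2; split=> //.
    by case: (ch i hi).
  apply: gQ; rewrite (_ : \sum_t _ = \sum_t c t *: (power_prod x t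
      - radix (slot_deg d b) (slot_form F b) (sval (spn t)))).
    have hI := add_gens_ideal (map F b) (zero_is_ideal R).
    apply: ideal_sum => // t _; rewrite -mul_mpolyC; apply: idealMl => //.
    by case: (svalP (spn t)).
  have := congr1 (radix (slot_deg d b) (slot_form F b)) hsum.
  rewrite linear0 linear_sum /= => e0.
  rewrite [RHS](eq_bigr (fun t => c t *: power_prod x t - radix (slot_deg d b) (slot_form F b) (c t *: sval (spn t)))).
    by rewrite sumrB e0 subr0.
  by move=> t _; rewrite scalerBr [in RHS]linearZ.
case/eqP: u0; apply/rowP => i; rewrite mxE.
by have := c0 (enum_val i); rewrite /c enum_valK.
Qed.

End Height.

(** * The Cohen-Macaulay property *)

Section Quotients.
Variables (A B : comNzRingType) (p : {rmorphism A -> B}).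
Hypothesis p_surj : forall b, exists a, p a = b.

Lemma add_gens_image (J : A -> Prop) (K : B -> Prop) xs : is_ideal J -> is_ideal K ->
  (forall a, K (p a) <-> J a) ->
  forall a, add_gens K (map p xs) (p a) <-> add_gens J xs a.
Proof.
elim: xs J K => //= x xs IH J K hJ hK KJ; apply: IH; try exact: add_gen_ideal.
move=> a; split.
  case=> z [c [hz e]]; have [z' ez] := p_surj z; have [c' ec] := p_surj c.
  exists (a - c' * x), c'; split; last by ring.
  apply/KJ; rewrite rmorphB rmorphM ec e (_ : z + c * p x - c * p x = z) //; ring.
case=> z [c [/KJ hz ->]]; exists (p z), (p c); split=> //.
by rewrite rmorphD rmorphM.
Qed.

Lemma regular_seq_quotient (I : A -> Prop) xs : is_ideal I -> (forall a, p a = 0 <-> I a) ->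
  wreg I xs -> forall i, (i < size (map p xs))%N ->
  forall y, gen_ideal (take i (map p xs)) ((map p xs)`_i * y) -> gen_ideal (take i (map p xs)) y.
Proof.
move=> hI ker /wreg_nthP hw i; rewrite size_map => hi y.
have [a <-] := p_surj y.
rewrite -map_take (nth_map 0) // -rmorphM !gen_idealE.
have h0 := zero_is_ideal B.
have h b := add_gens_image (take i xs) hI h0 ker b.
by move/h => /(hw i hi) /h.
Qed.

Lemma prime_chain_pullback (P : B -> Prop) m : prime_chain P m ->
  exists Q : nat -> A -> Prop,
    [/\ forall i, (i <= m)%N -> prime_ideal (Q i),
        forall i, (i < m)%N -> (forall x, Q i x -> Q i.+1 x) /\ (exists2 x, Q i.+1 x & ~ Q i x) &
        forall i a, (i <= m)%N -> p a = 0 -> Q i a].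
Proof.
case=> Q [pQ _ ch]; exists (fun i a => Q i (p a)); split.
- move=> i hi; have [[h1 h2 h3] q1 qm] := pQ i hi; split.
  + by split=> [|x y hx hy|a x hx]; rewrite ?rmorph0 ?rmorphD ?rmorphM //; [apply: h2|apply: h3].
  + by rewrite rmorph1.
  + by move=> x y; rewrite rmorphM; apply: qm.
- move=> i hi; have [h1 [b h2 h3]] := ch i hi; split=> [x|]; first exact: h1.
  by have [a ea] := p_surj b; exists a; rewrite ea.
- by move=> i a hi ->; apply: ideal0; case: (pQ i hi).
Qed.

End Quotients.

(** Regular sequences in P yield chains of primes of the same length, so a bound on chains that is
    attained by a regular sequence determines depth and height. *)
Lemma regular_chain_length (A : comNzRingType) (P : A -> Prop) (xs : seq A) m :
  noetherian A -> prime_ideal P -> regular_seq_in P xs -> size xs = m ->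
  (forall m', prime_chain P m' -> (m' <= m)%N) -> exists m, has_depth P m /\ has_height P m.
Proof.
move=> nA pP hxs sx bound; exists m; split.
  split; first by exists xs.
  by move=> ys hys; apply: bound; apply: regular_prime_chain.
by split=> //; rewrite -sx; apply: regular_prime_chain.
Qed.

Section StarCM.
Variables (k : fieldType) (n s : nat) (d : 'I_s -> nat) (F : forms k n d) (r : nat).
Hypothesis d_gt0 : forall i, (0 < d i)%N.
Let G (i : 'I_s) : {mpoly k[n.+1]} := F i.
Hypothesis goodF : good d G.
Local Notation R := {mpoly k[n.+1]}.
Local Notation zero := (@zero_ideal R).

Lemma form_homog i : G i \is (d i).-homog.
Proof. exact: dhomog_is_dhomog. Qed.

Lemma regular_upto_forms q : (q <= n)%N -> regular_upto G zero (enum 'I_s) q.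
Proof.
move=> qn b t ub _ sb; apply: (good_nzd d_gt0 form_homog goodF ub).
exact: leq_trans qn.
Qed.

Lemma form_coef0 i : (G i)@_0%MM = 0.
Proof.
apply: (dhomog_nemf_coeff (form_homog i)); rewrite /= mdeg0 eq_sym.
by rewrite -lt0n.
Qed.

Lemma coef0_is_ideal : is_ideal (fun g : R => g@_0%MM = 0).
Proof.
split=> [|x y hx hy|a x hx]; first by rewrite mcoeff0.
  by rewrite mcoeffD hx hy addr0.
by rewrite (rmorphM (mcoeff 0%MM)) /= hx mulr0.
Qed.

(** The forms have no constant term, and r <= s provides r of them. *)
Lemma star_proper : (r <= s)%N -> ~ star G zero (enum 'I_s) r 1.
Proof.
move=> rs /starP /(_ (take r (enum 'I_s)) (take_subseq _ _)).
rewrite size_takel ?size_enum_ord // => /(_ erefl).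
have sub := @add_gens_min _ zero (map G (take r (enum 'I_s))) _ coef0_is_ideal.
move/sub => h; have /eqP : (1 : R)@_0%MM = 0.
  apply: h => [x ->|_ /mapP[i _ ->]]; [exact: mcoeff0 | exact: form_coef0].
by rewrite mcoeff1 eqxx oner_eq0.
Qed.

Lemma star_CM : (r <= minn s n)%N -> arithmetically_CM (star_ideal r F).
Proof.
rewrite leq_min => /andP[rs rn]; have rn1 := leqW rn.
have hI : is_ideal (star G zero (enum 'I_s) r).
  by apply: star_ideal_is_ideal; apply: zero_is_ideal.
have [A [p [surj ker]]] := quotient_ring_exists hI (star_proper rs).
exists A, p; split=> // [f|]; first by rewrite star_idealE.
pose phi : {rmorphism k -> A} := p \o @mpolyC n.+1 k.
have gen : generates phi [seq p 'X_i | i <- enum 'I_n.+1].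
  move=> Q h1 h2 h3 h4 b; have [f <-] := surj b.
  have Q0 : Q 0 by have := h1 0; rewrite rmorph0.
  have Q1 : Q 1 by have := h1 1; rewrite rmorph1.
  rewrite [f]mpolyE rmorph_sum; apply: (big_ind Q Q0 h3) => m _ /=.
  rewrite -mul_mpolyC rmorphM; apply: (h4); first exact: h1.
  rewrite mpolyXE_id rmorph_prod; apply: (big_ind Q Q1 h4) => i _.
  rewrite rmorphXn; elim: (m i) => [|j IH]; first by rewrite expr0.
  by rewrite exprS; apply: (h4) => //; apply: h2; apply: map_f; rewrite mem_enum.
have nA : noetherian A := noetherian_generated gen (@noetherian_field k).
split=> // P mP; have pP := maximal_is_prime mP.
have [hP P1 _] := mP.
(* The Nullstellensatz applied to the class of each variable; since P is proper, the monic
   polynomial obtained is not constant. *)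
have hq i : {q : {poly k} | q \is monic /\ P (p (var_poly q i))}.
  apply: constructive_indefinite_description.
  have [q qm hq] := nullstellensatz gen mP (p 'X_i); exists q; split=> //.
  by rewrite /var_poly -horner_map /= -map_poly_comp.
pose q i := sval (hq i).
have qm i : q i \is monic by case: (svalP (hq i)).
have qs i : (1 < size (q i))%N.
  rewrite ltnNge; apply/negP => h; have [_] := svalP (hq i); apply: contra_not P1.
  have q1 : q i = 1.
    have lq : lead_coef (q i) = 1 by apply/eqP; rewrite -monicE; apply: qm.
    have s1 : size (q i) = 1%N.
      by apply/eqP; rewrite eqn_leq h size_poly_gt0 -lead_coef_eq0 lq oner_eq0.
    have c0 : (q i)`_0 = 1 by rewrite -[RHS]lq /lead_coef s1.
    by rewrite (size1_polyC h) c0.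
  rewrite -/(q i) q1 /var_poly map_polyC hornerC /= => hPP.
  by rewrite -(rmorph1 p).
pose ys := [seq var_poly (q i) i | i <- drop r (enum 'I_n.+1)].
apply: (@regular_chain_length _ _ (map p ys) (n.+1 - r)) => //.
- have inP : {in map p ys, forall x, P x}.
    by move=> _ /mapP[_ /mapP[i _ ->] ->]; case: (svalP (hq i)).
  split=> //; split; first by move=> g1; apply: P1; apply: gen_ideal_min g1.
  apply: (regular_seq_quotient surj hI ker).
  apply: wreg_star; first exact: zero_is_ideal.
  + exact: enum_uniq.
  + exact: regular_upto_forms.
  + move=> b ub _ sb; rewrite /ys -sb; apply: good_wreg_vars => //.
    * exact: form_homog.
    * by apply: goodF => //; rewrite sb.
    * by rewrite sb.
- by rewrite size_map size_map size_drop size_enum_ord.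
- move=> m /(prime_chain_pullback surj) [Q [pQ ch kQ]].
  have reg := regular_upto_forms rn.
  have e : (size (enum 'I_s)).+1 = ((s - r).+1 + r)%N by rewrite size_enum_ord; lia.
  (* The bottom prime of the chain contains the star ideal and therefore r of the forms, to which
     the growth bound applies. *)
  have [|b [sb1 sb2] hb] := prime_prods (F := G) (pQ 0%N (leq0n _)) e.
    move=> x hx; apply: kQ => //; apply/ker.
    apply/(star_prods (zero_is_ideal R) (enum_uniq _) reg e).
    by exists 0, x; rewrite add0r.
  rewrite -sb2; apply: (good_height d_gt0 _ _ pQ ch hb).
    by apply: goodF; rewrite ?sb2 //; apply: subseq_uniq sb1 (enum_uniq _).
  by rewrite sb2.
Qed.

End StarCM.

(** * Graded free modules and mapping cones *)

Section FreeModules.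
Variables (k : fieldType) (n : nat).
Local Notation R := {mpoly k[n.+1]}.
Implicit Types (f g : R).

Lemma shifted_homog0 a e : shifted_homog a e (0 : R).
Proof. by rewrite /shifted_homog; case: ifP => // _; apply: dhomog0. Qed.

Lemma shifted_homogD a e f g :
  shifted_homog a e f -> shifted_homog a e g -> shifted_homog a e (f + g).
Proof.
rewrite /shifted_homog; case: ifP => _; first exact: dhomogD.
by move=> /eqP-> /eqP->; rewrite addr0.
Qed.

Lemma shifted_homogN a e f : shifted_homog a e f -> shifted_homog a e (- f).
Proof.
rewrite /shifted_homog; case: ifP => _; last by move/eqP->; rewrite oppr0.
by rewrite dhomogN.
Qed.

Lemma shifted_homogM a c e f g : f \is c.-homog ->
  shifted_homog (c + a) e g -> shifted_homog a e (f * g).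
Proof.
move=> hf; rewrite /shifted_homog; case: leqP => h hg; last first.
  by rewrite (eqP hg) mulr0 -/(shifted_homog a e _) shifted_homog0.
have ha : (a <= e)%N by lia.
rewrite ha (_ : e - a = c + (e - (c + a)))%N; last by lia.
exact: dhomogM.
Qed.

Lemma shifted_homog_shift a c e f : (c <= e)%N ->
  shifted_homog (c + a) e f = shifted_homog a (e - c) f.
Proof. by move=> h; rewrite /shifted_homog leq_subRL // subnDA. Qed.

Lemma shifted_homog_low a c e f : (e < c)%N -> shifted_homog (c + a) e f -> f = 0.
Proof.
move=> h; rewrite /shifted_homog leqNgt (leq_trans h (leq_addr _ _)) /=.
by move/eqP.
Qed.

(* A graded free module with a basis indexed by fI, in the degrees fdeg; fco gives
   the coordinates. *)
Record fmod := FMod {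
  fV :> lmodType R;
  fI : finType;
  fdeg : fI -> nat;
  fco : fV -> fI -> R;
  fco_lin : forall i a (u v : fV), fco (a *: u + v) i = a * fco u i + fco v i;
  fco_inj : forall u v : fV, fco u =1 fco v -> u = v;
  fco_surj : forall g : fI -> R, exists u, fco u =1 g
}.
Arguments fdeg {f} i.
Arguments fco {f} v i : rename.

Definition hom (M : fmod) e (v : M) := forall i, shifted_homog (fdeg i) e (fco v i).
(** The submodule (x_0, ..., x_n) M, used to express minimality. *)
Definition inm (M : fmod) (v : M) := forall i, (fco v i)@_0%MM = 0.
Definition is_lin (U V : lmodType R) (phi : U -> V) :=
  forall a u v, phi (a *: u + v) = a *: phi u + phi v.
Definition is_graded (M N : fmod) (phi : M -> N) := forall e v, hom e v -> hom e (phi v).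
Definition degs (M : fmod) : seq nat := [seq fdeg i | i <- enum (fI M)].

Lemma lin0 (U V : lmodType R) (phi : U -> V) : is_lin phi -> phi 0 = 0.
Proof.
move=> h; have := h 1 0 0; rewrite !scale1r addr0 => e.
by apply: (addrI (phi 0)); rewrite -e addr0.
Qed.
Lemma linD (U V : lmodType R) (phi : U -> V) u v : is_lin phi -> phi (u + v) = phi u + phi v.
Proof. by move=> h; have := h 1 u v; rewrite !scale1r. Qed.
Lemma linZ (U V : lmodType R) (phi : U -> V) a u : is_lin phi -> phi (a *: u) = a *: phi u.
Proof. by move=> h; have := h a u 0; rewrite (lin0 h) !addr0. Qed.
Lemma linN (U V : lmodType R) (phi : U -> V) u : is_lin phi -> phi (- u) = - phi u.
Proof. by move=> h; rewrite -scaleN1r linZ // scaleN1r. Qed.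

Section Coordinates.
Variable M : fmod.
Implicit Types u v : M.

Lemma fco0 i : fco (0 : M) i = 0.
Proof. by have := fco_lin i (-1) (0 : M) 0; rewrite scaler0 addr0 mulN1r addNr. Qed.
Lemma fcoD u v i : fco (u + v) i = fco u i + fco v i.
Proof. by have := fco_lin i 1 u v; rewrite scale1r mul1r. Qed.
Lemma fcoZ a u i : fco (a *: u) i = a * fco u i.
Proof. by have := fco_lin i a u 0; rewrite fco0 !addr0. Qed.
Lemma fcoN u i : fco (- u) i = - fco u i.
Proof. by rewrite -scaleN1r fcoZ mulN1r. Qed.

Lemma hom0 e : hom e (0 : M). Proof. by move=> i; rewrite fco0 shifted_homog0. Qed.
Lemma homD e u v : hom e u -> hom e v -> hom e (u + v).
Proof. by move=> hu hv i; rewrite fcoD shifted_homogD. Qed.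
Lemma homN e u : hom e u -> hom e (- u).
Proof. by move=> hu i; rewrite fcoN shifted_homogN. Qed.
Lemma inm0 : inm (0 : M). Proof. by move=> i; rewrite fco0 mcoeff0. Qed.
Lemma inmD u v : inm u -> inm v -> inm (u + v).
Proof. by move=> hu hv i; rewrite fcoD mcoeffD hu hv addr0. Qed.
Lemma inmN u : inm u -> inm (- u).
Proof. by move=> hu i; rewrite fcoN mcoeffN hu oppr0. Qed.
Lemma inmZ f u : f@_0%MM = 0 -> inm (f *: u).
Proof. by move=> hf i; rewrite fcoZ (rmorphM (mcoeff 0%MM)) /= hf mul0r. Qed.
End Coordinates.

Definition fzero : fmod.
Proof.
refine (@FMod ('rV[R]_0) void (fun=> 0%N) (fun _ _ => 0) _ _ _) => //.
- by move=> u v _; apply/rowP => -[].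
- by move=> g; exists 0 => -[].
Defined.

Definition funit : fmod.
Proof.
refine (@FMod R^o unit (fun=> 0%N) (fun v _ => v) _ _ _) => //.
- by move=> u v /(_ tt).
- by move=> g; exists (g tt) => -[].
Defined.

(** The twist M(-c). It keeps the underlying module, so maps are reused without transport. *)
Definition fshift (c : nat) (M : fmod) : fmod :=
  @FMod (fV M) (fI M) (fun i => c + fdeg i)%N (@fco M) (@fco_lin M) (@fco_inj M) (@fco_surj M).

Definition fsum (M N : fmod) : fmod.
Proof.
refine (@FMod (fV M * fV N)%type (fI M + fI N)%type
  (fun i => match i with inl i => fdeg i | inr i => fdeg i end)
  (fun v i => match i with inl i => fco v.1 i | inr i => fco v.2 i end) _ _ _).
- by move=> [i|i] a u v; apply: fco_lin.
- move=> [u1 u2] [v1 v2] h; congr pair; apply: fco_inj => i.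
    exact: (h (inl i)).
  exact: (h (inr i)).
- move=> g; have [u hu] := fco_surj (fun i => g (inl i)).
  have [v hv] := fco_surj (fun i => g (inr i)).
  by exists (u, v) => -[i|i]; [apply: hu | apply: hv].
Defined.

Lemma hom_fsum (M N : fmod) e (v : fsum M N) : hom e v <-> hom e v.1 /\ hom e v.2.
Proof.
split=> [h|[h1 h2] [i|i]]; [split=> i | exact: h1 | exact: h2].
  exact: (h (inl i)).
exact: (h (inr i)).
Qed.

Lemma inm_fsum (M N : fmod) (v : fsum M N) : inm v.1 -> inm v.2 -> inm v.
Proof. by move=> h1 h2 [i|i]; [apply: h1 | apply: h2]. Qed.

Lemma hom_fshift (M : fmod) c e (v : M) : (c <= e)%N ->
  @hom (fshift c M) e v <-> hom (e - c) v.
Proof.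
by move=> h; split=> hv i; have := hv i; rewrite /= shifted_homog_shift.
Qed.

Lemma hom_fshift_low (M : fmod) c e (v : M) : (e < c)%N -> @hom (fshift c M) e v -> v = 0.
Proof.
move=> h hv; apply: fco_inj => i; rewrite fco0.
exact: shifted_homog_low h (hv i).
Qed.

Lemma graded_fshift (M N : fmod) c (phi : M -> N) : is_lin phi -> is_graded phi ->
  @is_graded (fshift c M) (fshift c N) phi.
Proof.
move=> lphi gphi e v; case: (leqP c e) => h.
  by rewrite !hom_fshift //; apply: gphi.
by move/(hom_fshift_low h) => ->; rewrite (lin0 lphi); apply: hom0.
Qed.

Lemma hom_scale (M : fmod) c e f (v : M) : f \is c.-homog ->
  @hom (fshift c M) e v -> hom e (f *: v).
Proof. by move=> hf hv i; rewrite fcoZ; apply: shifted_homogM (hv i). Qed.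

Lemma degs_fsum M N : degs (fsum M N) = degs M ++ degs N.
Proof.
rewrite /degs (_ : enum (fI (fsum M N)) = map inl (enum (fI M)) ++ map inr (enum (fI N))).
  by rewrite map_cat -!map_comp.
by rewrite enumT unlock /= /sum_enum -!enumT.
Qed.

Lemma degs_fshift c M : degs (fshift c M) = map (addn c) (degs M).
Proof. by rewrite /degs -map_comp. Qed.

Lemma degs_fzero : degs fzero = [::].
Proof. by apply: size0nil; rewrite size_map -cardE card_void. Qed.

Lemma degs_funit : degs funit = [:: 0%N].
Proof. by rewrite /degs enumT unlock. Qed.

Lemma degs_nil (M : fmod) : degs M = [::] -> forall v : M, v = 0.
Proof.
move=> h v; apply: fco_inj => i.
have : i \in enum (fI M) by rewrite mem_enum.
by rewrite (_ : enum (fI M) = [::]) //; apply: size0nil; rewrite -(size_map (@fdeg M)) -/(degs M) h.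
Qed.

End FreeModules.

(** * Augmented complexes and mapping cones *)

Section Complexes.
Variables (k : fieldType) (n : nat).
Local Notation R := {mpoly k[n.+1]}.
Local Notation fmod := (fmod k n).

(** Positions start at 0: [cM C l] becomes the module with index l + 1 in the resolution of an
    ideal. *)
Record cx := Cx { cM : nat -> fmod; cD : forall l, cM l.+1 -> cM l; cE : cM 0%N -> R }.
Arguments cD : clear implicits.

Definition cxmap (C C' : cx) := forall l, cM C l -> cM C' l.

Definition cx_linear (C : cx) :=
  [/\ forall l, is_lin (cD C l), forall a u v, cE (a *: u + v) = a * cE u + @cE C v
    & forall v, @cE C (cD C 0 v) = 0].

Definition cx_graded (C : cx) :=
  (forall l, is_graded (cD C l)) /\ (forall e (v : cM C 0), hom e v -> cE v \is e.-homog).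

Definition cx_minimal (C : cx) := forall l v, inm (cD C l v).

Definition cx_resolves (C : cx) (J : R -> Prop) :=
  [/\ forall f, J f <-> exists v : cM C 0, cE v = f,
      forall v : cM C 0, cE v = 0 <-> exists w, v = cD C 0 w
    & forall l v, cD C l v = 0 <-> exists w, v = cD C l.+1 w].

(** Compatibility with the augmentations makes [phi] cover the inclusion of the ideals; values in
    the maximal ideal times the target keep the cone minimal. *)
Definition lifts_inclusion (C C' : cx) (phi : cxmap C C') :=
  [/\ forall l, is_lin (phi l), forall l, is_graded (phi l), forall l v, inm (phi l v),
      forall l v, phi l (cD C l v) = cD C' l (phi l.+1 v)
    & forall v, cE (phi 0%N v) = cE v].

Section Cone.
Variables (C C' : cx) (phi : cxmap C C') (f : R) (c : nat).

(** C(-c) enters with its position raised by one, so position 0 consists of C'(-c) and C only. *)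
Definition cone_mod l : fmod :=
  match l with
  | 0 => fsum (fshift c (cM C' 0)) (cM C 0)
  | l'.+1 => fsum (fshift c (cM C l')) (fsum (fshift c (cM C' l'.+1)) (cM C l'.+1))
  end.

Definition cone_diff l : cone_mod l.+1 -> cone_mod l :=
  match l with
  | 0 => fun v => (phi v.1 + cD C' 0 v.2.1, - (f *: (v.1 : cM C 0)) + cD C 0 v.2.2)
  | l'.+1 => fun v => (- cD C l' v.1,
      (phi v.1 + cD C' l'.+1 v.2.1, - (f *: (v.1 : cM C l'.+1)) + cD C l'.+1 v.2.2))
  end.

Definition cone_aug (v : cone_mod 0) : R := f * cE (v.1 : cM C' 0) + cE v.2.

(* The mapping cone of (phi, -f) : C(-c) -> C'(-c) + C. *)
Definition cone : cx := Cx cone_diff cone_aug.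

Hypotheses (linC : cx_linear C) (linC' : cx_linear C') (lphi : lifts_inclusion phi).

Lemma cE0 (K : cx) : cx_linear K -> cE (0 : cM K 0) = 0.
Proof. by case=> _ h _; have := h (-1) 0 0; rewrite scaler0 addr0 mulN1r addNr. Qed.
Lemma cED (K : cx) (u v : cM K 0) : cx_linear K -> cE (u + v) = cE u + cE v.
Proof. by case=> _ h _; have := h 1 u v; rewrite scale1r mul1r. Qed.
Lemma cEZ (K : cx) a (u : cM K 0) : cx_linear K -> cE (a *: u) = a * cE u.
Proof. by move=> hK; case: (hK) => _ h _; have := h a u 0; rewrite (cE0 hK) !addr0. Qed.
Lemma cEN (K : cx) (u : cM K 0) : cx_linear K -> cE (- u) = - cE u.
Proof. by move=> hK; rewrite -scaleN1r cEZ // mulN1r. Qed.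

Lemma cone_linear : cx_linear cone.
Proof.
have [lD lE ED] := linC; have [lD' lE' ED'] := linC'; have [lp _ _ _ aug] := lphi.
split=> [[|l] a u v|a u v|v] /=.
- congr pair => /=.
    by rewrite lp lD' scalerDr addrACA.
  rewrite lD !scalerDr !scalerA mulrC opprD addrACA; congr (_ + _).
  by rewrite scalerN scalerA.
- congr pair => /=; first by rewrite lD opprD scalerN.
  congr pair => /=; first by rewrite lp lD' scalerDr addrACA.
  by rewrite lD !scalerDr !scalerA mulrC opprD addrACA scalerN scalerA.
- by rewrite /cone_aug /= lE lE'; ring.
- rewrite /cone_aug /= !cED // ED ED' aug cEN // cEZ //; ring.
Qed.

Lemma cone_graded : f \is c.-homog -> cx_graded C -> cx_graded C' -> cx_graded cone.
Proof.
move=> hf [gD gE] [gD' gE']; have [lp gp _ _ _] := lphi.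
have [lD _ _] := linC; have [lD' _ _] := linC'.
split=> [[|l] e v|e v] /=.
- case/hom_fsum=> h1 /hom_fsum [h2 h3]; apply/hom_fsum; split=> /=.
    apply: homD; first exact: (graded_fshift (lp 0%N) (gp 0%N)).
    exact: (graded_fshift (lD' 0%N) (gD' 0%N)).
  by apply: homD; [apply: homN; apply: hom_scale h1 | apply: gD].
- case/hom_fsum=> h1 /hom_fsum [h2 h3]; apply/hom_fsum; split=> /=.
    by apply: homN; apply: (graded_fshift (lD l) (gD l)).
  apply/hom_fsum; split=> /=.
    apply: homD; first exact: (graded_fshift (lp l.+1) (gp l.+1)).
    exact: (graded_fshift (lD' l.+1) (gD' l.+1)).
  by apply: homD; [apply: homN; apply: hom_scale h1 | apply: gD].
- case/hom_fsum=> h1 h2; apply: dhomogD; last exact: gE.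
  case: (leqP c e) => he; last first.
    by rewrite (hom_fshift_low he h1) (cE0 linC') mulr0 dhomog0.
  rewrite -(subnKC he); apply: dhomogM => //; apply: gE'.
  exact/hom_fshift.
Qed.

Lemma cone_minimal : f@_0%MM = 0 -> cx_minimal C -> cx_minimal C' -> cx_minimal cone.
Proof.
move=> hf mC mC'; have [_ _ mp _ _] := lphi.
move=> [|l] v /=; apply: inm_fsum => /=.
- exact: (inmD (mp 0%N _) (mC' 0%N _)).
- by apply: inmD; [apply: inmN; apply: inmZ | apply: mC].
- exact: (inmN (mC l _)).
apply: inm_fsum => /=; first exact: (inmD (mp l.+1 _) (mC' l.+1 _)).
by apply: inmD; [apply: inmN; apply: inmZ | apply: mC].
Qed.

(** As f is regular modulo J, the relations f y + z = 0 with y in J' and z in J are the pairs (a, -f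
    a) with a in J. The summand C(-c) accounts for them; the rest is lifting along the exact
    complexes C and C'. *)
Lemma cone_resolves (J J' : R -> Prop) : f != 0 -> nzd_mod J f -> is_ideal J ->
  cx_resolves C J -> cx_resolves C' J' ->
  cx_resolves cone (fun x => exists y z, [/\ J' y, J z & x = f * y + z]).
Proof.
move=> f0 nzd hJ [imC exE exD] [imC' exE' exD'].
have [lp _ _ comm aug] := lphi; have [lD _ _] := linC; have [lD' _ _] := linC'.
have DD l v : cD C l (cD C l.+1 v) = 0 by apply/exD; exists v.
have DD' l v : cD C' l (cD C' l.+1 v) = 0 by apply/exD'; exists v.
have ED v : cE (cD C 0 v) = 0 by apply/exE; exists v.
have ED' v : cE (cD C' 0 v) = 0 by apply/exE'; exists v.
split.
- move=> x; split.
    case=> y [z [/imC' [u <-] /imC [v <-] ->]].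
    by exists ((u, v) : cM cone 0).
  case=> -[u v] <-; exists (cE (u : cM C' 0)), (cE v); split=> //.
    by apply/imC'; exists u.
  by apply/imC; exists v.
- move=> [u v]; split; last first.
    case=> -[a [u' v']] [-> ->]; rewrite /= /cone_aug /=.
    by rewrite !cED // ED' ED cEN // cEZ // aug; ring.
  rewrite /= /cone_aug /= => e0.
  have [a ea] : exists a : cM C 0, cE a = cE (u : cM C' 0).
    apply/imC; apply: nzd; rewrite -[_ * _](addrK (cE v)) e0 sub0r.
    by apply: idealN => //; apply/imC; exists v.
  have [u' eu] : exists w, (u : cM C' 0) - phi a = cD C' 0 w.
    by apply/exE'; rewrite cED // cEN // aug ea subrr.
  have [v' ev] : exists w, v + f *: a = cD C 0 w.
    by apply/exE; rewrite cED // cEZ // ea addrC.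
  exists ((a, (u', v')) : cM cone 1); rewrite /= -eu -ev; congr pair => /=.
    by rewrite addrC subrK.
  by rewrite addrC addrK.
- move=> [|l] [a [u v]]; split.
  + case=> e1 e2.
    (* No component of the differential says directly that a is a cycle. Augmenting the second one
       shows that f kills [cE a], and R is a domain. *)
    have [a' ea] : exists a', (a : cM C 0) = cD C 0 a'.
      apply/exE; have := congr1 (@cE C) e2; rewrite (cE0 linC) cED // cEN // cEZ // ED addr0.
      by move/eqP; rewrite oppr_eq0 mulf_eq0 (negPf f0) /= => /eqP.
    have [u' eu] : exists w, phi a' + (u : cM C' 1) = cD C' 1 w.
      by apply/exD'; rewrite linD // -comm -ea.
    have [v' ev] : exists w, v - f *: a' = cD C 1 w.
      apply/exD; rewrite linD // linN // linZ // -ea addrC.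
      exact: e2.
    exists ((- a', (u', v')) : cM cone 2); rewrite /= -eu -ev; congr pair => /=.
      by rewrite linN // opprK.
    congr pair => /=; first by rewrite linN // addKr.
    by rewrite scalerN opprK addrC subrK.
  + case=> -[a' [u' v']] [-> -> ->] /=; congr pair => /=.
      rewrite linN // linD // comm DD' addr0; exact: addNr.
    rewrite (linD _ _ (lD 0%N)) (linN _ (lD 0%N)) (linZ _ _ (lD 0%N)) DD addr0 scalerN opprK; exact: subrr.
  + case=> e1 e2 e3.
    have [a' ea] : exists a', (a : cM C l.+1) = cD C l.+1 a'.
      by apply/exD; apply: oppr_inj; rewrite oppr0.
    have [u' eu] : exists w, phi a' + (u : cM C' l.+2) = cD C' l.+2 w.
      by apply/exD'; rewrite linD // -comm -ea.
    have [v' ev] : exists w, v - f *: a' = cD C l.+2 w.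
      apply/exD; rewrite linD // linN // linZ // -ea addrC.
      exact: e3.
    exists ((- a', (u', v')) : cM cone l.+3); rewrite /= -eu -ev; congr pair => /=.
      by rewrite linN // opprK.
    congr pair => /=; first by rewrite linN // addKr.
    by rewrite scalerN opprK addrC subrK.
  + case=> -[a' [u' v']] [-> -> ->] /=; congr pair => /=.
      by rewrite linN // DD !oppr0.
    congr pair => /=.
      rewrite linN // linD // comm DD' addr0; exact: addNr.
    rewrite (linD _ _ (lD l.+1)) (linN _ (lD l.+1)) (linZ _ _ (lD l.+1)) DD addr0 scalerN opprK; exact: subrr.
Qed.

Lemma cone_degs0 : degs (cM cone 0) = map (addn c) (degs (cM C' 0)) ++ degs (cM C 0).
Proof. by rewrite /= degs_fsum degs_fshift. Qed.

Lemma cone_degsS l : degs (cM cone l.+1) = map (addn c) (degs (cM C l)) ++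
  map (addn c) (degs (cM C' l.+1)) ++ degs (cM C l.+1).
Proof. by rewrite /= !degs_fsum !degs_fshift. Qed.

End Cone.

Definition unit_mod l : fmod := if l is 0 then funit k n else fzero k n.
Definition unit_cx : cx := @Cx unit_mod (fun _ _ => 0) (fun v => v).
Definition zero_cx : cx := @Cx (fun=> fzero k n) (fun _ _ => 0) (fun=> 0).

(** Diagonal on the summands. No homotopy terms occur, because the two cones are built from the same
    maps [phi2] and [phi1]. *)
Definition cone_map (C2 C1 C0 : cx) (phi2 : cxmap C2 C1) (phi1 : cxmap C1 C0) f c :
    cxmap (cone phi2 f c) (cone phi1 f c) :=
  fun l => match l with
  | 0 => fun v => (phi1 0%N v.1, phi2 0%N v.2)
  | l'.+1 => fun v => (phi2 l' v.1, (phi1 l'.+1 v.2.1, phi2 l'.+1 v.2.2))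
  end.

Arguments cone_map {C2 C1 C0} phi2 phi1 f c l v.

(** R alone resolves the unit ideal, so the augmentation itself lifts the inclusion into it; this
    starts the recursion for the lifts. *)
Definition aug_map (C : cx) : cxmap C unit_cx :=
  fun l => match l with 0 => @cE C | _.+1 => fun=> 0 end.
Arguments aug_map : clear implicits.

Lemma unit_linear : cx_linear unit_cx.
Proof. by split=> // l a u v /=; rewrite scaler0 addr0. Qed.

Lemma zero_linear : cx_linear zero_cx.
Proof. by split=> [l a u v|a u v|v] //=; rewrite ?scaler0 ?mulr0 addr0. Qed.

Lemma unit_graded : cx_graded unit_cx.
Proof. by split=> [l e v _|e v /(_ tt)]; [exact: hom0 | rewrite /shifted_homog subn0]. Qed.

Lemma zero_graded : cx_graded zero_cx.
Proof. by split=> [l e v _|e v _]; [exact: hom0 | exact: dhomog0]. Qed.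

Lemma fzeroE (u v : fzero k n) : u = v.
Proof. by apply/rowP => -[]. Qed.

Lemma unit_resolves : cx_resolves unit_cx (fun=> True).
Proof.
split=> [f|v|[|l] v]; split=> //.
- by move=> _; exists f.
- by move=> /= ->; exists 0.
- by case=> w ->.
- by move=> _; exists 0; apply: fzeroE.
- by move=> _; exists 0; apply: fzeroE.
Qed.

Lemma zero_resolves : cx_resolves zero_cx (@zero_ideal R).
Proof.
split=> [f|v|l v]; split=> //.
- by move->; exists 0.
- by case=> v.
- by move=> _; exists 0; apply: fzeroE.
- by move=> _; exists 0; apply: fzeroE.
Qed.

Lemma aug_lifts (C : cx) : cx_linear C -> cx_graded C ->
  (forall v : cM C 0, (cE v)@_0%MM = 0) -> lifts_inclusion (aug_map C).
Proof.
move=> [lD lE ED] [gD gE] mE; split=> //.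
- by move=> [|l] a u v /=; [apply: lE | apply: fzeroE].
- by move=> [|l] e v hv /=; [move=> i; rewrite /shifted_homog subn0; apply: gE | apply: hom0].
- by move=> [|l] v /=; [move=> i; apply: mE | apply: inm0].
- by move=> [|l] v /=; [apply: ED | apply: fzeroE].
Qed.

Lemma zero_lifts (C : cx) : cx_linear C -> lifts_inclusion ((fun l => fun=> 0) : cxmap zero_cx C).
Proof.
move=> linC; have [lD _ _] := linC; split=> [l a u v|l e v _|l v|l v|v].
- by rewrite scaler0 addr0.
- exact: hom0.
- exact: inm0.
- by rewrite (lin0 (lD l)).
- exact: cE0.
Qed.

Lemma cone_map_lifts (C2 C1 C0 : cx) (phi2 : cxmap C2 C1) (phi1 : cxmap C1 C0) f c :
  cx_linear C2 -> cx_linear C1 -> cx_linear C0 ->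
  lifts_inclusion phi2 -> lifts_inclusion phi1 -> lifts_inclusion (cone_map phi2 phi1 f c).
Proof.
move=> linC2 linC1 linC0 [l2 g2 m2 c2 a2] [l1 g1 m1 c1 a1]; split.
- by move=> [|l] a u v /=; rewrite ?l1 ?l2.
- move=> [|l] e v /=.
    case/hom_fsum=> h1 h2; apply/hom_fsum; split=> /=; last exact: g2.
    exact: (graded_fshift (l1 0%N) (g1 0%N)).
  case/hom_fsum=> h1 /hom_fsum [h2 h3]; apply/hom_fsum; split=> /=.
    exact: (graded_fshift (l2 l) (g2 l)).
  apply/hom_fsum; split=> /=; last exact: g2.
  exact: (graded_fshift (l1 l.+1) (g1 l.+1)).
- by move=> [|l] v /=; apply: inm_fsum => /=; [exact: (m1 0%N _)|exact: m2|exact: (m2 l _)|];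
    apply: inm_fsum => /=; [exact: (m1 l.+1 _) | exact: m2].
- move=> [|l] [a [u v]] /=; congr pair => /=.
  + by rewrite (linD _ _ (l1 0%N)) c1.
  + by rewrite (linD _ _ (l2 0%N)) (linN _ (l2 0%N)) (linZ _ _ (l2 0%N)) c2.
  + by rewrite (linN _ (l2 l)) c2.
  congr pair => /=.
    by rewrite (linD _ _ (l1 l.+1)) c1.
  by rewrite (linD _ _ (l2 l.+1)) (linN _ (l2 l.+1)) (linZ _ _ (l2 l.+1)) c2.
- by move=> [u v]; rewrite /= /cone_aug /= a1 a2.
Qed.

End Complexes.
Arguments cD {k n} c l _.
Arguments cone_map {k n C2 C1 C0} phi2 phi1 f c l v.
Arguments aug_map {k n} C l v.

(** * Resolutions of the ideals of products *)

Fixpoint subsums (ds : seq nat) (m : nat) : seq nat :=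
  match m, ds with
  | 0, _ => [:: 0%N]
  | _.+1, [::] => [::]
  | m'.+1, e :: ds' => map (addn e) (subsums ds' m') ++ subsums ds' m
  end.

Lemma subsumsS e ds m :
  subsums (e :: ds) m.+1 = map (addn e) (subsums ds m) ++ subsums ds m.+1.
Proof. by []. Qed.

(** The shifts in position l for products of q members. For q = 0 the binomial, with its truncated
    subtraction, is 1 at l = 0 and 0 afterwards, as for the resolution of the unit ideal. *)
Definition star_shifts (ds : seq nat) (q l : nat) : seq nat :=
  flatten (nseq 'C(q + l - 1, l) (subsums ds (q + l))).

Lemma count_star_shifts a ds q l :
  count a (star_shifts ds q l) = ('C(q + l - 1, l) * count a (subsums ds (q + l)))%N.
Proof. by rewrite count_flatten map_nseq sumn_nseq mulnC. Qed.

Section StarComplex.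
Variables (k : fieldType) (n : nat) (T : eqType) (d : T -> nat).
Local Notation R := {mpoly k[n.+1]}.
Variable G : T -> R.
Hypotheses (d_gt0 : forall t, (0 < d t)%N) (G_homog : forall t, G t \is (d t).-homog).
Local Notation zero := (@zero_ideal R).

Lemma regular_upto_leq ts q r : (q <= r)%N -> regular_upto G zero ts r -> regular_upto G zero ts q.
Proof. by move=> qr h bs t hu hs hb; apply: h => //; apply: leq_trans qr. Qed.

(** The ideal of products is a star ideal of codimension parameter size ts + 1 - q, for which
    regularity is known; for larger q it is zero. *)
Lemma nzd_prods t ts q r : uniq (t :: ts) -> regular_upto G zero (t :: ts) r ->
  ((size ts).+1 <= q + r)%N -> nzd_mod (prods G ts q) (G t).
Proof.
move=> ut reg h y; have /andP[tt ut'] := ut.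
case: (leqP q (size ts).+1) => hq; last first.
  move/(prods0 (ltnW hq)) => e0.
  have reg0 : nzd_mod zero (G t) by apply: (reg [::] t) => // x; rewrite /= inE => /eqP->; apply: mem_head.
  by rewrite (reg0 _ e0); apply: ideal0; apply: prods_ideal.
have e : (size ts).+1 = (q + ((size ts).+1 - q))%N by lia.
have reg' : regular_upto G zero (t :: ts) ((size ts).+1 - q).
  by apply: regular_upto_leq reg; lia.
have P z : star G zero ts ((size ts).+1 - q) z <-> prods G ts q z.
  rewrite (star_prods (zero_is_ideal R) ut' (regular_uptoW reg') e); split.
    by case=> _ [z' [-> hz ->]]; rewrite add0r.
  by move=> hz; exists 0, z; rewrite add0r.
by move=> /P /(nzd_star ut reg') /P.
Qed.

(** All q are built at once, because the cone for q + 1 uses the complexes for q and q + 1 on the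
    shorter list together with the lift between them. Exactness is claimed only in the range where
    regularity up to r suffices. *)
Lemma star_complex ts r : uniq ts -> regular_upto G zero ts r ->
  exists (C : nat -> cx k n) (phi : forall q, cxmap (C q.+1) (C q)), forall q,
  [/\ cx_linear (C q), cx_graded (C q), cx_minimal (C q), lifts_inclusion (phi q) &
   [/\ forall v : cM (C q.+1) 0, (cE v)@_0%MM = 0,
       (size ts < q + r)%N -> cx_resolves (C q) (prods G ts q)
     & forall l, perm_eq (degs (cM (C q) l)) (star_shifts (map d ts) q l)]].
Proof.
elim: ts => [|t ts IH] ut reg.
  pose C q := if q is 0 then unit_cx k n else zero_cx k n.
  have linC q : cx_linear (C q) by case: q => [|q]; [exact: unit_linear | exact: zero_linear].
  exists C, (fun q l => fun=> 0) => q; split=> //.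
  - by case: q => [|q]; [exact: unit_graded | exact: zero_graded].
  - by case: q => [|q] l v; exact: inm0.
  - exact: zero_lifts.
  split.
  - by move=> v; rewrite /= mcoeff0.
  - by case: q => [|q] _; [exact: unit_resolves | exact: zero_resolves].
  - case: q => [|q] l; apply/permP => a; rewrite count_star_shifts.
      case: l => [|l]; first by rewrite bin0 mul1n /= degs_funit.
      by rewrite /= degs_fzero /= add0n subn1 bin_small.
    by rewrite /= degs_fzero addSn muln0.
have /andP[tt ut'] := ut.
have [C [phi hC]] := IH ut' (regular_uptoW reg).
(* With t added, the ideal for q + 1 is G t J(ts, q) + J(ts, q + 1), hence a cone. The lifts are
   diagonal, except for the augmentation at q = 0. *)
pose C' q := if q is q'.+1 then cone (phi q') (G t) (d t) else unit_cx k n.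
pose phi' q : cxmap (C' q.+1) (C' q) := match q with
  | 0 => aug_map (C' 1%N)
  | q'.+1 => cone_map (phi q'.+1) (phi q') (G t) (d t) end.
have Gt0 : (G t)@_0%MM = 0.
  apply: (dhomog_nemf_coeff (G_homog t)); rewrite /= mdeg0 eq_sym -lt0n; exact: d_gt0.
have reg0 : nzd_mod zero (G t) by apply: (reg [::] t) => // x; rewrite /= inE => /eqP->; apply: mem_head.
have Gn0 : G t != 0.
  apply/eqP => e0; have : (1 : R) = 0 by apply: reg0; rewrite e0 mul0r.
  by apply/eqP; apply: oner_neq0.
have lin' q : cx_linear (C' q).
  case: q => [|q]; first exact: unit_linear.
  by apply: cone_linear; [case: (hC q.+1)|case: (hC q)|case: (hC q)].
have gr' q : cx_graded (C' q).
  case: q => [|q]; first exact: unit_graded.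
  by apply: cone_graded => //; [case: (hC q.+1)|case: (hC q)|case: (hC q)|case: (hC q.+1)|case: (hC q)].
have mE q (v : cM (C' q.+1) 0) : (cE v)@_0%MM = 0.
  have [_ _ _ _ [m0 _ _]] := hC q; rewrite /= /cone_aug mcoeffD m0 addr0.
  by rewrite (rmorphM (mcoeff 0%MM)) /= Gt0 mul0r.
exists C', phi' => q; split=> //.
- case: q => [|q]; first by move=> l v; exact: inm0.
  by apply: cone_minimal => //; [case: (hC q)|case: (hC q.+1)|case: (hC q)].
- case: q => [|q]; first exact: aug_lifts.
  by apply: cone_map_lifts; [case: (hC q.+2)|case: (hC q.+1)|case: (hC q)|case: (hC q.+1)|case: (hC q)].
split=> //.
- case: q => [|q] h; first exact: unit_resolves.
  have [l1 _ _ lp [_ r1 _]] := hC q; have [l2 _ _ _ [_ r2 _]] := hC q.+1.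
  apply: cone_resolves => //.
  + apply: (nzd_prods ut reg); exact: ltnW h.
  + exact: prods_ideal.
  + by apply: r2; exact: ltnW h.
  + by apply: r1; move: h; rewrite /= addSn ltnS.
- move=> l; apply/permP => a; rewrite count_star_shifts.
  case: q => [|q].
    case: l => [|l]; first by rewrite bin0 mul1n /= degs_funit.
    by rewrite /= degs_fzero /= add0n subn1 bin_small ?mul0n.
  have [_ _ _ _ [_ _ s1]] := hC q; have [_ _ _ _ [_ _ s2]] := hC q.+1.
  case: l => [|l].
    rewrite /C' cone_degs0 count_cat count_map.
    rewrite (permP (s1 0%N)) (permP (s2 0%N)) !count_star_shifts !addn0 !bin0 !mul1n.
    by rewrite /= count_cat count_map.
  have -> : count a (subsums (map d (t :: ts)) (q.+1 + l.+1)) =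
      (count (preim (addn (d t)) a) (subsums (map d ts) (q + l.+1)) +
       count a (subsums (map d ts) (q.+1 + l.+1)))%N.
    by rewrite addSn subsumsS count_cat count_map.
  rewrite /C' cone_degsS !count_cat (count_map _ _ (degs (cM (C q.+1) l))) (count_map _ _ (degs (cM (C q) l.+1))) (permP (s1 l.+1)) (permP (s2 l)) (permP (s2 l.+1)).
  (* Both twisted summands have shifts from the same subsums, of (q + l).+1 degrees, and their
     multiplicities add up by Pascal's rule. *)
  rewrite !count_star_shifts.
  rewrite (_ : q.+1 + l.+1 - 1 = (q + l).+1)%N; last by lia.
  rewrite (_ : q.+1 + l - 1 = q + l)%N; last by lia.
  rewrite (_ : q + l.+1 - 1 = q + l)%N; last by lia.
  rewrite (_ : q.+1 + l.+1 = (q + l).+2)%N; last by lia.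
  rewrite (_ : q.+1 + l = (q + l).+1)%N; last by lia.
  rewrite (_ : q + l.+1 = (q + l).+1)%N; last by lia.
  by rewrite addnA -mulnDl [('C(q + l, l) + _)%N]addnC -binS mulnDr.
Qed.

End StarComplex.

(** Allows a basis to be reordered so that its degrees appear in a prescribed order. *)
Lemma perm_map_lift (T : eqType) (f : T -> nat) (s : seq nat) (t : seq T) :
  perm_eq s (map f t) -> exists2 t', perm_eq t' t & s = map f t'.
Proof.
elim: s t => [|x s IH] t h.
  exists [::] => //; move/perm_size: h; rewrite size_map => /esym /size0nil ->.
  exact: perm_refl.
have /mapP[y yt exy] : x \in map f t by rewrite -(perm_mem h) mem_head.
have ht := perm_to_rem yt.
have : perm_eq s (map f (rem y t)).
  have := perm_trans h (perm_map f ht); rewrite /= exy perm_cons; exact.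
case/IH=> t' h1 h2; exists (y :: t'); last by rewrite /= exy h2.
by rewrite perm_sym (perm_trans ht) // perm_cons perm_sym.
Qed.

(** * From coordinate-free complexes to matrices *)

Section Matrices.
Variables (k : fieldType) (n : nat).
Local Notation R := {mpoly k[n.+1]}.

Lemma lin_row_mx (m p : nat) (g : 'rV[R]_m -> 'rV[R]_p) (v : 'rV[R]_m) :
  is_lin g -> g v = v *m lin1_mx g.
Proof.
move=> lg; pose g' : {linear 'rV[R]_m -> 'rV[R]_p} :=
  HB.pack g (GRing.isLinear.Build R 'rV[R]_m 'rV[R]_p _ g lg).
by rewrite -[g]/(g' : _ -> _) mul_rV_lin1.
Qed.

Record coord_iso (M : fmod k n) (s : seq nat)
    (to_row : M -> 'rV[R]_(size s)) (of_row : 'rV[R]_(size s) -> M) : Prop := CoordIso {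
  to_lin : is_lin to_row;
  of_lin : is_lin of_row;
  toK : cancel to_row of_row;
  ofK : cancel of_row to_row;
  of_delta : forall i : 'I_(size s), hom (nth 0%N s i) (of_row (delta_mx 0 i));
  to_hom : forall e v, hom e v -> forall i : 'I_(size s), shifted_homog (nth 0%N s i) e (to_row v 0 i);
  to_inm : forall v, inm v -> forall i, (to_row v 0 i)@_0%MM = 0 }.

Lemma coord_iso_exists (M : fmod k n) (s : seq nat) : perm_eq s (degs M) ->
  exists to_row of_row, @coord_iso M s to_row of_row.
Proof.
case/perm_map_lift=> js pjs es.
have ejs : size s = size js by rewrite es size_map.
have ujs : uniq js by rewrite (perm_uniq pjs) enum_uniq.
have injs i : i \in js by rewrite (perm_mem pjs) mem_enum.
have hidx i : (index i js < size s)%N by rewrite ejs index_mem.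
pose tau i : 'I_(size s) := Ordinal (hidx i).
pose sig (j : 'I_(size s)) : fI M := tnth (in_tuple js) (cast_ord ejs j).
have sigE x0 j : sig j = nth x0 js j by rewrite /sig (tnth_nth x0).
have sigK j : tau (sig j) = j.
  by apply: val_inj; rewrite /= (sigE (sig j)) index_uniq // -ejs.
have tauK i : sig (tau i) = i by rewrite (sigE i) /= nth_index.
have degE (j : 'I_(size s)) : nth 0%N s j = fdeg (sig j).
  have nthE x0 (m : nat) : (m < size js)%N -> nth 0%N s m = fdeg (nth x0 js m).
    by move=> hm; rewrite es (nth_map x0).
  by rewrite (nthE (sig j)) -?ejs // -sigE.
have ofP (w : 'rV[R]_(size s)) : {u : M | fco u =1 fun i => w 0 (tau i)}.
  by apply: constructive_indefinite_description; apply: fco_surj.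
pose to_row (v : M) : 'rV[R]_(size s) := \row_j fco v (sig j).
pose of_row w := sval (ofP w).
have ofE w i : fco (of_row w) i = w 0 (tau i) by apply: (svalP (ofP w)).
exists to_row, of_row; split.
- by move=> a u v; apply/rowP => j; rewrite !mxE fcoD fcoZ.
- by move=> a u v; apply: fco_inj => i; rewrite fcoD fcoZ !ofE !mxE.
- by move=> v; apply: fco_inj => i; rewrite ofE mxE tauK.
- by move=> w; apply/rowP => j; rewrite mxE ofE sigK.
- move=> j i; rewrite ofE mxE eqxx /=; case: eqP => [<-|_]; last exact: shifted_homog0.
  by rewrite degE tauK /shifted_homog leqnn subnn dhomog1.
- by move=> e v hv j; rewrite mxE degE; apply: hv.
- by move=> v hv j; rewrite mxE; apply: hv.
Qed.

(** Bases ordered as in F turn the differentials into matrices; the vanishing module in position c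
    makes the last one injective. *)
Lemma cx_min_resolution (C : cx k n) (J : R -> Prop) (c : nat) (F : nat -> seq nat) :
  (0 < c)%N -> cx_linear C -> cx_graded C -> cx_minimal C -> cx_resolves C J ->
  degs (cM C c) = [::] -> (forall l, (l < c)%N -> perm_eq (F l.+1) (degs (cM C l))) ->
  min_graded_free_resolution J c F.
Proof.
move=> c0 linC [gD gE] mC [imC exE exD] Cc hF; have [lD lE _] := linC.
have iso l : {ab : (cM C l -> 'rV[R]_(size (F l.+1))) * ('rV[R]_(size (F l.+1)) -> cM C l) |
    (l < c)%N -> coord_iso ab.1 ab.2}.
  apply: constructive_indefinite_description; case: (ltnP l c) => [/hF|_].
    by case/coord_iso_exists=> a [b hab]; exists (a, b).
  by exists (fun=> 0, fun=> 0).
pose to_row l := (sval (iso l)).1; pose of_row l := (sval (iso l)).2.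
have isoP l : (l < c)%N -> coord_iso (to_row l) (of_row l) by apply: (svalP (iso l)).
pose eps : 'cV[R]_(size (F 1%N)) := \col_i cE (of_row 0%N (delta_mx 0 i)).
have epsE v : (v *m eps) 0 0 = cE (of_row 0%N v).
  have [_ lof _ _ _ _ _] := isoP 0%N c0.
  rewrite {2}(row_sum_delta v) mxE.
  elim/big_rec2: _ => [|i y x _ ->]; first by rewrite (lin0 lof) (cE0 linC).
  by rewrite lof lE mxE.
pose dm l := to_row l \o cD C l \o of_row l.+1.
pose D l : 'M[R]_(size (F l.+1), size (F l)) :=
  match l with 0 => 0 | l'.+1 => lin1_mx (dm l') end.
have dm_lin l : (l.+1 < c)%N -> is_lin (dm l).
  move=> hl a u v; rewrite /dm /= (of_lin (isoP _ hl)) lD.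
  by rewrite (to_lin (isoP _ (ltnW hl))).
have DE l v : (l.+1 < c)%N -> v *m D l.+1 = to_row l (cD C l (of_row l.+1 v)).
  by move=> hl; rewrite /D -lin_row_mx //; apply: dm_lin.
have Dij l i j : (l.+1 < c)%N -> D l.+1 i j = to_row l (cD C l (of_row l.+1 (delta_mx 0 i))) 0 j.
  by move=> hl; rewrite -DE // -rowE [RHS]mxE.
have row_eq0 l v : (l < c)%N -> of_row l v = 0 <-> v = 0.
  move=> hl; split=> [e0|->]; last exact: lin0 (of_lin (isoP _ hl)).
  by rewrite -(ofK (isoP _ hl) v) e0; apply: lin0 (to_lin (isoP _ hl)).
have bd l (v : 'rV[R]_(size (F l.+1))) : (l < c)%N ->
    (if (l.+1 < c)%N then exists w, v = w *m D l.+1 else v = 0) <->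
    exists w, of_row l v = cD C l w.
  move=> hl; case: ltnP => hl1.
    split=> -[w].
      move->; exists (of_row l.+1 w); rewrite DE //; exact: (toK (isoP _ hl)).
    move=> ew; exists (to_row l.+1 w); rewrite DE //.
    by rewrite (toK (isoP _ hl1)) -ew (ofK (isoP _ hl)).
  rewrite -row_eq0 //; split=> [->|[w ->]].
    by exists 0; rewrite (lin0 (lD l)).
  have ecl : c = l.+1 by apply/eqP; rewrite eqn_leq hl hl1.
  have -> : w = 0 by apply: degs_nil; rewrite -ecl.
  exact: lin0 (lD l).
exists eps, D; split=> //.
- split.
    move=> i; rewrite mxE /shifted_homog; have := of_delta (isoP _ c0) i.
    by move/gE; rewrite leq0n subn0.
  move=> f; rewrite imC; split=> -[v ev].
    by exists (to_row 0%N v); rewrite epsE (toK (isoP _ c0)).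
  by exists (of_row 0%N v); rewrite -epsE.
- case=> // l hl; split=> i j; rewrite Dij //.
    by apply: (to_hom (isoP _ (ltnW hl))); apply: gD; apply: (of_delta (isoP _ hl)).
  by apply: (to_inm (isoP _ (ltnW hl))); apply: mC.
- move=> v; rewrite bd // -exE -epsE; split=> [->|e0]; first by rewrite mxE.
  by apply/matrixP => i j; rewrite !ord1 e0 mxE.
- case=> // l hl v; rewrite bd // -exD DE //; split.
    move=> e0; rewrite -(toK (isoP _ (ltnW hl)) (cD C l _)) e0.
    exact: lin0 (of_lin (isoP _ (ltnW hl))).
  by move->; exact: lin0 (to_lin (isoP _ (ltnW hl))).
Qed.

End Matrices.

(** * Genericity *)

Section RadixMatrix.
Variables (n : nat) (e : 'I_n -> nat).

Definition bounded_mon D (i : 'I_#|{: 'X_{1..n < D}}|) : 'X_{1..n} :=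
  (enum_val i : 'X_{1..n < D}).

(** The radix map in degrees below D, over an arbitrary base ring so that the coefficients of the
    forms may be indeterminates. *)
Definition radix_mx (K : comNzRingType) (f : 'I_n -> {mpoly K[n]}) D :
    'M[K]_#|{: 'X_{1..n < D}}| :=
  \matrix_(i, j) (radix_mon e f (bounded_mon i))@_(bounded_mon j).

Lemma map_radix_mx (K L : comNzRingType) (h : {rmorphism K -> L}) f g D :
  (forall i, map_mpoly h (f i) = g i) -> map_mx h (radix_mx f D) = radix_mx g D.
Proof.
move=> hfg; apply/matrixP => i j; rewrite !mxE -mcoeff_map_mpoly; congr (_@_ _).
rewrite /radix_mon rmorph_prod; apply: eq_bigr => l _ /=.
by rewrite rmorphM !rmorphXn /= hfg map_mpolyX.
Qed.

(** Surjectivity propagates from low degrees, so finitely many determinants decide it. *)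
Lemma radix_mx_unit (k : fieldType) (f : 'I_n -> {mpoly k[n]}) :
  (forall i, (0 < e i)%N) -> (forall i, msize (f i) <= (e i).+1)%N ->
  (forall D, (D <= (\sum_i (e i).-1).+2)%N -> \det (radix_mx f D) != 0) ->
  forall g, exists2 h, (msize h <= msize g)%N & radix e f h = g.
Proof.
move=> e0 hf hdet; apply: radix_surj => // m hm; pose D := (mdeg m).+1.
have um : radix_mx f D \in unitmx by rewrite unitmxE unitfE; apply: hdet.
have hmD : (mdeg m < D)%N by [].
pose w : 'rV[k]_#|{: 'X_{1..n < D}}| :=
  delta_mx 0 (enum_rank (BMultinom hmD)) *m invmx (radix_mx f D).
have wE : w *m radix_mx f D = delta_mx 0 (enum_rank (BMultinom hmD)) by rewrite mulmxKV.
pose h := \sum_i w 0 i *: 'X_[bounded_mon i] : {mpoly k[n]}.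
have hh : (msize h <= D)%N.
  apply: msize_sum_leq => i _; apply: leq_trans (msizeZ_le _ _) _.
  by rewrite msizeX; apply: bmdeg.
exists h => //; apply/mpolyP => m'; rewrite mcoeffX.
case: (ltnP (mdeg m') D) => hm'; last first.
  rewrite (_ : (radix e f h)@_m' = 0); last first.
    apply/eqP; rewrite mcoeff_eq0; apply: msize_mdeg_ge.
    exact: leq_trans (leq_trans (radix_size h hf) hh) hm'.
  by case: eqP => // em; move: hm'; rewrite -em ltnn.
have /rowP/(_ (enum_rank (BMultinom hm'))) := wE.
rewrite !mxE eqxx /= (inj_eq enum_rank_inj) -val_eqE /= eq_sym => <-.
have -> : radix e f h = \sum_i w 0 i *: radix_mon e f (bounded_mon i).
  by rewrite /h linear_sum; apply: eq_bigr => i _; rewrite linearZ /= radixX.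
rewrite raddf_sum; apply: eq_bigr => i _.
by rewrite /= mcoeffZ [radix_mx f D _ _]mxE /bounded_mon enum_rankK.
Qed.

Lemma radix_mx_powers (K : comNzRingType) D :
  radix_mx (fun i => 'X_i ^+ e i : {mpoly K[n]}) D = 1%:M.
Proof.
apply/matrixP => i j; rewrite !mxE (_ : radix_mon _ _ _ = 'X_[bounded_mon i]).
  by rewrite mcoeffX /bounded_mon -bmeqP (inj_eq enum_val_inj).
rewrite /radix_mon mpolyXE_id; apply: eq_bigr => l _.
by rewrite -exprM -exprD addnC mulnC -divn_eq.
Qed.

End RadixMatrix.

(** * A nonempty open set of good families *)

Section GenericForms.
Variables (k : fieldType) (n s : nat) (d : 'I_s -> nat).
Hypothesis k_infinite : forall l : seq k, exists x, x \notin l.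
Hypothesis d_gt0 : forall i, (0 < d i)%N.
Local Notation index_type := (coef_index n d).
Local Notation K := {mpoly k[#|{: index_type}|]}.
Local Notation forms := (forms k n d).

Lemma infinite_nonroot (p : {poly k}) : p != 0 -> exists x, p.[x] != 0.
Proof.
move=> p0; apply: NNPP => h.
have roots x : root p x.
  by apply/negPn/negP => hx; apply: h; exists x.
have [l ul sl] : exists2 l : seq k, uniq l & size l = size p.
  elim: (size p) => [|m [l ul sl]]; first by exists [::].
  by have [x hx] := k_infinite l; exists (x :: l); rewrite /= ?hx ?sl.
have := max_poly_roots p0 (introT allP (fun x _ => roots x)) ul.
by rewrite sl ltnn.
Qed.

Definition line (F F' : forms) (t : k) : forms := fun i => F i + t *: (F' i - F i).

Lemma line_coefs F F' t j :
  form_coefs (line F F' t) j = form_coefs F j + t * (form_coefs F' j - form_coefs F j).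
Proof. by rewrite /form_coefs /line /= mcoeffD mcoeffZ mcoeffB. Qed.

(** On the line through F and F' both polynomials restrict to nonzero polynomials in one variable,
    whose product has a nonroot in the infinite field. *)
Lemma nonvanishing_both (q q' : K) (F F' : forms) :
  q.@[form_coefs F] != 0 -> q'.@[form_coefs F'] != 0 ->
  exists F'' : forms, (q * q').@[form_coefs F''] != 0.
Proof.
move=> hq hq'.
pose L j : {poly k} := (form_coefs F j)%:P + 'X * (form_coefs F' j - form_coefs F j)%:P.
pose P (g : K) : {poly k} := mmap (@polyC k) L g.
have PE g t : (P g).[t] = g.@[form_coefs (line F F' t)].
  rewrite /P /mmap -[(_).[t]]/(horner_eval t _) raddf_sum mevalE /=.
  apply: eq_bigr => m _; rewrite /horner_eval hornerM hornerC; congr (_ * _).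
  rewrite /mmap1 -[(_).[t]]/(horner_eval t _) rmorph_prod; apply: eq_bigr => j _ /=.
  rewrite rmorphXn /= /horner_eval /L !hornerE line_coefs; congr (_ ^+ _).
have line0 : form_coefs (line F F' 0) =1 form_coefs F.
  by move=> j; rewrite line_coefs mul0r addr0.
have line1 : form_coefs (line F F' 1) =1 form_coefs F'.
  by move=> j; rewrite line_coefs mul1r addrC subrK.
have Pq : P q != 0.
  by apply: contraNneq hq => e0; rewrite -(meval_eq _ line0) -PE e0 horner0.
have Pq' : P q' != 0.
  by apply: contraNneq hq' => e0; rewrite -(meval_eq _ line1) -PE e0 horner0.
have [t ht] := infinite_nonroot (mulf_neq0 Pq Pq').
by exists (line F F' t); rewrite mevalM -!PE -hornerM.
Qed.

Lemma nonvanishing_prod (I : eqType) (r : seq I) (q : I -> K) :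
  (forall i, i \in r -> exists F : forms, (q i).@[form_coefs F] != 0) ->
  exists F : forms, (\prod_(i <- r) q i).@[form_coefs F] != 0.
Proof.
elim: r => [|i r IH] h.
  by exists (fun i => 0); rewrite big_nil meval1 oner_neq0.
have [F hF] := h i (mem_head _ _).
have [|F' hF'] := IH; first by move=> j hj; apply: h; rewrite inE hj orbT.
by have [F'' hF''] := nonvanishing_both hF hF'; exists F''; rewrite big_cons.
Qed.

(** The form with indeterminate coefficients. Terms of degree below [d i] are present, as in
    [coef_index], and vanish on specialization to a form. *)
Definition generic_form (i : 'I_s) : {mpoly K[n.+1]} :=
  \sum_(m : 'X_{1..n.+1 < (d i).+1})
    'X_(enum_rank (Tagged (fun i => 'X_{1..n.+1 < (d i).+1}) m : index_type)) *: 'X_[m].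

Lemma generic_formE (F : forms) i :
  map_mpoly (meval (form_coefs F)) (generic_form i) = F i.
Proof.
have hF : (msize (F i : {mpoly k[n.+1]}) <= (d i).+1)%N.
  exact: homog_msize_leq (dhomog_is_dhomog _).
rewrite [RHS](mpolywE hF) raddf_sum; apply: eq_bigr => m _ /=.
by rewrite map_mpolyZ map_mpolyX /= mevalXU /form_coefs enum_rankK.
Qed.

Definition generic_slot (b : seq 'I_s) (i : 'I_n.+1) : {mpoly K[n.+1]} :=
  oapp generic_form 'X_i (onth b i).

Lemma generic_slotE (F : forms) b i :
  map_mpoly (meval (form_coefs F)) (generic_slot b i) = slot_form (fun i => F i) b i.
Proof.
rewrite /generic_slot /slot_form; case: onth => [j|] /=; first exact: generic_formE.
by rewrite map_mpolyX.
Qed.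

Definition good_det (b : seq 'I_s) D : K := \det (radix_mx (slot_deg d b) (generic_slot b) D).

Lemma good_detE (F : forms) b D : (good_det b D).@[form_coefs F] =
  \det (radix_mx (slot_deg d b) (slot_form (fun i => F i) b) D).
Proof.
by rewrite /good_det -det_map_mx (map_radix_mx _ _ (generic_slotE F b)).
Qed.

Lemma power_homog b i :
  ('X_(inord (index i b)) ^+ d i : {mpoly k[n.+1]}) \is (d i).-homog.
Proof. by rewrite mpolyXn dhomogX /= mdegMn mdeg1 mul1n. Qed.

(** The witness takes as l-th member of b a power of the l-th variable, which makes the matrix the
    identity. *)
Lemma good_det_neq0 b D : uniq b -> (size b <= n.+1)%N ->
  exists F : forms, (good_det b D).@[form_coefs F] != 0.
Proof.
move=> ub sb; exists (fun i => DHomog (power_homog b i)); rewrite good_detE.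
rewrite (_ : radix_mx _ _ _ = 1%:M) ?det1 ?oner_neq0 //.
rewrite -(radix_mx_powers (slot_deg d b) k D); apply/matrixP => i j; rewrite !mxE.
congr (_@_ _); apply: eq_bigr => l _; congr (_ * _ ^+ _).
rewrite /slot_form /slot_deg; case eo : (onth b l) => [t|] /=; last by rewrite expr1.
have hl : (l < size b)%N by rewrite -onthTE eo.
have et : nth t b l = t by apply: onth_nth.
by rewrite -{1}et index_uniq // inord_val.
Qed.

(** One more than the largest D in [radix_mx_unit], since [iota] excludes its end. *)
Definition det_bound b := (\sum_(i < n.+1) (slot_deg d b i).-1).+3.

Definition short_lists : seq (seq 'I_s) :=
  [seq b <- flatten [seq [seq val t | t <- enum {: c.-tuple 'I_s}] | c <- iota 0 n.+2] | uniq b].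

Lemma mem_short_lists b : (b \in short_lists) = uniq b && (size b <= n.+1)%N.
Proof.
rewrite mem_filter; congr (_ && _); apply/flatten_mapP/idP.
  by case=> c; rewrite mem_iota => /andP[_ hc] /mapP[t _ ->]; rewrite size_tuple -ltnS.
move=> sb; exists (size b); first by rewrite mem_iota.
by apply/mapP; exists (in_tuple b); rewrite ?mem_enum.
Qed.

Definition generic_det : K :=
  \prod_(b <- short_lists) \prod_(D <- iota 0 (det_bound b)) good_det b D.

(** The open set is the nonvanishing locus of one product of determinants, each of which is nonzero
    at some family. *)
Lemma good_generic (P : forms -> Prop) :
  (forall F : forms, good d (fun i => F i : {mpoly k[n.+1]}) -> P F) -> for_general_forms P.
Proof.
move=> hP; exists (fun F => generic_det.@[form_coefs F] != 0); split.
- exists (eq generic_det) => F; split=> [h|[p <- //]].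
  by exists generic_det.
- apply: nonvanishing_prod => b; rewrite mem_short_lists => /andP[ub sb].
  by apply: nonvanishing_prod => D _; apply: good_det_neq0.
move=> F hF; apply: hP => b ub sb.
apply: radix_mx_unit.
- by move=> i; apply: slot_deg_gt0.
- by move=> i; apply: slot_form_size => // j; apply: dhomog_is_dhomog.
move=> D hD; rewrite -good_detE; apply: contraNneq hF => e0.
have hb : b \in short_lists by rewrite mem_short_lists ub.
have hD' : D \in iota 0 (det_bound b) by rewrite mem_iota add0n ltnS.
rewrite /generic_det (perm_big _ (perm_to_rem hb)) big_cons mevalM.
by rewrite (perm_big _ (perm_to_rem hD')) big_cons mevalM e0 !mul0r.
Qed.

End GenericForms.

(** * Shifts of the resolution *)

Section ShiftCombinatorics.

Lemma subsums_nil ds m : (size ds < m)%N -> subsums ds m = [::].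
Proof.
by elim: ds m => [|e ds IH] [|m] //=; rewrite ltnS => h; rewrite !IH // ltnW.
Qed.

(** The recursion of [subsums] splits the subsets of t :: ts into those containing t and those
    avoiding it. *)
Lemma subsums_sets (T : finType) (d : T -> nat) (ts : seq T) m : uniq ts ->
  perm_eq (subsums (map d ts) m)
    [seq (\sum_(i in W) d i)%N |
      W : {set T} <- enum [set W : {set T} | (W \subset [set x in ts]) && (#|W| == m)]].
Proof.
have enum0 (S : {set T}) : [set W : {set T} | (W \subset S) && (#|W| == 0%N)] = [set set0].
  by apply/setP => W; rewrite !inE cards_eq0; case: eqP => [->|]; rewrite ?sub0set ?andbF.
elim: ts m => [|t ts IH] [|m] /=; try by move=> _; rewrite enum0 enum_set1 /= big_set0.
  move=> _; rewrite (_ : [set W : {set T} | _] = set0) ?enum_set0 //; apply/setP => W; rewrite !inE.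
  apply/negbTE; rewrite negb_and; case: (eqVneq #|W| m.+1) => [e|_]; last by rewrite orbT.
  apply/orP; left; apply/negP => /subset_leq_card.
  by rewrite e (_ : [set x in [::]] = set0) ?cards0 //; apply/setP => x; rewrite !inE.
case/andP=> tts uts.
pose S p := [set W : {set T} | (W \subset [set x in ts]) && (#|W| == p)].
have tS p W : W \in S p -> t \notin W.
  by rewrite inE => /andP[/subsetP sW _]; apply: contra tts => /sW; rewrite inE.
have pe : perm_eq (enum [set W : {set T} | (W \subset [set x in t :: ts]) && (#|W| == m.+1)])
                  (map (fun W => t |: W) (enum (S m)) ++ enum (S m.+1)).
  apply: uniq_perm; first exact: enum_uniq.
    rewrite cat_uniq enum_uniq andbT map_inj_in_uniq ?enum_uniq /=; last first.
      move=> W W'; rewrite !mem_enum => /tS h /tS h' /(congr1 (fun V => V :\ t)).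
      by rewrite !setU1K.
    apply/hasPn => W; rewrite mem_enum => /tS h; apply/mapP => -[W' _ eW].
    by move: h; rewrite eW setU11.
  move=> W; rewrite mem_enum mem_cat mem_enum !inE.
  case: (boolP (t \in W)) => tW.
    rewrite [X in _ || X](_ : _ = false) ?orbF; last first.
      by apply/negP => h; move: (@tS m.+1 W); rewrite inE tW => /(_ h).
    apply/idP/mapP.
      case/andP=> /subsetP sW /eqP cW; exists (W :\ t); last by rewrite setD1K.
      rewrite mem_enum inE; apply/andP; split.
        apply/subsetP => x; rewrite !inE => /andP[xt /sW].
        by rewrite !inE (negPf xt).
      by move: cW; rewrite (cardsD1 t W) tW add1n => -[->].
    case=> W'; rewrite mem_enum => hW' eW; have := tS _ _ hW'; move: hW'.
    rewrite inE => /andP[/subsetP sW /eqP cW] tW'; rewrite eW cardsU1 tW' cW eqxx andbT.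
    by apply/subsetP => x; rewrite !inE => /orP[->//|/sW]; rewrite inE => ->; rewrite orbT.
  rewrite [X in X || _](_ : _ = false); last first.
    by apply/negP => /mapP[W' _ eW]; move: tW; rewrite eW setU11.
  congr (_ && _); apply/subsetP/subsetP => h x xW; have := h x xW; rewrite !inE.
    by case: eqP => [ext|//]; move: tW; rewrite -ext xW.
  by move->; rewrite orbT.
rewrite perm_sym; apply: perm_trans (perm_map _ pe) _.
rewrite map_cat perm_cat //; last by rewrite perm_sym; apply: IH.
rewrite perm_sym; apply: perm_trans (perm_map _ (IH m uts)) _.
rewrite -!map_comp (eq_in_map _ (fun W => (\sum_(i in t |: W) d i)%N) _).1 //.
by move=> W; rewrite mem_enum => /tS h /=; rewrite big_setU1.
Qed.

(** Complementation: the total degree minus a sum over r - l - 1 indices is the sum over the other s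
    - r + 1 + l. The offset of l is due to positions starting at 0. *)
Lemma star_module_shifts s (d : 'I_s -> nat) r l : (r <= s)%N -> (l < r)%N ->
  perm_eq (star_module d r l.+1) (star_shifts (map d (enum 'I_s)) (s - r).+1 l).
Proof.
move=> rs lr; apply/permP => a; rewrite count_star_shifts /star_module count_flatten.
rewrite -map_comp sumnE big_map (eq_bigr (fun B : {set 'I_s} =>
  star_alpha s r l.+1 * a (\sum_(i < s) d i - \sum_(i in B) d i))%N); last first.
  by move=> B _; rewrite /= count_nseq mulnC.
rewrite -big_distrr /= (_ : star_alpha _ _ _ = 'C((s - r).+1 + l - 1, l)); last first.
  by rewrite /star_alpha; congr 'C(_, _); lia.
congr (_ * _)%N; rewrite (permP (subsums_sets _ _ (enum_uniq _))).
rewrite -sum1_count big_map [RHS]big_mkcond /= !big_enum (reindex_inj (inv_inj (@setCK _))) /=.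
apply: eq_big => W; rewrite !inE.
  rewrite (_ : [set x in enum 'I_s] = setT) ?subsetT /=; last first.
    by apply/setP => i; rewrite !inE mem_enum.
  have := cardsC W; rewrite card_ord; move: #|W| #|~: W| => x y exy.
  by apply/eqP/eqP; lia.
move=> _; rewrite (bigID (fun i => i \in W)) /=.
rewrite [X in (_ + X - _)%N](eq_bigl (fun i => i \in ~: W)); last by move=> i; rewrite inE.
by rewrite addnK; case: (a _).
Qed.

End ShiftCombinatorics.

Lemma cx_resolves_ext (k : fieldType) n (C : cx k n) (J J' : {mpoly k[n.+1]} -> Prop) :
  (forall f, J f <-> J' f) -> cx_resolves C J -> cx_resolves C J'.
Proof. by move=> JJ [h1 h2 h3]; split=> // f; rewrite -JJ. Qed.

(** * Resolution and levelness of star configurations *)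

Section StarResolution.
Variables (k : fieldType) (n s : nat) (d : 'I_s -> nat) (F : forms k n d) (r : nat).
Hypothesis d_gt0 : forall i, (0 < d i)%N.
Hypothesis goodF : good d (fun i => F i : {mpoly k[n.+1]}).
Hypotheses (r_gt0 : (0 < r)%N) (r_le : (r <= minn s n)%N).

Lemma star_resolution : min_graded_free_resolution (star_ideal r F) r (star_module d r).
Proof.
have /andP[rs rn] : (r <= s)%N && (r <= n)%N by rewrite -leq_min.
have reg := regular_upto_forms d_gt0 goodF rn.
have [C [phi hC]] := star_complex d_gt0 (@form_homog _ _ _ _ F) (enum_uniq 'I_s) reg.
have [linC gC mC _ [_ rC dC]] := hC (s - r).+1.
have e : (size (enum 'I_s)).+1 = ((s - r).+1 + r)%N by rewrite size_enum_ord; lia.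
apply: (cx_min_resolution r_gt0 linC gC mC).
- apply: cx_resolves_ext (rC _); last by rewrite -e.
  move=> f; rewrite star_idealE (star_prods (zero_is_ideal _) (enum_uniq _) reg e).
  by split=> [hf|[y [z [-> hz ->]]]]; [exists 0, f; rewrite add0r | rewrite add0r].
(* Position r would require sums of s + 1 out of s degrees, so its module is zero. *)
- apply: perm_nilP; apply: perm_trans (dC r) _; rewrite /star_shifts subsums_nil.
    by elim: 'C(_, _).
  by rewrite size_map -e.
- move=> l lr; apply: perm_trans (star_module_shifts d rs lr) _.
  by rewrite perm_sym.
Qed.

Lemma star_moduleT : star_module d r r = nseq (star_alpha s r r) (\sum_(i < s) d i)%N.
Proof.
rewrite /star_module subnn (_ : [set B : {set 'I_s} | _] = [set set0]); last first.
  by apply/setP => B; rewrite !inE cards_eq0.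
by rewrite enum_set1 /= cats0 big_set0 subn0.
Qed.

Lemma star_level : level (star_ideal r F).
Proof.
split; first exact: star_CM.
have /andP[rs rn] : (r <= s)%N && (r <= n)%N by rewrite -leq_min.
exists r, (star_module d r), (\sum_(i < s) d i)%N; split; first exact: star_resolution.
  rewrite star_moduleT => /(congr1 size)/eqP; rewrite size_nseq.
  by apply/negP; rewrite -lt0n bin_gt0; lia.
by rewrite star_moduleT all_nseq /= eqxx orbT.
Qed.

End StarResolution.

Lemma size_star_module s (d : 'I_s -> nat) r l :
  size (star_module d r l) = ('C(s - r + l - 1, l - 1) * 'C(s, r - l))%N.
Proof.
rewrite size_flatten /shape -map_comp (eq_map (g := fun=> star_alpha s r l)); last first.
  by move=> B; rewrite /= size_nseq.
rewrite sumnE big_map big_const_seq count_predT iter_addn_0 -cardE card_draws card_ord.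
by [].
Qed.

Unset Implicit Arguments.
Set Strict Implicit.
Local Close Scope ring_scope.

Theorem theorem3p6 (k : fieldType)
    (k_infinite : forall l : seq k, exists x, x \notin l)
    (n s : nat) (d : 'I_s -> nat) (d_pos : forall i, 0 < d i) :
  (forall r : nat, 2 <= r <= minn s n ->
    [/\ for_general_forms (fun F : forms k n d =>
          min_graded_free_resolution (star_ideal r F) r (star_module d r)
          /\ level (star_ideal r F)),
        (forall l, 1 <= l <= r ->
          size (star_module d r l) = 'C(s - r + l - 1, l - 1) * 'C(s, r - l)),
        star_alpha s r 1 = 1
      & star_module d r r = nseq (star_alpha s r r) (\sum_(i < s) d i)])
  /\
  (forall r : nat, 1 <= r <= minn s n ->
    for_general_forms (fun F : forms k n d =>
      arithmetically_CM (star_ideal r F))).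
Proof.
split=> r /andP[r_gt r_le].
  split.
  (* [good] does not mention r, so one open set serves all r and both assertions. *)
  - apply: good_generic => // F goodF.
    by split; [apply: star_resolution | apply: star_level] => //; apply: ltnW.
  - by move=> l _; apply: size_star_module.
  - by rewrite /star_alpha subnn bin0.
  - exact: star_moduleT.
by apply: good_generic => // F goodF; apply: star_CM.
Qed.
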